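(* Let $\Sigma^{m}$ be a closed submanifold in the product space $\mathbb{S}^{n}\times\mathbb{R}$. Then $$\int_{\Sigma}f\,\square^{\ast}(\xi)\,d\Sigma=\int_{\Sigma}\langle\square(f),\xi\rangle\, d\Sigma+(m-1)\int_{\Sigma}\left(f\langle\nabla^{\perp}_{T}\xi,N\rangle-\langle N,\xi\rangle\langle\nabla f,T\rangle\right)d\Sigma$$ for all $f\in\mathcal{C}^{2}(\Sigma)$ and all (smooth) normal vector fields $\xi$ on $\Sigma$.
   Context: $\mathbb{S}^n\times\mathbb{R}$ is the Riemannian product of the unit sphere and the real line, with metric $\langle\,,\rangle$, and $\partial_t$ is the parallel unit vector field tangent to $\mathbb{R}$. Along a submanifold $\Sigma^m$, $\partial_t=T+N$ with $T$ tangent and $N$ normal to $\Sigma$. $\sigma$ is the second fundamental form, $\nabla$ the Levi-Civita connection of $\Sigma$ (also $\nabla f$ is the gradient of $f$), and $\nabla^\perp$ the normal connection. $A_\xi$ is the Weingarten operator, $\langle A_\xi X,Y\rangle=\langle\sigma(X,Y),\xi\rangle$. $h=\frac1m\mathrm{tr}(\sigma)$ is the mean curvature vector field. $\{e_{m+1},\dots,e_{n+1}\}$ is a (local) orthonormal frame of the normal bundle, $A_\alpha=A_{e_\alpha}$ and $H^\alpha=\langle h,e_\alpha\rangle$. Define the symmetric normal-bundle-valued tensor $P(X,Y)=m\langle X,Y\rangle h-\sigma(X,Y)$ and the operators $P_\alpha=mH^\alpha I-A_\alpha$ on tangent vector fields. For a normal field $\xi$, $\square^*(\xi)=\langle P,\nabla^2\xi\rangle=\sum_{i,j}\langle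 P(e_i,e_j),\nabla^2\xi(e_i,e_j)\rangle$ (Hilbert-Schmidt inner product, $\{e_1,\dots,e_m\}$ a tangent orthonormal frame), where $\nabla^2\xi(X,Y)=\nabla^\perp_X\nabla^\perp_Y\xi-\nabla^\perp_{\nabla_XY}\xi$. For a function $f$, $\square(f)=\sum_{\alpha}\mathrm{tr}(P_\alpha\circ\mathrm{Hess}\,f)\,e_\alpha$, a normal vector field. *)

(* Defs.v *)
From HB Require Import structures.
From mathcomp Require Import all_boot all_order all_algebra.
From mathcomp Require Import all_classical all_reals all_analysis.
From mathcomp Require Import measurable_realfun.

Set Implicit Arguments.
Unset Strict Implicit.
Unset Printing Implicit Defensive.

Import Order.TTheory GRing.Theory Num.Theory.
Import numFieldNormedType.Exports.

Local Open Scope classical_set_scope.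
Local Open Scope ring_scope.

Definition pderiv (R : realType) (m : nat) (W : normedModType R)
    (i : 'I_m) (f : 'rV[R]_m -> W) (u : 'rV[R]_m) : W :=
  'D_(delta_mx 0 i) f u.

(* Class C^k, meaningful for open V: all iterated partial derivatives of order at most k
   exist and are continuous at every point of V. *)
Fixpoint class_C (R : realType) (m : nat) (W : normedModType R) (k : nat)
    (V : set 'rV[R]_m) (f : 'rV[R]_m -> W) {struct k} : Prop :=
  (forall u, V u -> {for u, continuous f}) /\
  match k with
  | 0 => True
  | k'.+1 => forall i : 'I_m,
      (forall u, V u -> derivable f u (delta_mx 0 i)) /\
      class_C k' V (pderiv i f)
  end.

(* The integral of a nonnegative Borel function against the Lebesgue measure
   of R^m, as an iterated integral (Tonelli). *)
Fixpoint lebesgue_int (R : realType) (m : nat) :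
    ('rV[R]_m -> \bar R) -> \bar R :=
  match m return ('rV[R]_m -> \bar R) -> \bar R with
  | 0 => fun f => f 0
  | k.+1 => fun f =>
      (\int[@lebesgue_measure R]_t
         lebesgue_int (fun v : 'rV[R]_k => f (row_mx (t%:M : 'rV[R]_1) v)))%E
  end.

Definition dot (R : realType) (d : nat) (v w : 'rV[R]_d) : R :=
  (v *m w^T) 0 0.

(* A smooth manifold structure on M modelled on R^m: par c, used only on the
   open set coor c @` dom c, is the local parametrization inverse to the
   chart coor c. A chart around each point is singled out in order to evaluate
   tensors there; all tensors below are independent of it. *)
Record manifold (R : realType) (m : nat) (M : topologicalType) := Manifold {
  chart : Type;
  dom : chart -> set M;
  coor : chart -> M -> 'rV[R]_m;
  par : chart -> 'rV[R]_m -> M;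
  dom_open : forall c, open (dom c);
  im_open : forall c, open (coor c @` dom c);
  coorK : forall c p, dom c p -> par c (coor c p) = p;
  coor_continuous : forall c p, dom c p -> {for p, continuous (coor c)};
  par_continuous : forall c u, (coor c @` dom c) u ->
    {for u, continuous (par c)};
  transition_smooth : forall c c' k,
    class_C k (coor c @` (dom c `&` dom c')) (coor c' \o par c);
  chart_at : M -> chart;
  chart_atP : forall p, dom (chart_at p) p
}.

Definition im (R : realType) (m : nat) (M : topologicalType)
    (S : manifold R m M) (c : chart S) : set 'rV[R]_m := coor c @` dom c.

Definition class_C_on (R : realType) (m : nat) (M : topologicalType)
    (S : manifold R m M) (W : normedModType R) (k : nat) (g : M -> W) : Prop :=
  forall c : chart S, class_C k (im c) (g \o par c).

(* S^n x R is realized in R^(n+2) = R^(n+1) x R, the last coordinate being t. *)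
Definition in_SnR (R : realType) (n : nat) (y : 'rV[R]_(n.+1 + 1)) : Prop :=
  dot (lsubmx y) (lsubmx y) = 1.

Definition d_t (R : realType) (n : nat) : 'rV[R]_(n.+1 + 1) :=
  row_mx 0 (1%:M : 'rV[R]_1).

(* The unit normal of S^n x R in R^(n+2) at the point y. *)
Definition SnR_normal (R : realType) (n : nat) (y : 'rV[R]_(n.+1 + 1)) :
    'rV[R]_(n.+1 + 1) :=
  row_mx (lsubmx y) 0.

(* The orthogonal projection of R^(n+2) onto T_y(S^n x R). Composed with the
   flat derivative, it is the Levi-Civita connection of S^n x R. *)
Definition SnR_proj (R : realType) (n : nat) (y v : 'rV[R]_(n.+1 + 1)) :
    'rV[R]_(n.+1 + 1) :=
  v - dot v (SnR_normal y) *: SnR_normal y.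

(* Coordinate expressions at u for an immersion F of an open subset of R^m
   into S^n x R; indices refer to the coordinate fields d_i F. *)
Section Local.
Context (R : realType) (m n : nat).
Local Notation E := 'rV[R]_(n.+1 + 1).
Context (F : 'rV[R]_m -> E).

Definition jac (u : 'rV[R]_m) : 'M[R]_(m, n.+1 + 1) :=
  \matrix_i pderiv i F u.

Definition metric (u : 'rV[R]_m) : 'M[R]_m := jac u *m (jac u)^T.

Definition christoffel (u : 'rV[R]_m) (i j k : 'I_m) : R :=
  2^-1 * \sum_l invmx (metric u) k l *
    (pderiv i (fun v => metric v j l : R^o) u
     + pderiv j (fun v => metric v i l : R^o) u
     - pderiv l (fun v => metric v i j : R^o) u).

(* The components of the orthogonal projection of v on the tangent space. *)
Definition comps (u : 'rV[R]_m) (v : E) : 'rV[R]_m :=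
  v *m (jac u)^T *m invmx (metric u).

Definition tan_part (u : 'rV[R]_m) (v : E) : E := comps u v *m jac u.

(* The component of v in T(S^n x R) orthogonal to the submanifold. *)
Definition nor_part (u : 'rV[R]_m) (v : E) : E :=
  SnR_proj (F u) v - tan_part u (SnR_proj (F u) v).

Definition loc_sff (u : 'rV[R]_m) (i j : 'I_m) : E :=
  nor_part u (pderiv i (pderiv j F) u).

Definition loc_nconn (i : 'I_m) (xi : 'rV[R]_m -> E) (u : 'rV[R]_m) : E :=
  nor_part u (pderiv i xi u).

Definition loc_nhess (xi : 'rV[R]_m -> E) (u : 'rV[R]_m) (i j : 'I_m) : E :=
  loc_nconn i (loc_nconn j xi) u
  - \sum_k christoffel u i j k *: loc_nconn k xi u.

Definition loc_hess (f : 'rV[R]_m -> R^o) (u : 'rV[R]_m) : 'M[R]_m :=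
  \matrix_(i, j) (pderiv i (pderiv j f) u
                  - \sum_k christoffel u i j k * pderiv k f u).

(* The tangent vector Z such that <Z, Y> = b(X, Y) for all tangent Y, where B
   is the matrix of the bilinear form b. *)
Definition raise (u : 'rV[R]_m) (B : 'M[R]_m) (X : E) : E :=
  comps u X *m B *m invmx (metric u) *m jac u.

End Local.

(* Global objects for x : M -> S^n x R; tangent and normal vectors of the
   immersed manifold are represented by vectors of R^(n+2). *)
Section Submanifold.
Context (R : realType) (m n : nat) (M : topologicalType).
Local Notation E := 'rV[R]_(n.+1 + 1).
Context (S : manifold R m M) (x : M -> E).

Definition immersion : Prop :=
  [/\ forall p, in_SnR (x p),
      forall k, class_C_on S k x &
      forall (c : chart S) u, im c u -> row_free (jac (x \o par c) u)].

Definition loc (p : M) : 'rV[R]_m -> M := par (chart_at S p).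
Definition pt (p : M) : 'rV[R]_m := coor (chart_at S p) p.
Local Notation F p := (x \o loc p).

Definition tangent (p : M) (v : E) : Prop := (v <= jac (F p) (pt p))%MS.

Definition normal (p : M) (v : E) : Prop :=
  dot v (SnR_normal (x p)) = 0 /\ forall w, tangent p w -> dot v w = 0.

Definition orthonormal (k : nat) (e : 'I_k -> E) : Prop :=
  forall i j, dot (e i) (e j) = (i == j)%:R.

Definition tangent_frame (p : M) (e : 'I_m -> E) : Prop :=
  orthonormal e /\ forall i, tangent p (e i).

Definition normal_frame (p : M) (nu : 'I_(n.+1 - m) -> E) : Prop :=
  orthonormal nu /\ forall a, normal p (nu a).

Definition T (p : M) : E := tan_part (F p) (pt p) (d_t R n).
Definition N (p : M) : E := d_t R n - T p.

Definition sff (p : M) (X Y : E) : E :=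
  \sum_i \sum_j (comps (F p) (pt p) X 0 i * comps (F p) (pt p) Y 0 j)
    *: loc_sff (F p) (pt p) i j.

Definition weingarten (p : M) (nu X : E) : E :=
  raise (F p) (pt p)
    (\matrix_(i, j) dot (loc_sff (F p) (pt p) i j) nu) X.

Definition nconn (p : M) (X : E) (xi : M -> E) : E :=
  \sum_i comps (F p) (pt p) X 0 i *: loc_nconn (F p) i (xi \o loc p) (pt p).

Definition nhess (p : M) (xi : M -> E) (X Y : E) : E :=
  \sum_i \sum_j (comps (F p) (pt p) X 0 i * comps (F p) (pt p) Y 0 j)
    *: loc_nhess (F p) (xi \o loc p) (pt p) i j.

Definition grad (f : M -> R) (p : M) : E :=
  (\row_i pderiv i (f \o loc p : _ -> R^o) (pt p))
    *m invmx (metric (F p) (pt p)) *m jac (F p) (pt p).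

Definition hess (f : M -> R) (p : M) (X : E) : E :=
  raise (F p) (pt p) (loc_hess (F p) (f \o loc p) (pt p)) X.

(* In what follows, e is an orthonormal basis of the tangent space at p, and
   nu one of the normal space. *)

Definition mean_curv (p : M) (e : 'I_m -> E) : E :=
  m%:R^-1 *: \sum_i sff p (e i) (e i).

Definition P (p : M) (e : 'I_m -> E) (X Y : E) : E :=
  (m%:R * dot X Y) *: mean_curv p e - sff p X Y.

Definition P_op (p : M) (e : 'I_m -> E) (nu X : E) : E :=
  (m%:R * dot (mean_curv p e) nu) *: X - weingarten p nu X.

Definition tr (e : 'I_m -> E) (L : E -> E) : R := \sum_i dot (L (e i)) (e i).

Definition box_star (e : M -> 'I_m -> E) (xi : M -> E) (p : M) : R :=
  \sum_i \sum_j dot (P p (e p) (e p i) (e p j))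
                    (nhess p xi (e p i) (e p j)).

Definition box (e : M -> 'I_m -> E) (nu : M -> 'I_(n.+1 - m) -> E)
    (f : M -> R) (p : M) : E :=
  \sum_a tr (e p) (P_op p (e p) (nu p a) \o hess f p) *: nu p a.

End Submanifold.

(* The Riemannian measure of the induced metric g: the Borel measure which is
   sqrt(det g) du in every chart. *)
Definition riemannian_measure (R : realType) (m n : nat) (M : ptopologicalType)
    (S : manifold R m M) (x : M -> 'rV[R]_(n.+1 + 1))
    (mu : {measure set (g_sigma_algebraType (@open M)) -> \bar R}) : Prop :=
  forall (c : chart S) (w : g_sigma_algebraType (@open M) -> \bar R),
    measurable_fun [set: g_sigma_algebraType (@open M)] w ->
    (forall p, (0 <= w p)%E) ->
    (\int[mu]_(p in dom c) w p)%E =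
    lebesgue_int ((fun u : 'rV[R]_m =>
      (w (par c u) * (Num.sqrt (\det (metric (x \o par c) u)))%:E)%E)
      \_ (im c)).

(* Main.v *)
(* The vector field W = sum_ij <P(e_i, e_j), f nabla^perp_(e_j) xi - df(e_j) xi> e_i satisfies
   div W = f box^*(xi) - <box(f), xi> + <div P, f nabla^perp xi - df (x) xi>,
   the terms pairing P with df (x) nabla^perp xi cancelling by the symmetry of P. By the
   Codazzi equation of S^n x R, the normal part of div P is -(m - 1) <T, .> N, so the formula
   is the divergence theorem applied to W.

   The pointwise identity is computed extrinsically in R^(n+2): every tensor is expressed in
   the tangential projections of the standard basis, and differentiated along them. The
   divergence theorem is reduced by a partition of unity to a field supported in a chart,
   where Jacobi's formula turns div W sqrt(det g) into a sum of partial derivatives of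
   compactly supported functions. *)

Require Import Defs.
From HB Require Import structures.
From mathcomp Require Import all_boot all_order all_algebra.
From mathcomp Require Import all_classical all_reals all_analysis.
From mathcomp Require Import measurable_realfun.
From mathcomp Require Import ring lra zify.

Import Order.TTheory GRing.Theory Num.Theory.
Import numFieldNormedType.Exports.

Set Implicit Arguments.
Unset Strict Implicit.
Unset Printing Implicit Defensive.

Local Open Scope classical_set_scope.
Local Open Scope ring_scope.

(** * Functions of several real variables *)

(** The frames [e] and [nu], and the chart singled out at a point, are arbitrary choices at each
    point and may jump. Both operators are therefore rewritten through the orthogonal projections
    [Pi] on the tangent space and [Q] on the normal space, which are smooth and equal to E^T E for
    any orthonormal basis stacked as the rows of E. This yields the pointwise identity and also the
    continuity of the integrands, hence their integrability.

    The derivatives [D a] along projected basis vectors are independent of charts, but they do not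
    commute; their commutator is expressed by the derivatives of [Pi]. For a tensor w whose columns
    are tangent, the covariant derivative becomes [Dm a w - Dm a Pi *m w], up to a final projection
    by [Q] when the values are normal.

    The factor m - 1 is a difference of traces: with S the projection of R^(n+2) on R^(n+1), Pi S Pi
    has trace m - |T|^2 and maps T to (1 - |T|^2) T.

    As f is only C^2, the field W is only C^1, and the partition of unity is built in class C^1. *)

Lemma continuous_atP (R : realType) (V : topologicalType) (W : normedModType R)
    (f : V -> W) a :
  {for a, continuous f} <->
  forall e, 0 < e -> \forall w \near a, `|f a - f w| <= e.
Proof. by rewrite /prop_for /continuous_at; split => /cvgrPdist_le. Qed.

Lemma near_ball (R : realType) (V : normedModType R) (a : V) (P : V -> Prop) :
  (\forall w \near a, P w) -> exists2 r : R, 0 < r & forall w, ball a r w -> P w.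
Proof. by move=> /nbhs_ballP[r r0 rP]; exists r. Qed.

Lemma near_and (V : topologicalType) (a : V) (P Q : V -> Prop) :
  (\forall w \near a, P w) -> (\forall w \near a, Q w) ->
  \forall w \near a, P w /\ Q w.
Proof. exact: filterI. Qed.

Lemma ler_dist_half (R : realType) (e A B C : R) :
  `|A - B| <= e / 2 -> `|C - B| <= e / 2 -> `|A - C| <= e.
Proof.
move=> AB CB; rewrite (splitr e) (le_trans (ler_distD B _ _)) // lerD //.
by rewrite distrC.
Qed.

Section PartialDerivatives.
Context (R : realType) (m : nat).
Local Notation E := 'rV[R]_m.
Implicit Types (f g : E -> R^o) (u v w : E) (i j k : 'I_m).

Local Notation d_ i := (delta_mx 0 i : E).

Lemma is_derive_line f u w t : derivable f (u + t *: w) w ->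
  is_derive t 1 (fun s : R => f (u + s *: w) : R^o) ('D_w f (u + t *: w)).
Proof.
move=> df.
have E1 : (fun h : R => h^-1 *: (((fun s : R => f (u + s *: w) : R^o) \o shift t) (h *: (1:R)) - f (u + t *: w))) =
   (fun h : R => h^-1 *: ((f \o shift (u + t *: w)) (h *: w) - f (u + t *: w))).
  apply/funext => h /=; congr (_ *: (f _ - _)).
  by rewrite [h *: 1]mulr1 scalerDl addrCA.
apply: DeriveDef; first by rewrite /derivable E1.
by rewrite /derive E1.
Qed.

(** The bound on |s| by |t| covers both signs of t at once, so that difference quotients need no
    case distinction later. *)
Lemma mvt_norm (g dg : R -> R) t :
  (forall s, `|s| <= `|t| -> is_derive s (1 : R) (g : R -> R^o) (dg s)) ->
  exists2 s, `|s| <= `|t| & g t - g 0 = t * dg s.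
Proof.
move=> dgP.
have cg a b : (forall s, s \in `[a, b] -> `|s| <= `|t|) -> {within `[a, b], continuous g}.
  move=> st; apply: derivable_within_continuous => s /st /dgP; exact: @ex_derive.
have [t0|t0] := leP 0 t.
  have st s : s \in `[0, t] -> `|s| <= `|t|.
    by rewrite in_itv /= => /andP[s0 st]; rewrite !ger0_norm.
  have dg' s : s \in `]0, t[%R -> is_derive s (1:R) (g : R -> R^o) (dg s).
    by move=> s0; apply: dgP; apply: st; apply: subset_itv_oo_cc s0.
  have [s /st ss] := MVT_segment t0 dg' (cg _ _ st).
  by rewrite subr0 => ->; exists s => //; rewrite mulrC.
have st s : s \in `[t, 0] -> `|s| <= `|t|.
  by rewrite in_itv /= => /andP[s0 st]; rewrite !ler0_norm ?lerN2// ltW.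
have dg' s : s \in `]t, 0[%R -> is_derive s (1:R) (g : R -> R^o) (dg s).
  by move=> s0; apply: dgP; apply: st; apply: subset_itv_oo_cc s0.
have [s /st ss] := MVT_segment (ltW t0) dg' (cg _ _ st).
move=> e; exists s => //.
by rewrite -opprB e sub0r mulrN opprK mulrC.
Qed.

Lemma mvt_line f u w t :
  (forall s, `|s| <= `|t| -> derivable f (u + s *: w) w) ->
  exists2 s, `|s| <= `|t| & f (u + t *: w) - f u = t * 'D_w f (u + s *: w).
Proof.
move=> df.
have [s st e] := mvt_norm (fun s st => is_derive_line (df s st)).
by exists s => //; rewrite -e scale0r addr0.
Qed.

Lemma norm_delta_mx_le i t : `|t *: d_ i| <= `|t|.
Proof.
rewrite normrZ ler_piMr// [leLHS]mx_normrE bigmax_le// => -[a b] _.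
by rewrite mxE; case: (_ && _); rewrite ?normr1 ?normr0.
Qed.

(* The k-th vertex of a path from a to v changing one coordinate at a time. *)
Definition splice (a v : E) (k : nat) : E :=
  \row_l (if (l < k)%N then v 0 l else a 0 l).

Lemma splice0 a v : splice a v 0 = a.
Proof. by apply/rowP => l; rewrite mxE. Qed.

Lemma splice_full a v : splice a v m = v.
Proof. by apply/rowP => l; rewrite mxE ltn_ord. Qed.

Lemma spliceS a v k : splice a v k.+1 = splice a v k + (v 0 k - a 0 k) *: d_ k.
Proof.
apply/rowP => l; rewrite !mxE eqxx /= ltnS leq_eqVlt -val_eqE /=.
by case: ltngtP => [||/val_inj ->] /=; rewrite ?(mulr0, mulr1, addr0) ?subrKC.
Qed.

(** The increment telescopes along the path of [splice], and [D k v] is the difference quotient on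
    its k-th leg; the mean value theorem makes it continuous at a. This form of differentiability
    turns the chain rule into a limit of finite sums of products. *)
Lemma caratheodory f a :
  (forall k, \forall w \near a, derivable f w (d_ k)) ->
  (forall k, {for a, continuous (pderiv k f)}) ->
  exists D : 'I_m -> E -> R^o,
    [/\ forall k, {for a, continuous (D k)}, forall k, D k a = pderiv k f a &
        forall v, f v - f a = \sum_k (v 0 k - a 0 k) * D k v].
Proof.
move=> df cf.
pose D k v : R^o := if v 0 k == a 0 k then pderiv k f a
  else (f (splice a v k.+1) - f (splice a v k)) / (v 0 k - a 0 k).
have Da k : D k a = pderiv k f a by rewrite /D eqxx.
exists D; split => // [k|v]; last first.
  rewrite -{1}(splice_full a v) -{2}(splice0 a v).
  rewrite -(telescope_sumr (fun n : nat => f (splice a v n))) // big_mkord.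
  apply: eq_bigr => k _; rewrite /D; case: eqP => [e|/eqP ne].
    by rewrite spliceS e subrr scale0r addr0 subrr mul0r.
  by rewrite mulrC divfK // subr_eq0.
apply/continuous_atP => e e0; rewrite Da.
have /continuous_atP /(_ _ e0) ce := cf k.
have [r r0 rP] := near_ball (near_and (df k) ce).
have := nbhsx_ballx a _ r0; apply: filterS => v av; rewrite /D; case: eqP => [|/eqP ne].
  by rewrite subrr normr0 ltW.
have inr s : `|s| <= `|v 0 k - a 0 k| -> ball a r (splice a v k + s *: d_ k).
  move=> sv; split => // i j; rewrite ord1 !mxE eqxx /=.
  have [_ {}av] := av; have := av 0 j; rewrite /ball /= => avj.
  case: (ltngtP j k) => [jk|jk|/val_inj jk].
  - by rewrite -val_eqE /= (ltn_eqF jk) mulr0 addr0.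
  - by rewrite -val_eqE /= (gtn_eqF jk) mulr0 addr0 subrr normr0.
  - rewrite jk eqxx mulr1 opprD addrA subrr sub0r normrN.
    by rewrite (le_lt_trans sv) // distrC -jk.
rewrite spliceS.
have [s /inr /rP[_ sP]] := mvt_line (fun s ss => (rP _ (inr s ss)).1).
move=> ->; rewrite mulrC mulKf ?subr_eq0 //; exact: sP.
Qed.

(** The second difference of f on a small square equals h^2 times either mixed derivative at some
    point near a, by the mean value theorem used once in each direction. Continuity at a then
    identifies the two values. *)
Lemma schwarz f a i j :
  (\forall w \near a, derivable f w (d_ i) /\ derivable f w (d_ j)) ->
  (\forall w \near a, derivable (pderiv j f) w (d_ i)) ->
  (\forall w \near a, derivable (pderiv i f) w (d_ j)) ->
  {for a, continuous (pderiv i (pderiv j f))} ->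
  {for a, continuous (pderiv j (pderiv i f))} ->
  pderiv i (pderiv j f) a = pderiv j (pderiv i f) a.
Proof.
move=> df dij dji cij cji.
apply/eqP; rewrite -subr_eq0 -normr_le0; apply/ler_addgt0Pr => e e0.
rewrite add0r; have e2 : 0 < e / 2 by rewrite divr_gt0.
have /continuous_atP /(_ _ e2) c1 := cij.
have /continuous_atP /(_ _ e2) c2 := cji.
have [r r0 rP] := near_ball (near_and (near_and df (near_and dij dji)) (near_and c1 c2)).
(* Two steps of length at most h move a point by at most 2h = r/2, so the square stays in the
   ball. *)
pose h := r / 4; have h0 : 0 < h by rewrite divr_gt0.
have inr s t k l : `|s| <= `|h| -> `|t| <= `|h| -> ball a r (a + s *: d_ k + t *: d_ l).
  move=> sh th; rewrite -ball_normE /= -addrA opprD addrA subrr sub0r normrN.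
  apply: (@le_lt_trans _ _ (h + h)).
    rewrite (le_trans (ler_normD _ _)) // lerD //;
    by rewrite (le_trans (norm_delta_mx_le _ _)) // -[leRHS]gtr0_norm.
  by rewrite /h; lra.
have key k l : (forall w, ball a r w -> derivable f w (d_ l)) ->
    (forall w, ball a r w -> derivable (pderiv l f) w (d_ k)) ->
  exists2 w, ball a r w & f (a + h *: d_ k + h *: d_ l) - f (a + h *: d_ k) - (f (a + h *: d_ l) - f a) = h * h * pderiv k (pderiv l f) w.
  move=> dl dkl.
  pose g t : R := f (a + h *: d_ k + t *: d_ l) - f (a + t *: d_ l).
  have [t th] : exists2 t, `|t| <= `|h| & g h - g 0 = h *
      (pderiv l f (a + h *: d_ k + t *: d_ l) - pderiv l f (a + t *: d_ l)).
    apply: (mvt_norm (dg := fun t => pderiv l f (a + h *: d_ k + t *: d_ l) - pderiv l f (a + t *: d_ l))) => t th.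
    apply: is_deriveB; apply: is_derive_line; apply: dl.
      exact: inr.
    by have := inr 0 t k l; rewrite scale0r addr0 normr0; apply.
  have [s sh ->] : exists2 s, `|s| <= `|h| & pderiv l f (a + h *: d_ k + t *: d_ l) - pderiv l f (a + t *: d_ l) =
     h * pderiv k (pderiv l f) (a + t *: d_ l + s *: d_ k).
    rewrite addrAC; apply: mvt_line => s sh; apply: dkl; exact: inr.
  rewrite /g scale0r !addr0 mulrA => e'.
  by exists (a + t *: d_ l + s *: d_ k); [exact: inr|rewrite -e'; lra].
have [w1 w1r e1] : exists2 w, ball a r w & f (a + h *: d_ i + h *: d_ j) - f (a + h *: d_ i) - (f (a + h *: d_ j) - f a) = h * h * pderiv i (pderiv j f) w.
  by apply: key => w /rP[[[]? ? []] ? ? _].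
have [w2 w2r e2'] : exists2 w, ball a r w & f (a + h *: d_ j + h *: d_ i) - f (a + h *: d_ j) - (f (a + h *: d_ i) - f a) = h * h * pderiv j (pderiv i f) w.
  by apply: key => w /rP[[[]? ? []] ? ? _].
have e12 : pderiv i (pderiv j f) w1 = pderiv j (pderiv i f) w2.
  apply: (@mulfI _ (h * h)); first by rewrite mulf_neq0 ?gt_eqF.
  apply: etrans (esym e1) (etrans _ e2').
  rewrite (addrAC a (h *: d_ j)).
  have swap (A B C D : R) : A - B - (C - D) = A - C - (B - D) by ring.
  exact: swap.
have [_ [w1e _]] := rP _ w1r.
have [_ [_ w2e]] := rP _ w2r.
apply: ler_dist_half w1e _; rewrite e12; exact: w2e.
Qed.

End PartialDerivatives.

Section ChainRule.
Context (R : realType) (V : normedModType R) (m : nat).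
Local Notation E := 'rV[R]_m.

(** The Carathéodory expansion of f at [g a], divided by h, is a finite sum of products whose
    factors converge separately. *)
Lemma is_derive_comp_rV (f : E -> R^o) (g : V -> E) (a v : V) :
  (forall k, \forall w \near g a, derivable f w (delta_mx 0 k)) ->
  (forall k, {for g a, continuous (pderiv k f)}) ->
  (forall k, derivable (fun w => g w 0 k : R^o) a v) ->
  is_derive a v (f \o g : V -> R^o)
    (\sum_k 'D_v (fun w => g w 0 k : R^o) a * pderiv k f (g a)).
Proof.
move=> df cf dg.
have [D [cD Da fD]] := caratheodory df cf.
have dgm : derivable g a v.
  by apply/derivable_mxP => i j; rewrite ord1; exact: dg.
have cg : g (h *: v + a) @[h --> 0^'] --> g a.
  have : {for 0, continuous (fun h : R => g (h *: v + a))}.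
    exact/differentiable_continuous/derivable1_diffP/(derivable1P _ _ _).1.
  by move=> /continuous_withinNx; rewrite scale0r add0r.
suff lim_fg : (fun h : R => h^-1 *: (((f \o g) \o shift a) (h *: v) - (f \o g) a) : R^o) @ 0^'
    --> (\sum_k 'D_v (fun w => g w 0 k : R^o) a * pderiv k f (g a) : R^o).
  by split; [apply/cvg_ex; eexists; exact: lim_fg|exact: cvg_lim lim_fg].
have -> : (fun h : R => h^-1 *: (((f \o g) \o shift a) (h *: v) - (f \o g) a) : R^o) =
   (fun h : R => \sum_k (h^-1 *: (g (h *: v + a) 0 k - g a 0 k : R^o)) * D k (g (h *: v + a))).
  apply/funext => h /=; rewrite fD scaler_sumr; apply: eq_bigr => k _.
  by rewrite scalerAl.
apply: cvg_big => //; first exact: add_continuous.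
move=> k _; apply: cvgM; first exact: dg.
rewrite -Da; apply: cvg_comp cg _; exact: cD.
Qed.

End ChainRule.

Lemma continuous_near_eq (T W : topologicalType) (f g : T -> W) a :
  (\forall w \near a, f w = g w) -> {for a, continuous f} -> {for a, continuous g}.
Proof.
move=> fg; rewrite /prop_for /continuous_at -(nbhs_singleton fg) => cf.
by apply: cvg_trans cf; apply: near_eq_cvg; apply: filterS fg => w ->.
Qed.

Lemma continuous_rV (R : realType) (T : topologicalType) d (g : T -> 'rV[R]_d) a :
  (forall j, {for a, continuous (fun w => g w 0 j : R^o)}) -> {for a, continuous g}.
Proof.
move=> cg; apply/continuous_atP => e e0.
have : \forall w \near a, forall j, `|g a 0 j - g w 0 j| <= e.
  by apply: filter_forall => j; have /continuous_atP := cg j; apply.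
apply: filterS => w gw; rewrite [leLHS]mx_normrE bigmax_le ?ltW // => -[i j] _.
by rewrite !mxE ord1; exact: gw.
Qed.

(** * Stability of the classes C^k under the operations of calculus and linear algebra *)

Section ClassC.
Context (R : realType) (m : nat).
Local Notation E := 'rV[R]_m.
Implicit Types (W : normedModType R) (f g : E -> R^o) (V : set E) (k : nat).

Lemma class_C_cont W k V (f : E -> W) u : class_C k V f -> V u -> {for u, continuous f}.
Proof. by case: k => [|k] [+ _]; apply. Qed.

Lemma class_C_derivable W k V (f : E -> W) i u :
  class_C k.+1 V f -> V u -> derivable f u (delta_mx 0 i).
Proof. by move=> [_ /(_ i)[+ _]]; apply. Qed.

Lemma class_C_pderiv W k V (f : E -> W) i : class_C k.+1 V f -> class_C k V (pderiv i f).
Proof. by move=> [_ /(_ i)[]]. Qed.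

Lemma class_CS W k V (f : E -> W) : class_C k.+1 V f -> class_C k V f.
Proof.
elim: k f => [|k IH] f [cf df]; first by split.
by split => // i; have [di ci] := df i; split => //; exact: IH.
Qed.

Lemma class_C_sub W k V V' (f : E -> W) : V' `<=` V -> class_C k V f -> class_C k V' f.
Proof.
move=> sV; elim: k f => [|k IH] f [cf df].
  by split => // u /sV /cf.
split => [u /sV /cf //|i].
by have [di ci] := df i; split => [u /sV /di|]; last exact: IH.
Qed.

Lemma pderiv_eq_on W V (f g : E -> W) i u : open V -> (forall v, V v -> f v = g v) ->
  V u -> pderiv i f u = pderiv i g u.
Proof.
move=> oV fg Vu; apply: near_eq_derive; apply: filterS (open_nbhs_nbhs (conj oV Vu)).
exact: fg.
Qed.

Lemma derivable_eq_on W V (f g : E -> W) i u : open V -> (forall v, V v -> f v = g v) ->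
  V u -> derivable f u (delta_mx 0 i) -> derivable g u (delta_mx 0 i).
Proof.
move=> oV fg Vu; apply: near_eq_derivable; apply: filterS (open_nbhs_nbhs (conj oV Vu)).
exact: fg.
Qed.

Lemma class_C_eq W k V (f g : E -> W) : open V -> (forall u, V u -> f u = g u) ->
  class_C k V f -> class_C k V g.
Proof.
move=> oV; have ceq (f' g' : E -> W) u : (forall u, V u -> f' u = g' u) -> V u ->
    {for u, continuous f'} -> {for u, continuous g'}.
  move=> fg' Vu; apply: continuous_near_eq; apply: filterS (open_nbhs_nbhs (conj oV Vu)).
  exact: fg'.
elim: k f g => [|k IH] f g fg [cf df].
  by split => // u Vu; exact: ceq fg Vu (cf u Vu).
split => [u Vu|i].
  exact: ceq fg Vu (cf u Vu).
have [di ci] := df i; split => [u Vu|]; first exact: derivable_eq_on fg Vu (di u Vu).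
by apply: IH ci => u Vu; exact: pderiv_eq_on fg Vu.
Qed.

Lemma class_C_coord d k V (F : E -> 'rV[R]_d) j : open V ->
  class_C k V F -> class_C k V (fun u => F u 0 j : R^o).
Proof.
move=> oV; elim: k F => [|k IH] F [cF dF].
  by split => // u Vu; exact: (cvg_comp _ _ (cF u Vu) (@coord_continuous _ _ _ _ _ _)).
split => [u Vu|i].
  exact: (cvg_comp _ _ (cF u Vu) (@coord_continuous _ _ _ _ _ _)).
have [di ci] := dF i; split => [u Vu|].
  by have /derivable_mxP := di u Vu; apply.
apply: class_C_eq (IH _ ci) => // u Vu.
by rewrite /pderiv derive_mx ?mxE//; exact: di.
Qed.

Lemma class_C_cst W k V (w : W) : class_C k V (fun=> w : W).
Proof.
elim: k w => [|k IH] w.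
  by split => // u Vu; exact: cst_continuous.
split => [u Vu|i]; first exact: cst_continuous.
split => [u _|]; first exact: derivable_cst.
by rewrite (_ : pderiv _ _ = fun=> 0) //; apply/funext => u; exact: derive_cst.
Qed.

Lemma class_CD W k V (f g : E -> W) : open V ->
  class_C k V f -> class_C k V g -> class_C k V (fun u => f u + g u).
Proof.
move=> oV; elim: k f g => [|k IH] f g cf cg.
  by split => // u Vu; apply: (continuousD (class_C_cont cf Vu) (class_C_cont cg Vu)).
split => [u Vu|i].
  by apply: (continuousD (class_C_cont cf Vu) (class_C_cont cg Vu)).
have df u := @class_C_derivable _ _ _ _ i u cf.
have dg u := @class_C_derivable _ _ _ _ i u cg.
split => [u Vu|]; first by apply: derivableD; [exact: df|exact: dg].
apply: class_C_eq (IH _ _ (class_C_pderiv i cf) (class_C_pderiv i cg)) => // u Vu.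
by rewrite /pderiv -deriveD; [|exact: df|exact: dg].
Qed.

Lemma class_CM k V f g : open V ->
  class_C k V f -> class_C k V g -> class_C k V (fun u => f u * g u : R^o).
Proof.
move=> oV; elim: k f g => [|k IH] f g cf cg.
  by split => // u Vu; apply: (continuousM (class_C_cont cf Vu) (class_C_cont cg Vu)).
split => [u Vu|i].
  by apply: (continuousM (class_C_cont cf Vu) (class_C_cont cg Vu)).
have df u := @class_C_derivable _ _ _ _ i u cf.
have dg u := @class_C_derivable _ _ _ _ i u cg.
split => [u Vu|]; first by apply: derivableM; [exact: df|exact: dg].
apply: class_C_eq (class_CD oV (IH _ _ (class_CS cf) (class_C_pderiv i cg)) (IH _ _ (class_CS cg) (class_C_pderiv i cf))) => // u Vu.
by apply/esym/deriveM; [exact: df|exact: dg].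
Qed.

Lemma class_C_sum (I : Type) (r : seq I) (P : pred I) k V (F : I -> E -> R^o) : open V ->
  (forall i, class_C k V (F i)) -> class_C k V (fun u => \sum_(i <- r | P i) F i u : R^o).
Proof.
move=> oV cF; elim: r => [|i r IH].
  by under eq_fun do rewrite big_nil; exact: class_C_cst.
under eq_fun do rewrite big_cons; case: (P i) => //; exact: class_CD.
Qed.

Lemma class_C_prod (I : Type) (r : seq I) (P : pred I) k V (F : I -> E -> R^o) : open V ->
  (forall i, class_C k V (F i)) -> class_C k V (fun u => \prod_(i <- r | P i) F i u : R^o).
Proof.
move=> oV cF; elim: r => [|i r IH].
  by under eq_fun do rewrite big_nil; exact: class_C_cst.
under eq_fun do rewrite big_cons; case: (P i) => //; exact: class_CM.
Qed.

Lemma class_CV k V f : open V -> (forall u, V u -> f u != 0) ->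
  class_C k V f -> class_C k V (fun u => (f u)^-1 : R^o).
Proof.
move=> oV f0; elim: k => [|k IH] cf.
  by split => // u Vu; apply: (continuousV (f0 u Vu) (class_C_cont cf Vu)).
split => [u Vu|i].
  by apply: (continuousV (f0 u Vu) (class_C_cont cf Vu)).
have df u := @class_C_derivable _ _ _ _ i u cf.
split => [u Vu|]; first by apply: derivableV; [exact: f0|exact: df].
have cV := IH (class_CS cf).
have := class_CM oV (class_C_cst k V (-1 : R^o)) (class_CM oV (class_CM oV cV cV) (class_C_pderiv i cf)).
apply: class_C_eq => // u Vu.
rewrite /pderiv deriveV; [|exact: f0|exact: df].
by rewrite mulN1r scaleNr expr2 invfM.
Qed.

Lemma class_C_det n k V (A : E -> 'M[R]_n) : open V ->
  (forall i j, class_C k V (fun u => A u i j : R^o)) -> class_C k V (fun u => \det (A u) : R^o).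
Proof.
move=> oV cA; apply: class_C_sum => // s; apply: class_CM => //; first exact: class_C_cst.
by apply: class_C_prod => // i.
Qed.

(** By Cramer's rule the entries are cofactors divided by a determinant that does not vanish on
    V. *)
Lemma class_C_invmx n k V (A : E -> 'M[R]_n) i j : open V ->
  (forall u, V u -> A u \in unitmx) ->
  (forall i j, class_C k V (fun u => A u i j : R^o)) ->
  class_C k V (fun u => invmx (A u) i j : R^o).
Proof.
move=> oV uA cA.
have : class_C k V (fun u => (\det (A u))^-1 * ((-1) ^+ (j + i) * \det (row' j (col' i (A u)))) : R^o).
  apply: class_CM => //.
    by apply: class_CV => // [u /uA|]; [rewrite unitmxE unitfE|exact: class_C_det].
  apply: class_CM => //; first exact: class_C_cst.
  by apply: class_C_det => // a b; under eq_fun do rewrite !mxE; exact: cA.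
by apply: class_C_eq => // u Vu; rewrite /invmx uA // !mxE.
Qed.

End ClassC.

Section ClassCComp.
Context (R : realType) (m : nat).
Local Notation E := 'rV[R]_m.
Implicit Types (f : E -> R^o) (V : set E) (k : nat).

Lemma class_C_comp p k V (U : set 'rV[R]_p) f (g : 'rV[R]_p -> E) : open V -> open U ->
  (forall u, U u -> V (g u)) -> class_C k V f ->
  (forall j, class_C k U (fun u => g u 0 j : R^o)) -> class_C k U (f \o g : _ -> R^o).
Proof.
move=> oV oU gU; elim: k f => [|k IH] f cf cg.
  split => // u Uu; apply: continuous_comp; last exact: class_C_cont cf (gU _ Uu).
  by apply: continuous_rV => j; exact: class_C_cont (cg j) Uu.
have dfg u i : U u -> is_derive u (delta_mx 0 i) (f \o g : _ -> R^o)
    (\sum_j pderiv i (fun w => g w 0 j : R^o) u * pderiv j f (g u)).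
  move=> Uu; apply: is_derive_comp_rV => j.
  - apply: filterS (open_nbhs_nbhs (conj oV (gU _ Uu))) => w Vw.
    exact: (class_C_derivable (i := j) cf Vw).
  - exact: (class_C_cont (class_C_pderiv _ cf) (gU _ Uu)).
  - exact: (class_C_derivable (i := i) (cg j) Uu).
split => [u Uu|i].
  have := IH _ (class_CS cf) (fun j => class_CS (cg j)).
  by move=> c; exact: class_C_cont c Uu.
split => [u Uu|]; first exact: (@ex_derive _ _ _ _ _ _ _ (dfg u i Uu)).
have : class_C k U (fun u => \sum_j pderiv i (fun w => g w 0 j : R^o) u * (pderiv j f \o g) u : R^o).
  apply: class_C_sum => // j; apply: class_CM => //; first exact: class_C_pderiv.
  by apply: IH; [exact: class_C_pderiv|move=> l; exact: class_CS].
apply: class_C_eq => // u Uu.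
by apply/esym/(@derive_val _ _ _ _ _ _ _ (dfg u i Uu)).
Qed.

(** Serves for two outer functions of one variable: the square root in the Riemannian density and
    the squared positive part in the bump functions. *)
Lemma class_C1_comp1 V f (th dth : R -> R^o) : open V -> class_C 1 V f ->
  (forall u, V u -> is_derive (f u) 1 th (dth (f u))) ->
  (forall u, V u -> {for f u, continuous dth}) -> class_C 1 V (th \o f : E -> R^o).
Proof.
move=> oV cf dthP cdth.
have dcomp u i : V u -> is_derive u (delta_mx 0 i) (th \o f : E -> R^o) (dth (f u) * pderiv i f u).
  move=> Vu; set v := delta_mx 0 i : E.
  have df : is_derive 0 (1 : R) (fun h : R => f (u + h *: v)) (pderiv i f u).
    have := @is_derive_line _ _ f u v 0; rewrite scale0r addr0; apply.
    exact: class_C_derivable cf Vu.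
  have dth0 : is_derive (f (u + 0 *: v)) (1 : R) th (dth (f u)).
    by rewrite scale0r addr0; exact: dthP.
  have [dl el] := is_derive1_comp dth0 df; rewrite -el.
  have quot : (fun h : R => h^-1 *: (((th \o f) \o shift u) (h *: v) - (th \o f) u)) =
      (fun h : R => h^-1 *: (((th \o (fun h : R => f (u + h *: v))) \o shift (0 : R)) (h *: (1 : R)) - th (f (u + 0 *: v)))).
    apply/funext => h /=; rewrite scale0r !addr0 [h *: 1]mulr1.
    by rewrite [h *: v + u]addrC.
  by split; [rewrite /derivable quot; exact: dl|rewrite /derive quot].
have cont_th u : V u -> {for u, continuous (th \o f : E -> R^o)}.
  move=> Vu; apply: continuous_comp; first exact: class_C_cont cf Vu.
  apply/differentiable_continuous/derivable1_diffP.
  exact: (@ex_derive _ _ _ _ _ _ _ (dthP u Vu)).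
split => // i; split => [u Vu|]; first exact: (@ex_derive _ _ _ _ _ _ _ (dcomp u i Vu)).
split => // u Vu.
have : {for u, continuous (fun w => dth (f w) * pderiv i f w : R^o)}.
  apply: (@continuousM _ _ (dth \o f)); last exact: class_C_cont (class_C_pderiv i cf) Vu.
  by apply: continuous_comp; [exact: class_C_cont cf Vu|exact: cdth].
apply: continuous_near_eq; apply: filterS (open_nbhs_nbhs (conj oV Vu)) => w Vw.
by apply/esym/(@derive_val _ _ _ _ _ _ _ (dcomp w i Vw)).
Qed.

End ClassCComp.

(** * Integrals over cubes *)

(* The real-valued counterpart of lebesgue_int, for functions vanishing off [-L, L]^m. *)
Fixpoint box_int (R : realType) (L : R) (m : nat) : ('rV[R]_m -> R) -> R :=
  match m return ('rV[R]_m -> R) -> R with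
  | 0 => fun f => f 0
  | k.+1 => fun f => \int[@lebesgue_measure R]_(t in `[- L, L])
       box_int L (fun v : 'rV[R]_k => f (row_mx (t%:M : 'rV[R]_1) v))
  end.

Section BoxIntegral.
Context (R : realType) (L : R) (L_gt0 : 0 < L).
Implicit Types m : nat.

Local Notation leb := (@lebesgue_measure R).
Local Notation rcons t v := (row_mx (t%:M : 'rV[R]_1) v).

Definition in_box m (v : 'rV[R]_m) := forall i, `|v 0 i| <= L.

Lemma in_box_compact m : compact [set v : 'rV[R]_m | in_box v].
Proof.
have -> : [set v : 'rV[R]_m | in_box v] = [set v | forall i, `[- L, L]%classic (v ord0 i)].
  by apply/seteqP; split => v /= vb i; have := vb i; rewrite in_itv /= ler_norml.
by apply: (@rV_compact _ _ (fun=> `[- L, L]%classic)) => i; exact: segment_compact.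
Qed.

Lemma rcons_continuous m : continuous (fun p : R * 'rV[R]_m => rcons p.1 p.2 : 'rV[R]_(1 + m)).
Proof.
move=> [t v]; apply: continuous_rV => j; have [i ->|i ->] := split_ordP j.
  have -> : (fun p : R * 'rV[R]_m => rcons p.1 p.2 0 (lshift m i)) = fst.
    by apply/funext => p; rewrite row_mxEl mxE ord1 eqxx mulr1n.
  exact: cvg_fst.
have -> : (fun p : R * 'rV[R]_m => rcons p.1 p.2 0 (rshift 1 i)) = (fun p => p.2 0 i).
  by apply/funext => p; rewrite row_mxEr.
by apply: (@continuous_comp _ _ _ snd (fun v : 'rV[R]_m => v 0 i)); [exact: cvg_snd|exact: coord_continuous].
Qed.

Lemma rcons_continuousr m t : continuous (fun v : 'rV[R]_m => rcons t v : 'rV[R]_(1 + m)).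
Proof.
move=> v; apply: continuous_rV => j; have [i ->|i ->] := split_ordP j.
  have -> : (fun v : 'rV[R]_m => rcons t v 0 (lshift m i)) = (fun=> t).
    by apply/funext => s; rewrite row_mxEl mxE ord1 eqxx mulr1n.
  exact: cst_continuous.
have -> : (fun v : 'rV[R]_m => rcons t v 0 (rshift 1 i)) = (fun v => v 0 i).
  by apply/funext => s; rewrite row_mxEr.
exact: coord_continuous.
Qed.

Lemma rcons_box m t (v : 'rV[R]_m) : in_box (rcons t v : 'rV[R]_m.+1) <-> `|t| <= L /\ in_box v.
Proof.
split=> [tv|[tL vL] j].
  split=> [|i].
    have : `|rcons t v 0 (lshift m ord0)| <= L := tv _.
    by rewrite row_mxEl mxE eqxx mulr1n.
  have : `|rcons t v 0 (rshift 1 i)| <= L := tv _.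
  by rewrite row_mxEr.
pose j' : 'I_(1 + m) := j; change (`|rcons t v 0 j'| <= L).
have [i ->|i ->] := split_ordP j'.
  by rewrite row_mxEl mxE ord1 eqxx mulr1n.
by rewrite row_mxEr.
Qed.

(** Compactness of the cube makes continuity in the first variable uniform in the others. *)
Lemma tube m (f : 'rV[R]_m.+1 -> R^o) t e : continuous f -> 0 < e ->
  \forall s \near t, forall v, in_box v -> `|f (rcons t v) - f (rcons s v)| <= e.
Proof.
move=> cf e0; have e2 : 0 < e / 2 by rewrite divr_gt0.
have /compact_near_coveringP nc := @in_box_compact m.
apply: (nc R (nbhs t) (fun s v => `|f (rcons t v) - f (rcons s v)| <= e)) => v _.
have : {for (t, v), continuous (fun p : R * 'rV[R]_m => f (rcons p.1 p.2))}.
  by apply: continuous_comp; [exact: rcons_continuous|exact: cf].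
move=> /continuous_atP /(_ _ e2) [[A B] /= [At Bv] AB].
exists (B, A) => //= -[w s] /= [Bw As].
have := AB (s, w) (conj As Bw); have := AB (t, w) (conj (nbhs_singleton At) Bw).
move=> /= d1 d2; apply: (ler_dist_half (B := f (rcons t v))); rewrite distrC //.
Qed.

Definition box_int_laws m := [/\
  forall f g : 'rV[R]_m -> R, continuous (f : _ -> R^o) -> continuous (g : _ -> R^o) ->
    box_int L (fun v => f v + g v) = box_int L f + box_int L g,
  forall c (f : 'rV[R]_m -> R), continuous (f : _ -> R^o) ->
    box_int L (fun v => c * f v) = c * box_int L f,
  forall f g : 'rV[R]_m -> R, continuous (f : _ -> R^o) -> continuous (g : _ -> R^o) ->
    (forall v, in_box v -> f v <= g v) -> box_int L f <= box_int L g &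
  box_int L (fun _ : 'rV[R]_m => 1) = (L *+ 2) ^+ m].

Section FromLaws.
Context m (laws : box_int_laws m).
Implicit Types f g : 'rV[R]_m -> R^o.

Lemma box_int_dist_of f g e : continuous f -> continuous g ->
  (forall v, in_box v -> `|f v - g v| <= e) ->
  `|box_int L f - box_int L g| <= e * (L *+ 2) ^+ m.
Proof.
move=> cf cg fg; have [lD lZ lle l1] := laws.
have c1 : continuous (fun v : 'rV[R]_m => e * 1 : R^o) by move=> v; exact: cst_continuous.
have ec : box_int L (fun v : 'rV[R]_m => e * 1) = e * (L *+ 2) ^+ m.
  by rewrite lZ ?l1 // => v; exact: cst_continuous.
rewrite -ec ler_distl; apply/andP; split.
  rewrite lerBlDr -lD //; apply: lle => //.
    by move=> v; exact: (continuousD (cf v) (c1 v)).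
  by move=> v /fg; rewrite ler_distl mulr1 lerBlDr => /andP[].
rewrite -lD //; apply: lle => //.
  by move=> v; exact: (continuousD (cg v) (c1 v)).
by move=> v /fg; rewrite ler_distl mulr1 => /andP[].
Qed.

Lemma box_int_param_of (f : 'rV[R]_m.+1 -> R^o) : continuous f ->
  continuous (fun t => box_int L (fun v : 'rV[R]_m => f (rcons t v)) : R^o).
Proof.
move=> cf t; apply/continuous_atP => e e0.
have L0 : 0 < (L *+ 2) ^+ m by rewrite exprn_gt0 // pmulrn_lgt0.
have := tube t cf (divr_gt0 e0 L0); apply: filterS => s ts.
have cr r : continuous (fun v : 'rV[R]_m => f (rcons r v)).
  by move=> v; apply: continuous_comp; [exact: rcons_continuousr|exact: cf].
by rewrite (le_trans (box_int_dist_of (cr t) (cr s) ts)) // divfK // gt_eqF.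
Qed.

End FromLaws.

Lemma integrable_box (f : R -> R^o) : continuous f ->
  leb.-integrable `[- L, L] (EFin \o f).
Proof.
move=> cf; apply: continuous_compact_integrable; first exact: segment_compact.
exact: continuous_subspaceT.
Qed.

Lemma box_intP m : box_int_laws m.
Proof.
elim: m => [|m IH]; first by split => //= f g _ _; apply => -[].
have cr f r : continuous (f : 'rV[R]_m.+1 -> R^o) -> continuous (fun v : 'rV[R]_m => f (rcons r v) : R^o).
  by move=> cf v; apply: continuous_comp; [exact: rcons_continuousr|exact: cf].
have [lD lZ lle l1] := IH.
split => [f g cf cg|c f cf|f g cf cg fg|] /=.
- rewrite -RintegralD //; last 2 first.
  + exact/integrable_box/box_int_param_of.
  + exact/integrable_box/box_int_param_of.
  by apply: eq_Rintegral => t _; rewrite lD //; exact: cr.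
- rewrite -RintegralZl //; last exact/integrable_box/box_int_param_of.
  by apply: eq_Rintegral => t _; rewrite lZ //; exact: cr.
- apply: le_Rintegral => //.
  + exact/integrable_box/box_int_param_of.
  + exact/integrable_box/box_int_param_of.
  move=> t /=; rewrite in_itv /= -ler_norml => tL.
  by apply: lle => [||v vb]; [exact: cr|exact: cr|apply: fg; exact/rcons_box].
- under eq_Rintegral do rewrite l1.
  rewrite Rintegral_cst //= lebesgue_measure_itv /= lte_fin.
  by rewrite ifT ?gtrN // -EFinD /= opprK exprSr mulr2n.
Qed.

Lemma box_int0 m : box_int L (fun _ : 'rV[R]_m => 0) = 0.
Proof.
have [_ lZ _ _] := box_intP m.
have := lZ 0 (fun=> 0) (fun v => @cst_continuous _ _ (0 : R^o) v).
by under eq_fun do rewrite mul0r; rewrite mul0r.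
Qed.

Lemma slice_continuous m (f : 'rV[R]_m.+1 -> R^o) t : continuous f ->
  continuous (fun v : 'rV[R]_m => f (rcons t v) : R^o).
Proof. by move=> cf v; apply: continuous_comp; [exact: rcons_continuousr|exact: cf]. Qed.

(** The inner integral of a slice at height t vanishes when t lies off [-L, L], so at each level the
    integral over the line reduces to one over the segment. *)
Lemma lebesgue_int_box m (f : 'rV[R]_m -> R) : continuous (f : _ -> R^o) ->
  (forall v, ~ in_box v -> f v = 0) ->
  lebesgue_int (fun v => (f v)%:E) = (box_int L f)%:E.
Proof.
elim: m f => [//|m IH] f cf f0 /=.
have -> : (fun t => lebesgue_int (fun v : 'rV[R]_m => (f (rcons t v))%:E)) =
    (EFin \o (fun t => box_int L (fun v : 'rV[R]_m => f (rcons t v)))) \_ `[- L, L].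
  apply/funext => t; rewrite IH; last 2 first.
  - exact: slice_continuous.
  - by move=> v nv; apply: f0 => /rcons_box[].
  rewrite patchE; case: ifPn => //; rewrite notin_setE /= in_itv /= -ler_norml => tL.
  have -> : (fun v : 'rV[R]_m => f (rcons t v)) = (fun=> 0); last by rewrite box_int0.
  by apply/funext => v; apply: f0 => /rcons_box[].
rewrite -integral_mkcond /Rintegral fineK //.
apply: integrable_fin_num => //.
exact/integrable_box/box_int_param_of/cf/box_intP.
Qed.

Lemma rcons_ord0 m t (v : 'rV[R]_m) : (rcons t v : 'rV[R]_m.+1) 0 ord0 = t.
Proof.
have -> : ord0 = lshift m (ord0 : 'I_1) by exact: val_inj.
by rewrite [LHS]row_mxEl mxE eqxx mulr1n.
Qed.

Lemma rcons_lift m t (v : 'rV[R]_m) k : (rcons t v : 'rV[R]_m.+1) 0 (lift ord0 k) = v 0 k.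
Proof.
have -> : lift ord0 k = rshift 1 k by exact: val_inj.
exact: row_mxEr.
Qed.

Lemma rconsD m s h (v : 'rV[R]_m) :
  rcons s v + h *: (delta_mx 0 ord0 : 'rV[R]_m.+1) = rcons (s + h) v.
Proof.
apply/rowP => j; rewrite [LHS]mxE [X in _ + X]mxE [X in _ + h * X]mxE eqxx /=.
case: (unliftP ord0 j) => [k ->|->]; first by rewrite !rcons_lift mulr0 addr0.
by rewrite !rcons_ord0 mulr1.
Qed.

Lemma rcons_delta m s h (v : 'rV[R]_m) k :
  rcons s v + h *: (delta_mx 0 (lift ord0 k) : 'rV[R]_m.+1) = rcons s (v + h *: delta_mx 0 k).
Proof.
apply/rowP => j; rewrite [LHS]mxE [X in _ + X]mxE [X in _ + h * X]mxE eqxx /=.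
case: (unliftP ord0 j) => [l ->|->]; last by rewrite !rcons_ord0 mulr0 addr0.
by rewrite !rcons_lift !mxE eqxx (inj_eq lift_inj).
Qed.

(** By the mean value theorem the difference quotient of f is a value of its partial derivative at a
    nearby height, and [tube] makes the approximation uniform over the cube. *)
Lemma is_derive_box_int m (f : 'rV[R]_m.+1 -> R^o)  t :
  continuous f -> (forall u, derivable f u (delta_mx 0 ord0)) ->
  continuous (pderiv ord0 f) ->
  is_derive t (1 : R) (fun t => box_int L (fun v : 'rV[R]_m => f (rcons t v)) : R^o)
    (box_int L (fun v : 'rV[R]_m => pderiv ord0 f (rcons t v))).
Proof.
pose i0 : 'I_m.+1 := ord0; rewrite -/i0 => cf df cdf.
have [lD lZ _ _] := box_intP m.
set G := fun t => _; set G' := box_int L _.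
suff lim_G : (fun h : R => h^-1 *: ((G \o shift t) (h *: (1:R)) - G t) : R^o) @ 0^' --> (G' : R^o).
  by split; [apply/cvg_ex; eexists; exact: lim_G|exact: cvg_lim lim_G].
apply/cvgrPdist_le => e e0.
have L0 : 0 < (L *+ 2) ^+ m by rewrite exprn_gt0 // pmulrn_lgt0.
have [r r0 rP] := near_ball (tube t cdf (divr_gt0 e0 L0)).
near=> h.
have h0 : h != 0 by near: h; exact: nbhs_dnbhs_neq.
have hr : `|h| < r by near: h; exact: dnbhs0_lt.
have -> : h^-1 *: ((G \o shift t) (h *: (1:R)) - G t) =
    box_int L (fun v : 'rV[R]_m => h^-1 * (f (rcons (t + h) v) - f (rcons t v))).
  rewrite /G /= [h *: 1]mulr1 [h + t]addrC.
  have cN : continuous (fun v : 'rV[R]_m => -1 * f (rcons t v) : R^o).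
    by move=> v; apply: (@continuousM _ _ (fun=> -1) (fun v => f (rcons t v))); [exact: cst_continuous|exact: slice_continuous].
  have cB : continuous (fun v : 'rV[R]_m => f (rcons (t + h) v) + -1 * f (rcons t v) : R^o).
    by move=> v; apply: (@continuousD _ R^o _ (fun v => f (rcons (t + h) v))) (cN v); exact: slice_continuous.
  have -> : (fun v : 'rV[R]_m => h^-1 * (f (rcons (t + h) v) - f (rcons t v))) =
     (fun v : 'rV[R]_m => h^-1 * (f (rcons (t + h) v) + -1 * f (rcons t v))).
    by apply/funext => v; rewrite mulN1r.
  rewrite lZ // lD ?lZ //; last 2 first.
  - exact: slice_continuous.
  - exact: slice_continuous.
  by rewrite mulN1r.
have := box_int_dist_of (box_intP m) (e := e / (L *+ 2) ^+ m).
rewrite divfK ?gt_eqF //; apply.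
- exact: slice_continuous.
- move=> v; apply: (@continuousM _ _ (fun=> h^-1) (fun v => f (rcons (t + h) v) - f (rcons t v))).
    exact: cst_continuous.
  apply: (@continuousB _ R^o _ (fun v => f (rcons (t + h) v)) (fun v => f (rcons t v)));
  exact: slice_continuous.
- move=> v vb; rewrite -rconsD.
  have [s sh ->] := @mvt_line _ _ f (rcons t v) (delta_mx 0 i0) h (fun s _ => df _).
  rewrite mulKf // rconsD; apply: rP => //.
  by rewrite -ball_normE /= opprD addrA subrr sub0r normrN (le_lt_trans sh).
Unshelve. all: by end_near. Qed.

(** For the first variable this is the fundamental theorem of calculus after differentiation under
    the integral sign; for the others the inner integral already vanishes by induction. The
    condition on f includes the faces |v_j| = L, which removes the boundary terms. *)
Lemma box_int_pderiv m (f : 'rV[R]_m -> R^o) i :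
  continuous f -> (forall j u, derivable f u (delta_mx 0 j)) ->
  (forall j, continuous (pderiv j f)) ->
  (forall (v : 'rV[R]_m) j, L <= `|v 0 j| -> f v = 0) ->
  box_int L (pderiv i f) = 0.
Proof.
elim: m f i => [f []//|m IH] f i cf df cdf f0 /=.
have [k ->|->] := unliftP ord0 i.
  have quot t v j : (fun h : R => h^-1 *: (((fun v : 'rV[R]_m => f (rcons t v)) \o shift v) (h *: delta_mx 0 j) - f (rcons t v))) =
     (fun h : R => h^-1 *: ((f \o shift (rcons t v : 'rV[R]_m.+1)) (h *: delta_mx 0 (lift ord0 j)) - f (rcons t v))).
    by apply/funext => h /=; rewrite ![h *: _ + _]addrC rcons_delta.
  have pd t v j : pderiv j (fun v : 'rV[R]_m => f (rcons t v)) v = pderiv (lift ord0 j) f (rcons t v).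
    by rewrite /pderiv /derive quot.
  suff z t : box_int L (fun v : 'rV[R]_m => pderiv (lift ord0 k) f (rcons t v)) = 0.
    by under eq_Rintegral do rewrite z; rewrite Rintegral_cst ?mul0r.
  have <- : pderiv k (fun v : 'rV[R]_m => f (rcons t v)) = (fun v : 'rV[R]_m => pderiv (lift ord0 k) f (rcons t v)).
    exact/funext.
  apply: IH => [|j u|j|v j vj].
  - exact: slice_continuous.
  - by rewrite /derivable quot; exact: df.
  - rewrite (_ : pderiv _ _ = fun v : 'rV[R]_m => pderiv (lift ord0 j) f (rcons t v)).
      exact: slice_continuous.
    exact/funext.
  - by apply: (f0 _ (lift ord0 j)); rewrite rcons_lift.
set i0 : 'I_m.+1 := ord0.
pose G t : R := box_int L (fun v : 'rV[R]_m => f (rcons t v)).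
have dG t : is_derive t (1 : R) (G : R -> R^o) (box_int L (fun v : 'rV[R]_m => pderiv i0 f (rcons t v))).
  exact: is_derive_box_int.
have cG : continuous (G : R -> R^o) by exact: box_int_param_of (box_intP m) _ cf.
have G0 t : L <= `|t| -> G t = 0.
  move=> tL; rewrite /G; have -> : (fun v : 'rV[R]_m => f (rcons t v)) = (fun=> 0).
    apply/funext => v; apply: (f0 _ i0); suff -> : (rcons t v : 'rV[R]_m.+1) 0 i0 = t by [].
    exact: rcons_ord0.
  exact: box_int0.
rewrite /Rintegral.
rewrite (@continuous_FTC2 _ _ G) //.
- by rewrite !G0 ?normrN ?gtr0_norm // subee.
- by rewrite gtrN.
- apply: continuous_subspaceT; exact: box_int_param_of (box_intP m) _ (cdf _).
- split.
  + by move=> t _; exact: ex_derive.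
  + by apply: cvg_at_right_filter; exact: cG.
  + by apply: cvg_at_left_filter; exact: cG.
- by move=> t _; rewrite derive1E derive_val.
Qed.

End BoxIntegral.

(** * Immersions in coordinates *)

Lemma mulmx_entry (R : pzSemiRingType) m n p (A : 'M[R]_(m, n)) (B : 'M[R]_(n, p)) i k :
  (A *m B) i k = \sum_j A i j * B j k.
Proof. exact: mxE. Qed.

Lemma invmxM (R : comUnitRingType) m (A B : 'M[R]_m) :
  A \in unitmx -> B \in unitmx -> invmx (A *m B) = invmx B *m invmx A.
Proof.
move=> uA uB; have uAB : A *m B \in unitmx by rewrite unitmx_mul uA.
rewrite -[RHS](mulKmx uAB) -[A *m B *m _]mulmxA [B *m _]mulmxA mulmxV //.
by rewrite mul1mx mulmxV // mulmx1.
Qed.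

Section GramMatrix.
Context (R : realType) (m d : nat).
Implicit Types J : 'M[R]_(m, d).

Lemma dotE (v w : 'rV[R]_d) : dot v w = \sum_a v 0 a * w 0 a.
Proof. by rewrite /dot mxE; apply: eq_bigr => a _; rewrite mxE. Qed.

Lemma dotC (v w : 'rV[R]_d) : dot v w = dot w v.
Proof. by rewrite !dotE; apply: eq_bigr => a _; rewrite mulrC. Qed.

Lemma dot_eq0 (v : 'rV[R]_d) : dot v v = 0 -> v = 0.
Proof.
rewrite dotE => /eqP; rewrite psumr_eq0; last by move=> a _; rewrite -expr2 sqr_ge0.
move=> /allP v0; apply/rowP => a; rewrite mxE.
by have := v0 a (mem_index_enum _); rewrite mulf_eq0 orbb => /eqP.
Qed.

(** If v J J^T = 0 then |v J|^2 = 0, so v J = 0 and v = 0. *)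
Lemma gram_unit J : row_free J -> J *m J^T \in unitmx.
Proof.
move=> Jf; rewrite -row_free_unit -kermx_eq0 -submx0; apply/row_subP => i.
set v := row i _.
have : v *m (J *m J^T) = 0 by rewrite -row_mul mulmx_ker row0.
move=> /(congr1 (fun w => w *m v^T)); rewrite mul0mx => e.
have : dot (v *m J) (v *m J) = 0.
  by rewrite /dot trmx_mul !mulmxA -[v *m J *m _]mulmxA e mxE.
by move=> /dot_eq0 /eqP; rewrite mulmx_free_eq0 // => /eqP ->; exact: sub0mx.
Qed.

End GramMatrix.

Section MatrixDerivative.
Context (R : realType) (m : nat).
Local Notation E := 'rV[R]_m.

Definition dM i p q (A : E -> 'M[R]_(p, q)) u : 'M[R]_(p, q) :=
  \matrix_(r, s) pderiv i (fun v => A v r s : R^o) u.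

Definition mx_C k (V : set E) p q (A : E -> 'M[R]_(p, q)) : Prop :=
  forall r s, class_C k V (fun v => A v r s : R^o).

Lemma mx_C_mul k V p q r (A : E -> 'M[R]_(p, q)) (B : E -> 'M[R]_(q, r)) : open V ->
  mx_C k V A -> mx_C k V B -> mx_C k V (fun u => A u *m B u).
Proof.
move=> oV cA cB i j.
have -> : (fun v => (A v *m B v) i j : R^o) = (fun v => \sum_l A v i l * B v l j : R^o).
  by apply/funext => v; rewrite mxE.
by apply: class_C_sum => // l; apply: class_CM.
Qed.

Lemma mx_C_tr k V p q (A : E -> 'M[R]_(p, q)) : mx_C k V A -> mx_C k V (fun u => (A u)^T).
Proof.
move=> cA i j; have -> : (fun v => (A v)^T i j : R^o) = (fun v => A v j i : R^o).
  by apply/funext => v; rewrite mxE.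
exact: cA.
Qed.

Lemma dM_eq V i p q (A B : E -> 'M[R]_(p, q)) u : open V -> (forall v, V v -> A v = B v) ->
  V u -> dM i A u = dM i B u.
Proof.
move=> oV AB Vu; apply/matrixP => r s; rewrite !mxE.
by apply: pderiv_eq_on Vu => // v Vv; rewrite AB.
Qed.

Lemma pderivD V i (f g : E -> R^o) u : class_C 1 V f -> class_C 1 V g -> V u ->
  pderiv i (fun v => f v + g v : R^o) u = pderiv i f u + pderiv i g u.
Proof. by move=> cf cg Vu; apply: deriveD; apply: class_C_derivable Vu; eassumption. Qed.

Lemma pderivM V i (f g : E -> R^o) u : class_C 1 V f -> class_C 1 V g -> V u ->
  pderiv i (fun v => f v * g v : R^o) u = f u * pderiv i g u + g u * pderiv i f u.
Proof.
move=> cf cg Vu; apply: (@deriveM _ _ f g); apply: class_C_derivable Vu; eassumption.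
Qed.

Lemma pderiv_sum V i (I : Type) (r : seq I) (P : pred I) (f : I -> E -> R^o) u : open V ->
  (forall l, class_C 1 V (f l)) -> V u ->
  pderiv i (fun v => \sum_(l <- r | P l) f l v : R^o) u = \sum_(l <- r | P l) pderiv i (f l) u.
Proof.
move=> oV cf Vu; elim: r => [|l r IH].
  rewrite big_nil -[RHS](derive_cst (0 : R^o) u (delta_mx 0 i)).
  by congr (pderiv i _ u); apply/funext => v; rewrite big_nil.
rewrite big_cons -IH; case Pl : (P l).
  rewrite -(pderivD (V := V)) //; last exact: class_C_sum.
  by congr (pderiv i _ u); apply/funext => v; rewrite big_cons Pl.
by congr (pderiv i _ u); apply/funext => v; rewrite big_cons Pl.
Qed.

Lemma dM_mul V i p q r (A : E -> 'M[R]_(p, q)) (B : E -> 'M[R]_(q, r)) u : open V ->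
  mx_C 1 V A -> mx_C 1 V B -> V u ->
  dM i (fun v => A v *m B v) u = dM i A u *m B u + A u *m dM i B u.
Proof.
move=> oV cA cB Vu; apply/matrixP => a b; rewrite !mxE.
have -> : (fun v => (A v *m B v) a b : R^o) = (fun v => \sum_l A v a l * B v l b : R^o).
  by apply/funext => v; rewrite mxE.
rewrite (pderiv_sum (V := V)) //; last by move=> l; apply: class_CM.
rewrite -big_split; apply: eq_bigr => l _; rewrite (pderivM (V := V)) // !mxE.
by rewrite addrC mulrC.
Qed.

Lemma dM_tr i p q (A : E -> 'M[R]_(p, q)) u : dM i (fun v => (A v)^T) u = (dM i A u)^T.
Proof.
apply/matrixP => a b; rewrite !mxE; congr (pderiv i _ u).
by apply/funext => v; rewrite mxE.
Qed.

End MatrixDerivative.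

Section LocalImmersion.
Context (R : realType) (m n : nat).
Local Notation d := (n.+1 + 1)%N.
Local Notation E := 'rV[R]_d.
Context (F : 'rV[R]_m -> E) (V : set 'rV[R]_m) (oV : open V).
Context (cF : forall k, class_C k V F) (free : forall u, V u -> row_free (jac F u)).

(* Its columns are the dual frame of the coordinate frame (the rows of jac). *)
Definition Cmx u : 'M[R]_(d, m) := (jac F u)^T *m invmx (metric F u).

Lemma metric_unit u : V u -> metric F u \in unitmx.
Proof. by move=> /free /gram_unit. Qed.

Lemma jacE u i a : V u -> jac F u i a = pderiv i (fun v => F v 0 a : R^o) u.
Proof. by move=> Vu; rewrite mxE /pderiv derive_mx ?mxE//; exact: class_C_derivable (cF 1) Vu. Qed.

Lemma mx_C_jac k : mx_C k V (jac F).
Proof.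
move=> i a; have := class_C_pderiv i (class_C_coord a oV (cF k.+1)).
by apply: class_C_eq => // u Vu; rewrite jacE.
Qed.

Lemma mx_C_metric k : mx_C k V (metric F).
Proof. by apply: mx_C_mul => //; [exact: mx_C_jac|apply: mx_C_tr; exact: mx_C_jac]. Qed.

Lemma mx_C_invmetric k : mx_C k V (fun u => invmx (metric F u)).
Proof. by move=> i j; apply: class_C_invmx => //; [exact: metric_unit|exact: mx_C_metric]. Qed.

Lemma mx_C_Cmx k : mx_C k V Cmx.
Proof. by apply: mx_C_mul => //; [apply: mx_C_tr; exact: mx_C_jac|exact: mx_C_invmetric]. Qed.

Lemma metric_sym u : (metric F u)^T = metric F u.
Proof. by rewrite /metric trmx_mul trmxK. Qed.

Lemma invmetric_sym u : (invmx (metric F u))^T = invmx (metric F u).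
Proof. by rewrite trmx_inv metric_sym. Qed.

Lemma compsE u v : comps F u v = v *m Cmx u.
Proof. by rewrite /comps /Cmx mulmxA. Qed.

Lemma jac_Cmx u : V u -> jac F u *m Cmx u = 1%:M.
Proof. by move=> Vu; rewrite /Cmx mulmxA mulmxV // metric_unit. Qed.

Lemma second_deriv_sym u i j a : V u -> dM i (jac F) u j a = dM j (jac F) u i a.
Proof.
move=> Vu; rewrite [LHS]mxE [RHS]mxE.
have pdE k l w : V w -> pderiv k (fun v => jac F v l a : R^o) w = pderiv k (pderiv l (fun v => F v 0 a : R^o)) w.
  by move=> Vw; apply: pderiv_eq_on Vw => // v Vv; rewrite jacE.
apply: etrans (pdE i j u Vu) (etrans _ (esym (pdE j i u Vu))).
have ca := class_C_coord a oV (cF 2).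
have nV : \forall w \near u, V w by exact: open_nbhs_nbhs.
apply: schwarz.
- by apply: filterS nV => w Vw; split; apply: class_C_derivable Vw; exact: class_CS ca.
- by apply: filterS nV => w Vw; apply: class_C_derivable Vw; exact: class_C_pderiv ca.
- by apply: filterS nV => w Vw; apply: class_C_derivable Vw; exact: class_C_pderiv ca.
- by apply: class_C_cont Vu; exact: class_C_pderiv (class_C_pderiv _ ca).
- by apply: class_C_cont Vu; exact: class_C_pderiv (class_C_pderiv _ ca).
Qed.

(** The Levi-Civita connection of an induced metric is the tangential part of the flat derivative.
    With s a b c = <d_a d_b F, d_c F>, symmetric in a and b, the three derivatives of the metric add
    up to 2 s i j l. *)
Lemma christoffelE u i j k : V u -> christoffel F u i j k = (dM i (jac F) u *m Cmx u) j k.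
Proof.
move=> Vu.
have dg a b c : pderiv a (fun v => metric F v b c : R^o) u =
    (dM a (jac F) u *m (jac F u)^T) b c + (dM a (jac F) u *m (jac F u)^T) c b.
  transitivity (dM a (metric F) u b c); first by rewrite mxE.
  rewrite (dM_mul (V := V)) //; last 2 first.
  - exact: mx_C_jac.
  - by apply: mx_C_tr; exact: mx_C_jac.
  rewrite dM_tr mxE; congr (_ + _).
  by rewrite -[in RHS](trmxK (dM a (jac F) u *m _)) [RHS]mxE trmx_mul trmxK.
have sw a b c : (dM a (jac F) u *m (jac F u)^T) b c = (dM b (jac F) u *m (jac F u)^T) a c.
  rewrite [LHS]mulmx_entry.
  rewrite [RHS]mulmx_entry.
  apply: eq_bigr => l _.
  congr (_ * _).
  exact: second_deriv_sym.
have rhs : (dM i (jac F) u *m Cmx u) j k =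
    \sum_l (dM i (jac F) u *m (jac F u)^T) j l * invmx (metric F u) l k.
  by rewrite /Cmx mulmxA [LHS]mulmx_entry.
have gsym l : invmx (metric F u) k l = invmx (metric F u) l k.
  by rewrite -[in LHS]invmetric_sym [LHS]mxE.
have [s [sdg ssw sE]] : exists s : 'I_m -> 'I_m -> 'I_m -> R, [/\
    forall a b c, pderiv a (fun v => metric F v b c : R^o) u = s a b c + s a c b,
    forall a b c, s a b c = s b a c &
    forall l, (dM i (jac F) u *m (jac F u)^T) j l = s i j l].
  by exists (fun a b c => (dM a (jac F) u *m (jac F u)^T) b c).
rewrite rhs /christoffel mulr_sumr {rhs dg sw}.
apply: eq_bigr => l _; rewrite sdg sdg sdg gsym sE.
rewrite (ssw i l j) (ssw j i l) (ssw j l i).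
move: (s i j l) (s l i j) (s l j i) (invmx (metric F u) l k) => a b c g.
by field.
Qed.

(** The unwanted derivative of [Cmx] is removed by subtracting the derivative of [Cmx *m jac],
    because [jac *m Cmx] is the identity. What remains is the coordinate covariant derivative of
    psi, the matrix [dM i (jac F) *m Cmx] holding the Christoffel symbols. *)
Lemma covariant_deriv q (psi : 'rV[R]_m -> 'M[R]_(m, q)) i u :
  mx_C 1 V psi -> V u ->
  dM i (fun v => Cmx v *m psi v) u
    - dM i (fun v => Cmx v *m jac F v) u *m (Cmx u *m psi u)
  = Cmx u *m (dM i psi u - dM i (jac F) u *m Cmx u *m psi u).
Proof.
move=> cpsi Vu.
have eq1 := dM_mul i oV (mx_C_Cmx 1) cpsi Vu.
have eq2 := dM_mul i oV (mx_C_Cmx 1) (mx_C_jac 1) Vu.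
rewrite eq1 eq2 mulmxDl mulmxBr -[dM i Cmx u *m jac F u *m _]mulmxA.
by rewrite [jac F u *m (_ *m _)]mulmxA jac_Cmx // mul1mx !mulmxA opprD addrACA subrr add0r.
Qed.

Definition lgrad (phi : 'rV[R]_m -> R^o) u : E :=
  (\row_i pderiv i phi u) *m invmx (metric F u) *m jac F u.

Lemma lgradE phi u a : lgrad phi u 0 a = \sum_i Cmx u a i * pderiv i phi u.
Proof.
have -> : lgrad phi u = (\row_i pderiv i phi u) *m (Cmx u)^T.
  by rewrite /lgrad /Cmx trmx_mul trmxK invmetric_sym mulmxA.
rewrite [LHS]mulmx_entry; apply: eq_bigr => i _.
by rewrite mulrC [X in X * _]mxE [X in _ * X]mxE.
Qed.

End LocalImmersion.

(** * Independence of the gradient from the chart *)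

Section Atlas.
Context (R : realType) (m n : nat) (M : topologicalType).
Local Notation d := (n.+1 + 1)%N.
Local Notation E := 'rV[R]_d.
Context (S : manifold R m M) (x : M -> E) (imm : immersion S x).
Implicit Types (c : chart S) (p : M) (u : 'rV[R]_m) (f g : M -> R).

Lemma im_coor c p : dom c p -> im c (coor c p).
Proof. by move=> cp; exists p. Qed.

Lemma par_dom c u : im c u -> dom c (par c u).
Proof. by move=> [p cp <-]; rewrite coorK. Qed.

Lemma parK c u : im c u -> coor c (par c u) = u.
Proof. by move=> [p cp <-]; rewrite coorK. Qed.

Lemma open_im c : open (im c). Proof. exact: im_open. Qed.

Lemma open_overlap c c' : open (coor c @` (dom c `&` dom c')).
Proof.
rewrite openE => _ [p [cp c'p] <-].
have ci := im_coor cp.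
have : \forall v \near coor c p, im c v /\ dom c' (par c v).
  apply: near_and; first by apply: open_nbhs_nbhs; split; [exact: open_im|exact: ci].
  have pc := par_continuous ci; apply: (pc (dom c')); rewrite coorK //.
  by apply: open_nbhs_nbhs; split => //; exact: dom_open.
apply: filterS => v [iv dv]; exists (par c v); last exact: parK.
by split => //; exact: par_dom.
Qed.

Lemma immersion_class c k : class_C k (im c) (x \o par c).
Proof. by have [_ + _] := imm; apply. Qed.

Lemma immersion_free c u : im c u -> row_free (jac (x \o par c) u).
Proof. by have [_ _] := imm; apply. Qed.

Local Notation sm k f := (class_C_on S k (f : M -> R^o)).

(** With J the Jacobian of the transition map, the row of partial derivatives acquires J^T, the
    metric becomes J g J^T and the coordinate frame acquires J; these factors cancel. This allows
    derivatives at neighbouring points, defined through unrelated charts, to be computed in one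
    fixed chart. *)
Lemma grad_chart c c' f p : sm 1 f -> dom c p -> dom c' p ->
  lgrad (x \o par c) (f \o par c) (coor c p) = lgrad (x \o par c') (f \o par c') (coor c' p).
Proof.
move=> cf cp c'p; set u := coor c p; pose tau := coor c' \o par c.
have tu : tau u = coor c' p by rewrite /tau /u /= coorK.
pose U := coor c @` (dom c `&` dom c').
have oU : open U by exact: open_overlap.
have Uu : U u by exists p.
have ctau k : class_C k U tau by exact: transition_smooth.
have tauU v : U v -> im c' (tau v) /\ par c' (tau v) = par c v.
  move=> [q [cq c'q] <-]; rewrite /tau /= coorK // coorK //; split => //; exact: im_coor.
have chain (h : M -> R) i : sm 1 h ->
    pderiv i (h \o par c : _ -> R^o) u = \sum_j pderiv i (fun v => tau v 0 j : R^o) u * pderiv j (h \o par c' : _ -> R^o) (coor c' p).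
  move=> ch; rewrite -tu.
  have -> : pderiv i (h \o par c : _ -> R^o) u = pderiv i ((h \o par c') \o tau : _ -> R^o) u.
    by apply: pderiv_eq_on Uu => // v /tauU[_ /= ->].
  apply: (@derive_val _ _ _ _ _ _ _ (is_derive_comp_rV _ _ _)) => j.
  - have nV : \forall w \near tau u, im c' w.
      by apply: open_nbhs_nbhs; split; [exact: open_im|exact: (tauU u Uu).1].
    by apply: filterS nV => w; exact: class_C_derivable (ch c').
  - exact: class_C_cont (class_C_pderiv j (ch c')) (tauU u Uu).1.
  - exact: class_C_derivable (class_C_coord j oU (ctau 1)) Uu.
pose J : 'M[R]_m := \matrix_(i, j) pderiv i (fun v => tau v 0 j : R^o) u.
have smx b : sm 1 (fun q => x q 0 b).
  by move=> b'; have := class_C_coord b (@open_im b') (immersion_class b' 1); exact.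
have jacJ : jac (x \o par c) u = J *m jac (x \o par c') (coor c' p).
  apply/matrixP => i b; rewrite [RHS]mulmx_entry.
  have jE c0 j : dom c0 p -> jac (x \o par c0) (coor c0 p) j b =
      pderiv j (fun v => (x \o par c0) v 0 b : R^o) (coor c0 p).
    by move=> c0p; apply: (jacE (V := im c0)); [move=> k; exact: immersion_class|exact: im_coor].
  apply: etrans (jE c i cp) _; apply: etrans (chain (fun q => x q 0 b) i (smx b)) _.
  apply: eq_bigr => j _; congr (_ * _); first by rewrite mxE.
  exact: (esym (jE c' j c'p)).
have rowJ : (\row_i pderiv i (f \o par c : _ -> R^o) u) =
    (\row_j pderiv j (f \o par c' : _ -> R^o) (coor c' p)) *m J^T.
  apply/rowP => i; rewrite [LHS]mxE [RHS]mulmx_entry; apply: etrans (chain f i cf) _.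
  by apply: eq_bigr => j _; rewrite [X in _ = X * _]mxE [X in _ = _ * X]mxE [X in _ = _ * X]mxE mulrC.
have g'u : metric (x \o par c') (coor c' p) \in unitmx.
  by apply: gram_unit; apply: immersion_free; exact: im_coor.
have gJ : metric (x \o par c) u = J *m metric (x \o par c') (coor c' p) *m J^T.
  by rewrite /metric jacJ trmx_mul !mulmxA.
have gu : metric (x \o par c) u \in unitmx.
  by apply: gram_unit; apply: immersion_free; exact: im_coor.
(* Invertibility of J is read off from that of the two metrics, without the inverse transition
   map. *)
have Ju : J \in unitmx by move: gu; rewrite gJ !unitmx_mul => /andP[/andP[]].
rewrite /lgrad rowJ gJ jacJ.
move: (\row_j _) (jac _ _) (metric _ _) g'u => r J' g' g'u.
have JTu : J^T \in unitmx by rewrite unitmx_tr.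
rewrite invmxM ?invmxM ?unitmx_mul ?Ju //.
by rewrite !mulmxA mulmxK // -[_ *m invmx J *m J]mulmxA mulVmx // mulmx1.
Qed.

End Atlas.

(** * Tangential derivatives *)

Section TangentialCalculus.
Context (R : realType) (m n : nat) (M : topologicalType).
Local Notation d := (n.+1 + 1)%N.
Local Notation E := 'rV[R]_d.
Context (S : manifold R m M) (x : M -> E) (imm : immersion S x).
Implicit Types (c : chart S) (p : M) (u : 'rV[R]_m) (f g : M -> R) (a b : 'I_d).

Definition smooth k (f : M -> R) := class_C_on S k (f : M -> R^o).

(* The derivative of f along the tangential projection of the a-th basis vector of R^(n+2).
   These n+2 derivatives replace the coordinate derivatives, so that charts disappear. *)
Definition D a f p : R := grad S x f p 0 a.

Lemma D_chart c f p a : smooth 1 f -> dom c p ->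
  D a f p = \sum_i Cmx (x \o par c) (coor c p) a i * pderiv i (f \o par c : _ -> R^o) (coor c p).
Proof.
move=> cf cp; rewrite -lgradE.
by apply: (congr1 (fun v : E => v 0 a) (grad_chart imm cf (chart_atP S p) cp)).
Qed.

Lemma D_at f p a :
  D a f p = \sum_i Cmx (x \o loc S p) (pt S p) a i * pderiv i (f \o loc S p : _ -> R^o) (pt S p).
Proof. by rewrite -lgradE. Qed.

Lemma smooth_eq k f g : f =1 g -> smooth k f -> smooth k g.
Proof. by move=> /funext ->. Qed.

Lemma smoothS k f : smooth k.+1 f -> smooth k f.
Proof. by move=> cf c; exact: class_CS. Qed.

Lemma smooth1 k f : smooth k.+1 f -> smooth 1 f.
Proof. by elim: k => [|k IH] cf; [exact: cf|apply: IH; exact: smoothS]. Qed.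

Lemma smooth_cst k (r : R) : smooth k (fun=> r).
Proof. by move=> c; exact: class_C_cst. Qed.

Lemma smoothD k f g : smooth k f -> smooth k g -> smooth k (fun p => f p + g p).
Proof. by move=> cf cg c; exact: class_CD (@open_im _ _ _ _ c) (cf c) (cg c). Qed.

Lemma smoothM k f g : smooth k f -> smooth k g -> smooth k (fun p => f p * g p).
Proof. by move=> cf cg c; exact: class_CM (@open_im _ _ _ _ c) (cf c) (cg c). Qed.

Lemma smoothN k f : smooth k f -> smooth k (fun p => - f p).
Proof.
move=> cf; apply: smooth_eq (smoothM (smooth_cst k (-1)) cf) => p.
by rewrite mulN1r.
Qed.

Lemma smoothB k f g : smooth k f -> smooth k g -> smooth k (fun p => f p - g p).
Proof. by move=> cf cg; exact: smoothD cf (smoothN cg). Qed.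

Lemma smooth_sum (I : Type) (r : seq I) (P : pred I) k (F : I -> M -> R) :
  (forall i, smooth k (F i)) -> smooth k (fun p => \sum_(i <- r | P i) F i p).
Proof.
move=> cF c; exact: (class_C_sum (F := fun i => F i \o par c) _ _ (@open_im _ _ _ _ c)
  (fun i => cF i c)).
Qed.

Lemma smoothV k f : (forall p, f p != 0) -> smooth k f -> smooth k (fun p => (f p)^-1).
Proof. by move=> f0 cf c; exact: class_CV (@open_im _ _ _ _ c) (fun u _ => f0 _) (cf c). Qed.

(** The chart in the definition of [D] varies with the point; [D_chart] replaces it by c throughout
    the domain of c. *)
Lemma smooth_D k f a : smooth k.+1 f -> smooth k (D a f).
Proof.
move=> cf c; have oV := @open_im _ _ _ S c.
have : class_C k (im c) (fun u => \sum_i Cmx (x \o par c) u a i * pderiv i (f \o par c : _ -> R^o) u : R^o).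
  apply: class_C_sum => // i; apply: class_CM => //.
    apply: (mx_C_Cmx (V := im c)) => //; first by move=> k'; exact: immersion_class.
    exact: immersion_free.
  exact: class_C_pderiv (cf c).
apply: class_C_eq => // u iu.
have cf1 := smooth1 cf.
by rewrite [RHS](D_chart a cf1 (par_dom iu)) parK.
Qed.

Lemma smooth_x k b : smooth k (fun p => x p 0 b).
Proof. by move=> c; have := class_C_coord b (@open_im _ _ _ _ c) (immersion_class imm c k); exact. Qed.

Lemma in_im p : im (chart_at S p) (pt S p).
Proof. exact: im_coor (chart_atP S p). Qed.

Lemma loc_pt p : loc S p (pt S p) = p.
Proof. exact: coorK (chart_atP S p). Qed.

Lemma DD f g a p : smooth 1 f -> smooth 1 g -> D a (fun q => f q + g q) p = D a f p + D a g p.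
Proof.
move=> cf cg; rewrite 3!D_at -big_split; apply: eq_bigr => i _ /=; rewrite -mulrDr; congr (_ * _).
exact: (pderivD (V := im (chart_at S p))) (cf _) (cg _) (in_im p).
Qed.

Lemma DM f g a p : smooth 1 f -> smooth 1 g ->
  D a (fun q => f q * g q) p = D a f p * g p + f p * D a g p.
Proof.
move=> cf cg; rewrite 3!D_at big_distrl big_distrr -big_split; apply: eq_bigr => i _ /=.
have := pderivM i (cf (chart_at S p)) (cg _) (in_im p).
rewrite /= [par _ _]loc_pt => e.
by apply: etrans (congr1 _ e) _; rewrite mulrDr addrC !mulrA; congr (_ + _); rewrite mulrAC // mulrC mulrA.
Qed.

Lemma D_cst (r : R) a p : D a (fun=> r) p = 0.
Proof.
rewrite D_at big1 // => i _; rewrite -[RHS](mulr0 (Cmx (x \o loc S p) (pt S p) a i)); congr (_ * _).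
exact: derive_cst.
Qed.

Lemma D_sum (I : Type) (r : seq I) (P : pred I) (F : I -> M -> R) a p :
  (forall i, smooth 1 (F i)) ->
  D a (fun q => \sum_(i <- r | P i) F i q) p = \sum_(i <- r | P i) D a (F i) p.
Proof.
move=> cF; elim: r => [|i r IH].
  rewrite big_nil -[RHS](D_cst 0 a p); congr (D a _ p); apply/funext => q; exact: big_nil.
rewrite big_cons -IH; case Pi : (P i).
  rewrite -DD; [|exact: cF|exact: smooth_sum].
  by congr (D a _ p); apply/funext => q; rewrite big_cons Pi.
by congr (D a _ p); apply/funext => q; rewrite big_cons Pi.
Qed.

Definition smooth_mx k (p q : nat) (A : M -> 'M[R]_(p, q)) := forall r s, smooth k (fun y => A y r s).

Definition Dm (p q : nat) a (A : M -> 'M[R]_(p, q)) y : 'M[R]_(p, q) :=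
  \matrix_(r, s) D a (fun z => A z r s) y.

Section MatrixFields.
Context (k : nat) (p q r : nat).
Implicit Types y z : M.
Implicit Types (A : M -> 'M[R]_(p, q)) (B : M -> 'M[R]_(q, r)).

Lemma smooth_mx_mul A B : smooth_mx k A -> smooth_mx k B -> smooth_mx k (fun y => A y *m B y).
Proof.
move=> cA cB i j; have : smooth k (fun y => \sum_l A y i l * B y l j).
  by apply: smooth_sum => l; exact: smoothM.
by apply: smooth_eq => y; rewrite mulmx_entry.
Qed.

Lemma smooth_mxD A A' : smooth_mx k A -> smooth_mx k A' -> smooth_mx k (fun y => A y + A' y).
Proof. by move=> cA cA' i j; apply: smooth_eq (smoothD (cA i j) (cA' i j)) => y; rewrite [RHS]mxE. Qed.

Lemma smooth_mxN A : smooth_mx k A -> smooth_mx k (fun y => - A y).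
Proof. by move=> cA i j; apply: smooth_eq (smoothN (cA i j)) => y; rewrite [RHS]mxE. Qed.

Lemma smooth_mxZ f A : smooth k f -> smooth_mx k A -> smooth_mx k (fun y => f y *: A y).
Proof. by move=> cf cA i j; apply: smooth_eq (smoothM cf (cA i j)) => y; rewrite [RHS]mxE. Qed.

Lemma smooth_mx_cst (A : 'M[R]_(p, q)) : smooth_mx k (fun=> A).
Proof. by move=> i j; exact: smooth_cst. Qed.

Lemma smooth_mx_tr A : smooth_mx k A -> smooth_mx k (fun y => (A y)^T).
Proof. by move=> cA i j; apply: smooth_eq (cA j i) => y; rewrite [RHS]mxE. Qed.

Lemma smooth_Dm a A : smooth_mx k.+1 A -> smooth_mx k (Dm a A).
Proof. by move=> cA i j; apply: smooth_eq (smooth_D a (cA i j)) => y; rewrite [RHS]mxE. Qed.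

Lemma Dm_mul a A B y : smooth_mx 1 A -> smooth_mx 1 B ->
  Dm a (fun y => A y *m B y) y = Dm a A y *m B y + A y *m Dm a B y.
Proof.
move=> cA cB; apply/matrixP => i j; rewrite [LHS]mxE [RHS]mxE 2![in RHS]mulmx_entry -big_split.
have -> : (fun z => (A z *m B z) i j) = (fun z => \sum_l A z i l * B z l j).
  by apply/funext => z; rewrite mulmx_entry.
rewrite D_sum; last by move=> l; exact: smoothM.
apply: eq_bigr => l _; rewrite DM; [|exact: cA|exact: cB].
by rewrite [X in _ = X * _ + _]mxE [X in _ = _ + _ * X]mxE.
Qed.

Lemma DmD a A A' y : smooth_mx 1 A -> smooth_mx 1 A' ->
  Dm a (fun y => A y + A' y) y = Dm a A y + Dm a A' y.
Proof.
move=> cA cB; apply/matrixP => i j; rewrite [LHS]mxE [RHS]mxE [X in _ = X + _]mxE [X in _ = _ + X]mxE -DD; [|exact: cA|exact: cB].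
by congr (D a _ y); apply/funext => z; rewrite mxE.
Qed.

Lemma DmZ a f A y : smooth 1 f -> smooth_mx 1 A ->
  Dm a (fun y => f y *: A y) y = D a f y *: A y + f y *: Dm a A y.
Proof.
move=> cf cA; apply/matrixP => i j; rewrite [LHS]mxE [RHS]mxE [X in _ = X + _]mxE [X in _ = _ + X]mxE.
rewrite [X in _ = _ + _ * X]mxE -DM; [|exact: cf|exact: cA].
by congr (D a _ y); apply/funext => z; rewrite mxE.
Qed.

Lemma Dm_cst a (A : 'M[R]_(p, q)) y : Dm a (fun=> A) y = 0.
Proof. by apply/matrixP => i j; rewrite [LHS]mxE D_cst [RHS]mxE. Qed.

Lemma DmN a A y : smooth_mx 1 A -> Dm a (fun y => - A y) y = - Dm a A y.
Proof.
move=> cA; have -> : (fun y => - A y) = (fun y => -1 *: A y).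
  by apply/funext => z; rewrite scaleN1r.
rewrite DmZ; [|exact: smooth_cst|exact: cA].
by rewrite D_cst scale0r add0r scaleN1r.
Qed.

Lemma Dm_tr a A y : Dm a (fun y => (A y)^T) y = (Dm a A y)^T.
Proof.
apply/matrixP => i j; rewrite [LHS]mxE [RHS]mxE [RHS]mxE.
by congr (D a _ y); apply/funext => z; rewrite mxE.
Qed.

End MatrixFields.

End TangentialCalculus.

(** * The tangential and normal projections and their derivatives *)

Section TangentialGeometry.
Context (R : realType) (m n : nat) (M : topologicalType).
Local Notation d := (n.+1 + 1)%N.
Local Notation E := 'rV[R]_d.
Context (S : manifold R m M) (x : M -> E) (imm : immersion S x).
Implicit Types (c : chart S) (p : M) (u : 'rV[R]_m) (f g : M -> R) (a b : 'I_d).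

Local Notation smooth k f := (smooth S k f).
Local Notation smooth_mx k A := (smooth_mx S k A).
Local Notation D := (D S x).
Local Notation Dm := (Dm S x).
Local Notation C p := (Cmx (x \o loc S p) (pt S p)).
Local Notation J p := (jac (x \o loc S p) (pt S p)).
Local Notation et := (d_t R n).

(* The tangential projection, since D_a x is the projection of the a-th basis vector. *)
Definition Pi p : 'M[R]_d := \matrix_(a, b) D a (fun q => x q 0 b) p.

Lemma jac_chart c u i a : im c u ->
  jac (x \o par c) u i a = pderiv i (fun v => (x \o par c) v 0 a : R^o) u.
Proof. by move=> iu; apply: (jacE (V := im c)) => // k; exact: immersion_class. Qed.

Lemma Pi_chart c u : im c u ->
  Pi (par c u) = Cmx (x \o par c) u *m jac (x \o par c) u.
Proof.
move=> iu; apply/matrixP => a b; rewrite [LHS]mxE [RHS]mulmx_entry.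
have := D_chart imm a (smooth_x imm 1 b) (par_dom iu); rewrite parK // => e.
by apply: etrans e _; apply: eq_bigr => i _; congr (_ * _); exact: (esym (jac_chart i b iu)).
Qed.

Lemma PiE p : Pi p = C p *m J p.
Proof. by have := Pi_chart (in_im S p); rewrite [par _ _]loc_pt. Qed.

Lemma J_C p : J p *m C p = 1%:M.
Proof.
apply: (jac_Cmx (V := im (chart_at S p))); last exact: in_im.
by move=> u; exact: immersion_free.
Qed.

Lemma Pi_C p : Pi p *m C p = C p.
Proof. by rewrite PiE -mulmxA J_C mulmx1. Qed.

Lemma Pi_sym p : (Pi p)^T = Pi p.
Proof. by rewrite PiE /Cmx !trmx_mul trmxK invmetric_sym mulmxA. Qed.

Lemma Pi_idem p : Pi p *m Pi p = Pi p.
Proof. by rewrite {2}PiE mulmxA Pi_C -PiE. Qed.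

Lemma tr_Pi p : \tr (Pi p) = m%:R.
Proof. by rewrite PiE mxtrace_mulC J_C mxtrace1. Qed.

(** The direction of [D a] is already a tangential projection, and projecting it again changes
    nothing. *)
Lemma D_Pi f a p : D a f p = \sum_b Pi p a b * D b f p.
Proof.
rewrite D_at.
have -> : \sum_b Pi p a b * D b f p = \sum_b \sum_i Pi p a b * C p b i * pderiv i (f \o loc S p : _ -> R^o) (pt S p).
  by apply: eq_bigr => b _; rewrite D_at mulr_sumr; apply: eq_bigr => i _; rewrite mulrA.
rewrite exchange_big; apply: eq_bigr => i _ /=; rewrite -mulr_suml; congr (_ * _).
by rewrite -[in LHS](Pi_C p) mulmx_entry.
Qed.

Lemma Dm_Pi (q r : nat) (A : M -> 'M[R]_(q, r)) a p : Dm a A p = \sum_b Pi p a b *: Dm b A p.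
Proof.
apply/matrixP => i j; rewrite [LHS]mxE D_Pi summxE; apply: eq_bigr => b _.
by rewrite [RHS]mxE [X in _ = _ * X]mxE.
Qed.

Lemma smooth_Pi k : smooth_mx k Pi.
Proof. by move=> a b; apply: smooth_eq (smooth_D imm a (smooth_x imm k.+1 b)) => p; rewrite [RHS]mxE. Qed.

Lemma smooth_mx_x k : smooth_mx k x.
Proof. by move=> i b; rewrite ord1; exact: smooth_x. Qed.

Lemma Dm_x a p : Dm a x p = row a (Pi p).
Proof. by apply/rowP => b; rewrite [LHS]mxE [RHS]mxE [RHS]mxE. Qed.

(* The projection of R^(n+2) onto R^(n+1). *)
Definition sphere_proj : 'M[R]_d := block_mx 1%:M 0 0 0.

Definition eta p : E := SnR_normal (x p).

Lemma etaE p : eta p = x p *m sphere_proj.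
Proof.
rewrite /eta /SnR_normal /sphere_proj -[X in _ = X *m _](hsubmxK (x p)).
by rewrite mul_row_block !mulmx0 mulmx1 !addr0.
Qed.

Lemma sphere_projE : sphere_proj = 1%:M - et^T *m et.
Proof.
rewrite /sphere_proj /d_t tr_row_mx mul_col_row !trmx0 !mul0mx trmx1 mulmx1 mulmx0.
by rewrite [X in X - _]scalar_mx_block opp_block_mx add_block_mx !oppr0 !addr0 subrr.
Qed.

Lemma eta_et p : eta p *m et^T = 0.
Proof. by rewrite /eta /SnR_normal /d_t tr_row_mx mul_row_col trmx0 mulmx0 mul0mx addr0. Qed.

Lemma eta_eta p : eta p *m (eta p)^T = 1%:M.
Proof.
have [/(_ p) + _ _] := imm; rewrite /in_SnR /dot => h.
apply/matrixP => i j; rewrite !ord1 [RHS]mxE eqxx mulr1n -[RHS]h.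
by rewrite /eta /SnR_normal tr_row_mx mul_row_col mul0mx addr0.
Qed.

Lemma smooth_eta k : smooth_mx k eta.
Proof.
have -> : eta = fun p => x p *m sphere_proj by apply/funext => p; exact: etaE.
by apply: smooth_mx_mul; [exact: smooth_mx_x|exact: smooth_mx_cst].
Qed.

Lemma Dm_eta a p : Dm a eta p = row a (Pi p) *m sphere_proj.
Proof.
have -> : eta = fun p => x p *m sphere_proj by apply/funext => q; exact: etaE.
rewrite Dm_mul; [|exact: smooth_mx_x|exact: smooth_mx_cst].
by rewrite Dm_cst mulmx0 addr0 Dm_x.
Qed.

(** Differentiating <eta, eta> = 1 shows that D_a eta is orthogonal to eta. Since D_a eta is row a
    of [Pi] projected on R^(n+1), and that projection fixes eta, the product is an entry of
    [Pi *m eta^T]. *)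
Lemma Pi_eta p : Pi p *m (eta p)^T = 0.
Proof.
apply/colP => a.
have := Dm_mul x a p (smooth_eta 1) (smooth_mx_tr (smooth_eta 1)).
have -> : (fun q => eta q *m (eta q)^T) = fun=> 1%:M by apply/funext => q; exact: eta_eta.
rewrite Dm_cst Dm_tr => /esym e.
have e2 : Dm a eta p *m (eta p)^T = row a (Pi p *m (eta p)^T).
  rewrite Dm_eta row_mul -mulmxA; congr (_ *m _).
  by rewrite sphere_projE mulmxBl mul1mx -mulmxA -[et *m _]trmxK trmx_mul trmxK eta_et trmx0 mulmx0 subr0.
have e3 : eta p *m (Dm a eta p)^T = row a (Pi p *m (eta p)^T).
  by rewrite -e2 -[LHS]trmxK trmx_mul trmxK; apply/matrixP => i j; rewrite !ord1 [LHS]mxE.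
have := congr1 (fun A : 'M[R]_1 => A 0 0) e.
rewrite e2 e3 [LHS]mxE [RHS]mxE => /eqP; rewrite -mulr2n mulrn_eq0 /= => /eqP e4.
by rewrite [RHS]mxE -e4 [RHS]mxE.
Qed.

Lemma eta_Pi p : eta p *m Pi p = 0.
Proof. by rewrite -[LHS]trmxK trmx_mul Pi_sym Pi_eta trmx0. Qed.

(* The projection onto the normal space of the submanifold in S^n x R. *)
Definition Q p : 'M[R]_d := 1%:M - Pi p - (eta p)^T *m eta p.

Lemma Q_sym p : (Q p)^T = Q p.
Proof. by rewrite /Q !linearB /= trmx1 Pi_sym trmx_mul trmxK. Qed.

Lemma Pi_Q p : Pi p *m Q p = 0.
Proof. by rewrite /Q !mulmxBr mulmx1 Pi_idem mulmxA Pi_eta mul0mx subrr subr0. Qed.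

Lemma Q_Pi p : Q p *m Pi p = 0.
Proof. by rewrite -[LHS]trmxK trmx_mul Pi_sym Q_sym Pi_Q trmx0. Qed.

Lemma eta_Q p : eta p *m Q p = 0.
Proof. by rewrite /Q !mulmxBr mulmx1 eta_Pi subr0 mulmxA eta_eta mul1mx subrr. Qed.

Lemma Q_idem p : Q p *m Q p = Q p.
Proof. by rewrite {1}/Q !mulmxBl mul1mx Pi_Q subr0 -mulmxA eta_Q mulmx0 subr0. Qed.

Lemma smooth_Q k : smooth_mx k Q.
Proof.
apply: smooth_mxD; last first.
  by apply: smooth_mxN; apply: smooth_mx_mul; [apply: smooth_mx_tr|]; exact: smooth_eta.
by apply: smooth_mxD; [exact: smooth_mx_cst|apply: smooth_mxN; exact: smooth_Pi].
Qed.

Lemma tan_partE c u v : im c u -> tan_part (x \o par c) u v = v *m Pi (par c u).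
Proof. by move=> iu; rewrite Pi_chart // /tan_part compsE mulmxA. Qed.

Lemma nor_partE c u v : im c u -> nor_part (x \o par c) u v = v *m Q (par c u).
Proof.
move=> iu; rewrite /nor_part tan_partE //.
have -> : SnR_proj ((x \o par c) u) v = v *m (1%:M - (eta (par c u))^T *m eta (par c u)).
  rewrite /SnR_proj mulmxBr mulmx1 mulmxA; congr (_ - _).
  by rewrite [v *m _]mx11_scalar mul_scalar_mx.
rewrite -[v *m _ *m _]mulmxA -mulmxBr; congr (v *m _).
by rewrite mulmxBl mul1mx -[_ *m eta _ *m _]mulmxA eta_Pi mulmx0 subr0 /Q addrAC.
Qed.

Lemma TE p : T S x p = et *m Pi p.
Proof. by rewrite /T (tan_partE _ (in_im S p)) [par _ _]loc_pt. Qed.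

Lemma NE p : N S x p = et *m Q p.
Proof.
rewrite /N TE /Q !mulmxBr mulmx1 mulmxA -[et *m (eta p)^T]trmxK trmx_mul trmxK.
by rewrite eta_et trmx0 mul0mx subr0.
Qed.

Lemma Dm_at (q r : nat) (A : M -> 'M[R]_(q, r)) a p :
  Dm a A p = \sum_i C p a i *: dM i (A \o loc S p) (pt S p).
Proof.
apply/matrixP => i j; rewrite [LHS]mxE D_at summxE; apply: eq_bigr => b _.
by rewrite [RHS]mxE [X in _ = _ * X]mxE.
Qed.

(** Global form of [covariant_deriv]: the right side is the covariant derivative in coordinates of
    the tensor with components psi, the left side involves only [D] and [Pi]. *)
Lemma covariantE (q : nat) (w : M -> 'M[R]_(d, q)) (psi : 'rV[R]_m -> 'M[R]_(m, q)) a p :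
  mx_C 1 (im (chart_at S p)) psi ->
  (forall u, im (chart_at S p) u -> w (loc S p u) = Cmx (x \o loc S p) u *m psi u) ->
  Dm a w p - Dm a Pi p *m w p =
  \sum_i C p a i *: (C p *m (dM i psi (pt S p) - dM i (jac (x \o loc S p)) (pt S p) *m C p *m psi (pt S p))).
Proof.
move=> cpsi wE; set V := im (chart_at S p) in cpsi wE.
have Vp : V (pt S p) by exact: in_im.
have oV : open V by exact: open_im.
have cF k : class_C k V (x \o loc S p) by exact: immersion_class.
have fr u : V u -> row_free (jac (x \o loc S p) u) by exact: immersion_free.
have wp : w p = C p *m psi (pt S p) by rewrite -wE // loc_pt.
rewrite 2!Dm_at mulmx_suml -sumrB; apply: eq_bigr => i _.
rewrite -scalemxAl -scalerBr; congr (_ *: _).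
rewrite (dM_eq (B := fun u => Cmx (x \o loc S p) u *m psi u) i oV wE Vp).
have eP u : V u -> (Pi \o loc S p) u = Cmx (x \o loc S p) u *m jac (x \o loc S p) u by exact: Pi_chart.
rewrite (dM_eq i oV eP Vp) wp.
exact: (covariant_deriv oV cF fr i cpsi Vp).
Qed.

End TangentialGeometry.

(** * Second fundamental form and second covariant derivatives *)

Lemma row_entry (R : pzSemiRingType) p q (A : 'M[R]_(p, q)) i j : row i A 0 j = A i j.
Proof. exact: mxE. Qed.

Section Bilinear.
Context (R : realType) (d : nat).
Local Notation E := 'rV[R]_d.

Definition bil k (X Y : 'rV[R]_k) (nu : 'I_k -> 'I_k -> E) : E :=
  \sum_i \sum_j (X 0 i * Y 0 j) *: nu i j.

(** A vector-valued form is split into one scalar matrix per coordinate of its values, to which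
    matrix algebra and traces apply. *)
Definition coefmx k (nu : 'I_k -> 'I_k -> E) l : 'M[R]_k := \matrix_(i, j) nu i j 0 l.

Lemma bil_coef k (X Y : 'rV[R]_k) nu l : bil X Y nu 0 l = (X *m coefmx nu l *m Y^T) 0 0.
Proof.
rewrite -mulmxA mulmx_entry /bil summxE; apply: eq_bigr => i _.
rewrite mulmx_entry mulr_sumr summxE; apply: eq_bigr => j _.
have -> : coefmx nu l i j = nu i j 0 l by rewrite mxE.
by rewrite [LHS]mxE [Y^T _ _]mxE -mulrA [Y 0 j * _]mulrC.
Qed.

(** With A = [Cmx], entry (a, b) is the value of the form on the tangential projections of the a-th
    and b-th basis vectors, since row a of [Cmx] holds the components of the a-th projection. *)
Definition lift_form k r (A : 'M[R]_(r, k)) (nu : 'I_k -> 'I_k -> E) (a b : 'I_r) : E :=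
  bil (row a A) (row b A) nu.

Lemma coefmx_lift k r (A : 'M[R]_(r, k)) nu l :
  coefmx (lift_form A nu) l = A *m coefmx nu l *m A^T.
Proof.
apply/matrixP => a b; rewrite [LHS]mxE bil_coef -row_mul 2!mulmx_entry.
by apply: eq_bigr => i _; congr (_ * _); rewrite !mxE.
Qed.

Lemma bil_mul k r (A : 'M[R]_(r, k)) (X Y : 'rV[R]_r) nu :
  bil (X *m A) (Y *m A) nu = bil X Y (lift_form A nu).
Proof.
by apply/rowP => l; rewrite 2!bil_coef coefmx_lift trmx_mul !mulmxA.
Qed.

End Bilinear.

Section Links.
Context (R : realType) (m n : nat) (M : topologicalType).
Local Notation d := (n.+1 + 1)%N.
Local Notation E := 'rV[R]_d.
Context (S : manifold R m M) (x : M -> E) (imm : immersion S x).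
Implicit Types (c : chart S) (p : M) (u : 'rV[R]_m) (f g : M -> R) (a b : 'I_d).

Local Notation smooth k f := (smooth S k f).
Local Notation smooth_mx k A := (smooth_mx S k A).
Local Notation D := (D S x).
Local Notation Dm := (Dm S x).
Local Notation F p := (x \o loc S p).
Local Notation C p := (Cmx (F p) (pt S p)).
Local Notation J p := (jac (F p) (pt S p)).
Local Notation Pi := (Pi S x).
Local Notation Q := (Q S x).

(* Row b is sigma(Pi e_a, Pi e_b); in the same way nhess_form, hess_col and P_form below
   hold the components of nabla^2 xi, Hess f and P in the tangential projections of the
   basis of R^(n+2). *)
Definition sff_form a p : 'M[R]_d := Dm a Pi p *m Q p.

Lemma row_mulC (k r q : nat) (A : 'M[R]_(r, k)) (X : 'M[R]_(k, q)) (i : 'I_r) :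
  row i (A *m X) = \sum_j A i j *: row j X.
Proof.
rewrite row_mul mulmx_sum_row; apply: eq_bigr => j _.
by rewrite [X in X *: _]mxE.
Qed.

(* psi holds the coordinate components of the tensor w. With psi = jac it yields sigma, with
   psi = nabla^perp xi the second covariant derivative of xi. *)
Lemma lift_covariant (w : M -> 'M[R]_d) (psi : 'rV[R]_m -> 'M[R]_(m, d)) a b p :
  mx_C 1 (im (chart_at S p)) psi ->
  (forall u, im (chart_at S p) u -> w (loc S p u) = Cmx (F p) u *m psi u) ->
  lift_form (C p) (fun i j => row j (dM i psi (pt S p) - dM i (jac (F p)) (pt S p) *m C p *m psi (pt S p)) *m Q p) a b =
  row b ((Dm a w p - Dm a Pi p *m w p) *m Q p).
Proof.
move=> cpsi wE; rewrite (covariantE imm a cpsi wE) mulmx_suml linear_sum.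
apply: eq_bigr => i _; rewrite -scalemxAl linearZ /= -[C p *m _ *m Q p]mulmxA [in RHS]row_mulC scaler_sumr.
by apply: eq_bigr => j _; rewrite [in RHS]row_mul scalerA 2!row_entry.
Qed.

Lemma pderiv_row i (G : 'rV[R]_m -> E) u : derivable G u (delta_mx 0 i) ->
  pderiv i G u = \row_l pderiv i (fun v => G v 0 l : R^o) u.
Proof.
by move=> dG; apply/rowP => l; rewrite [RHS]mxE {1}/pderiv derive_mx // [LHS]mxE.
Qed.

Lemma pderiv_row_dM i (q : nat) (G : 'rV[R]_m -> E) (A : 'rV[R]_m -> 'M[R]_(q, d)) j u :
  derivable G u (delta_mx 0 i) -> (forall v, G v = row j (A v)) ->
  pderiv i G u = row j (dM i A u).
Proof.
move=> dG GA; rewrite pderiv_row //; apply/rowP => l; rewrite row_entry [LHS]mxE [RHS]mxE.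
by congr (pderiv i _ u); apply/funext => v; rewrite GA row_entry.
Qed.

(** Case psi = [jac], w = [Pi] of [lift_covariant]: the correction term on each side ends in [Pi]
    and is killed by [Q]. *)
Lemma sff_lift p a b : lift_form (C p) (loc_sff (F p) (pt S p)) a b = row b (sff_form a p).
Proof.
have iu := in_im S p.
have cF k := immersion_class imm (chart_at S p) k.
have cJ : mx_C 1 (im (chart_at S p)) (jac (F p)).
  by apply: mx_C_jac; [exact: open_im|exact: cF].
have wE u : im (chart_at S p) u -> Pi (loc S p u) = Cmx (F p) u *m jac (F p) u.
  exact: Pi_chart.
have := lift_covariant a b cJ wE.
rewrite mulmxBl -[_ *m Pi p *m Q p]mulmxA (Pi_Q imm) mulmx0 subr0 => <-.
congr (bil _ _ _); apply/funext => i; apply/funext => j.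
have -> : dM i (jac (F p)) (pt S p) *m C p *m J p = dM i (jac (F p)) (pt S p) *m Pi p.
  by rewrite -mulmxA -(PiE imm).
rewrite -row_mul mulmxBl -[_ *m Pi p *m Q p]mulmxA (Pi_Q imm) mulmx0 subr0 row_mul.
have := nor_partE imm (pderiv i (pderiv j (F p)) (pt S p)) iu.
rewrite [par _ _]loc_pt => e; apply: etrans e _; congr (_ *m _).
apply: pderiv_row_dM; first exact: class_C_derivable (class_C_pderiv j (cF 2)) iu.
by move=> v; exact: (esym (rowK _ _)).
Qed.

Section NormalField.
Context (xi : M -> E) (xi_smooth : forall k, class_C_on S k xi).

Definition Dxi p : 'M[R]_d := \matrix_(b, l) D b (fun q => xi q 0 l) p.
Definition Nxi p : 'M[R]_d := Dxi p *m Q p.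

Lemma smooth_xi k : smooth_mx k xi.
Proof.
move=> i l; rewrite ord1 => c.
by have := class_C_coord l (@open_im _ _ _ _ c) (xi_smooth k c); exact.
Qed.

Lemma smooth_Dxi k : smooth_mx k Dxi.
Proof.
by move=> b l; apply: smooth_eq (smooth_D imm b (smooth_xi k.+1 0 l)) => p; rewrite [RHS]mxE.
Qed.

Lemma smooth_Nxi k : smooth_mx k Nxi.
Proof. by apply: smooth_mx_mul; [exact: smooth_Dxi|exact: smooth_Q]. Qed.

Lemma Dm_xi a p : Dm a xi p = row a (Dxi p).
Proof. by apply/rowP => l; rewrite [LHS]mxE [RHS]mxE [RHS]mxE. Qed.

Definition partials p v : 'M[R]_(m, d) :=
  \matrix_(j, l) pderiv j (fun w => xi (loc S p w) 0 l : R^o) v.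
Definition npartials p v : 'M[R]_(m, d) :=
  \matrix_(j, l) loc_nconn (F p) j (xi \o loc S p) v 0 l.

Lemma loc_nconn_row p j v : loc_nconn (F p) j (xi \o loc S p) v = row j (npartials p v).
Proof. by apply/rowP => l; rewrite [RHS]mxE [RHS]mxE. Qed.

Lemma npartialsE p v : im (chart_at S p) v -> npartials p v = partials p v *m Q (loc S p v).
Proof.
move=> iv; apply/row_matrixP => j; rewrite -loc_nconn_row row_mul.
apply: etrans (nor_partE imm (pderiv j (xi \o loc S p) v) iv) _; congr (_ *m _).
rewrite pderiv_row; last exact: class_C_derivable (xi_smooth 1 (chart_at S p)) iv.
by apply/rowP => l; rewrite [LHS]mxE [RHS]mxE [RHS]mxE.
Qed.

Lemma mx_C_npartials p : mx_C 1 (im (chart_at S p)) (npartials p).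
Proof.
move=> j l; have oV := @open_im _ _ _ S (chart_at S p).
have : mx_C 1 (im (chart_at S p)) (fun v => partials p v *m Q (loc S p v)).
  apply: mx_C_mul => // [i k|i k].
    have := class_C_pderiv i (smooth_xi 2 0 k (chart_at S p)).
    by apply: class_C_eq => // v iv; rewrite [RHS]mxE.
  exact: (smooth_Q imm 1 i k (chart_at S p)).
by move=> /(_ j l); apply: class_C_eq => // v iv; rewrite npartialsE.
Qed.

Lemma Nxi_chart p v : im (chart_at S p) v ->
  Nxi (loc S p v) = Cmx (F p) v *m npartials p v.
Proof.
move=> iv; rewrite npartialsE // mulmxA /Nxi; congr (_ *m _).
apply/matrixP => b l; rewrite [LHS]mxE mulmx_entry.
have := D_chart imm b (smooth_xi 1 0 l) (par_dom iv); rewrite parK // => e.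
by apply: etrans e _; apply: eq_bigr => j _; congr (_ * _); rewrite [RHS]mxE.
Qed.

Definition nhess_form a p : 'M[R]_d := (Dm a Nxi p - Dm a Pi p *m Nxi p) *m Q p.

(** Case psi = [npartials], w = [Nxi] of [lift_covariant]. The first derivatives are already normal,
    so the final projection leaves the Christoffel term unchanged. *)
Lemma nhess_lift p a b :
  lift_form (C p) (loc_nhess (F p) (xi \o loc S p) (pt S p)) a b = row b (nhess_form a p).
Proof.
have iu := in_im S p.
rewrite -(lift_covariant a b (@mx_C_npartials p) (@Nxi_chart p)).
congr (bil _ _ _); apply/funext => i; apply/funext => j; rewrite /loc_nhess.
have -> : loc_nconn (F p) i (loc_nconn (F p) j (xi \o loc S p)) (pt S p) =
    row j (dM i (npartials p) (pt S p)) *m Q p.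
  have := nor_partE imm (pderiv i (loc_nconn (F p) j (xi \o loc S p)) (pt S p)) iu.
  rewrite [par _ _]loc_pt => e; apply: etrans e _; congr (_ *m _).
  apply: pderiv_row_dM; last by move=> v; exact: loc_nconn_row.
  apply/derivable_mxP => a' l; rewrite ord1.
  have := class_C_derivable (i := i) (@mx_C_npartials p j l) iu.
  rewrite (_ : (fun v => npartials p v j l) = (fun v => loc_nconn (F p) j (xi \o loc S p) v 0 l)) //.
  by apply/funext => v; rewrite [LHS]mxE.
have npQ : npartials p (pt S p) *m Q p = npartials p (pt S p).
  by rewrite npartialsE // loc_pt -mulmxA (Q_idem imm).
rewrite [X in _ = X *m _]linearB mulmxBl; congr (_ - _).
rewrite -row_mul -[_ *m npartials p _ *m _]mulmxA npQ row_mulC.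
apply: eq_bigr => k _; rewrite loc_nconn_row; congr (_ *: _).
exact: (christoffelE (@open_im _ _ _ S (chart_at S p)) (immersion_class imm (chart_at S p)) i j k iu).
Qed.

End NormalField.

Section Hessian.
Context (f : M -> R) (f_C2 : smooth 2 f).

Definition Df p : 'cV[R]_d := \col_b D b f p.

Lemma smooth_Df : smooth_mx 1 Df.
Proof. by move=> b i; apply: smooth_eq (smooth_D imm b f_C2) => p; rewrite [RHS]mxE. Qed.

Lemma gradE p : grad S x f p = (Df p)^T.
Proof. by apply/rowP => b; rewrite [RHS]mxE [RHS]mxE. Qed.

Definition hess_col a p : 'cV[R]_d := Dm a Df p - Dm a Pi p *m Df p.

Lemma hess_lift p a b :
  (C p *m loc_hess (F p) (f \o loc S p) (pt S p) *m (C p)^T) a b = hess_col a p b 0.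
Proof.
have iu := in_im S p; have oV := @open_im _ _ _ S (chart_at S p).
pose psi v : 'cV[R]_m := \col_j pderiv j (f \o loc S p : _ -> R^o) v.
have cpsi : mx_C 1 (im (chart_at S p)) psi.
  move=> j l; have := class_C_pderiv j (f_C2 (chart_at S p)).
  by apply: class_C_eq => // v iv; rewrite [RHS]mxE.
have wE v : im (chart_at S p) v -> Df (loc S p v) = Cmx (F p) v *m psi v.
  move=> iv; apply/colP => b'; rewrite [LHS]mxE mulmx_entry.
  have := D_chart imm b' (smooth1 f_C2) (par_dom iv); rewrite parK // => e.
  by apply: etrans e _; apply: eq_bigr => j _; congr (_ * _); rewrite [RHS]mxE.
rewrite /hess_col (covariantE imm a cpsi wE) -mulmxA mulmx_entry summxE.
apply: eq_bigr => i _; rewrite [RHS]mxE; congr (_ * _).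
rewrite 2!mulmx_entry; apply: eq_bigr => j _; rewrite [X in X * _]mxE [X in _ * X]mxE mulrC.
congr (_ * _); rewrite [RHS]mxE [X in _ = _ + X]mxE; congr (_ - _).
  apply: etrans _ (esym (mxE _ _ _ _)).
  by apply: (congr1 (fun G => pderiv i G (pt S p))); apply/funext => v; exact: (esym (mxE _ _ _ _)).
rewrite mulmx_entry; apply: eq_bigr => k _; rewrite [X in _ = _ * X]mxE; congr (_ * _).
exact: (christoffelE (@open_im _ _ _ S (chart_at S p)) (immersion_class imm (chart_at S p)) i j k iu).
Qed.

End Hessian.

End Links.

(** * The operators of the theorem as traces free of frames *)

Section Frames.
Context (R : realType) (m n : nat) (M : topologicalType).
Local Notation d := (n.+1 + 1)%N.
Local Notation E := 'rV[R]_d.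
Context (S : manifold R m M) (x : M -> E) (imm : immersion S x) (m_gt0 : (0 < m)%N).
Implicit Types (p : M) (a b : 'I_d).

Local Notation smooth k f := (smooth S k f).
Local Notation F p := (x \o loc S p).
Local Notation C p := (Cmx (F p) (pt S p)).
Local Notation J p := (jac (F p) (pt S p)).
Local Notation Pi := (Pi S x).
Local Notation Q := (Q S x).
Local Notation sff_form := (sff_form S x).

Lemma sum_mul_tr k q (A B : 'M[R]_(k, q)) : \sum_i \sum_j A i j * B i j = \tr (A *m B^T).
Proof.
apply: eq_bigr => i _; rewrite mulmx_entry; apply: eq_bigr => j _.
by rewrite [X in _ = _ * X]mxE.
Qed.

Lemma dot_entry k r q (A : 'M[R]_(k, q)) (B : 'M[R]_(r, q)) i j : (A *m B^T) i j = dot (row i A) (row j B).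
Proof.
rewrite mulmx_entry dotE; apply: eq_bigr => l _.
by rewrite !row_entry [X in _ * X]mxE.
Qed.

Lemma sandwich_entry k r (A B : 'M[R]_(r, k)) (X : 'M[R]_k) i j :
  (A *m X *m B^T) i j = (row i A *m X *m (row j B)^T) 0 0.
Proof.
rewrite -row_mul [LHS]mulmx_entry [RHS]mulmx_entry; apply: eq_bigr => l _.
by rewrite row_entry [X in _ * X]mxE [X in _ = _ * X]mxE row_entry.
Qed.

Lemma sffE p X Y : sff S x p X Y = bil X Y (fun a b => row b (sff_form a p)).
Proof.
have -> : sff S x p X Y = bil (comps (F p) (pt S p) X) (comps (F p) (pt S p) Y) (loc_sff (F p) (pt S p)) by [].
rewrite !compsE bil_mul; congr (bil _ _ _); apply/funext => a; apply/funext => b.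
exact: sff_lift.
Qed.

Definition sff_mx p l : 'M[R]_d := coefmx (fun a b => row b (sff_form a p)) l.

Lemma sff_mxE p l : sff_mx p l = C p *m coefmx (loc_sff (F p) (pt S p)) l *m (C p)^T.
Proof.
rewrite -coefmx_lift /sff_mx; congr (coefmx _ l).
by apply/funext => a; apply/funext => b; rewrite sff_lift.
Qed.

Lemma sff_mx_Pi p l : sff_mx p l *m Pi p = sff_mx p l.
Proof.
have CtPi : (C p)^T *m Pi p = (C p)^T by rewrite -[Pi p](Pi_sym imm) -trmx_mul (Pi_C imm).
by rewrite sff_mxE -mulmxA CtPi.
Qed.

Lemma sff_mx_sym p l : (sff_mx p l)^T = sff_mx p l.
Proof.
rewrite sff_mxE; move: (C p) => Cp; rewrite !trmx_mul trmxK mulmxA; congr (_ *m _ *m _).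
apply/matrixP => i j; rewrite [LHS]mxE [LHS]mxE [RHS]mxE.
have iu := in_im S p.
have -> : loc_sff (F p) (pt S p) j i = loc_sff (F p) (pt S p) i j.
  have cF := immersion_class imm (chart_at S p).
  have e k k' : pderiv k (pderiv k' (F p)) (pt S p) = row k' (dM k (jac (F p)) (pt S p)).
    apply: pderiv_row_dM; first exact: class_C_derivable (class_C_pderiv k' (cF 2)) iu.
    by move=> v; exact: (esym (rowK _ _)).
  apply: (congr1 (nor_part (F p) (pt S p))); apply: etrans (e j i) (etrans _ (esym (e i j))).
  apply/rowP => b; apply: etrans (row_entry _ _ _) (etrans _ (esym (row_entry _ _ _))).
  exact: (second_deriv_sym (@open_im _ _ _ S (chart_at S p)) cF).
reflexivity.
Qed.

(** This is m h: a tangential form has the same trace over the standard basis of R^(n+2) as over an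
    orthonormal basis of the tangent space. *)
Definition Hvec p : E := \sum_a row a (sff_form a p).

Lemma Hvec_tr p l : Hvec p 0 l = \tr (sff_mx p l).
Proof. by rewrite /Hvec summxE; apply: eq_bigr => a _; rewrite row_entry [RHS]mxE row_entry. Qed.

Definition P_form a p : 'M[R]_d := col a (Pi p) *m Hvec p - sff_form a p.

Definition P_mx p l : 'M[R]_d := coefmx (fun a b => row b (P_form a p)) l.

Lemma P_mxE p l : P_mx p l = Hvec p 0 l *: Pi p - sff_mx p l.
Proof.
apply/matrixP => a b.
have -> : P_mx p l a b = P_form a p b l by rewrite mxE row_entry.
have -> : P_form a p b l = Pi p b a * Hvec p 0 l - sff_form a p b l.
  by rewrite [LHS]mxE mulmx_entry big_ord1 [X in X * _]mxE [X in _ + X]mxE.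
have -> : sff_form a p b l = sff_mx p l a b by rewrite [RHS]mxE row_entry.
have -> : Pi p b a = Pi p a b by rewrite -[in LHS](Pi_sym imm) [LHS]mxE.
by rewrite [RHS]mxE [X in _ = X + _]mxE [X in _ = _ + X]mxE mulrC.
Qed.

Lemma P_mx_sym p l : (P_mx p l)^T = P_mx p l.
Proof. by rewrite P_mxE linearB linearZ /= (Pi_sym imm) sff_mx_sym. Qed.

Lemma P_form_sym a b p : row b (P_form a p) = row a (P_form b p).
Proof.
apply/rowP => l; have /matrixP/(_ b a) := P_mx_sym p l.
by rewrite [X in X = _]mxE [X in X = _]mxE [X in _ = X]mxE.
Qed.

Section Frame.
Context (p : M) (e : 'I_m -> E) (e_frame : tangent_frame S x p e).
Let Em : 'M[R]_(m, d) := \matrix_i e i.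

Lemma frame_row i : row i Em = e i. Proof. exact: rowK. Qed.

Lemma frame_EEt : Em *m Em^T = 1%:M.
Proof. by apply/matrixP => i j; rewrite dot_entry !frame_row (e_frame.1 i j) mxE. Qed.

(** The frame is K J for a square matrix K, and orthonormality reads K g K^T = 1. So g is the
    inverse of K^T K, and J^T g^-1 J becomes (K J)^T (K J). *)
Lemma frame_gram : Em^T *m Em = Pi p.
Proof.
have /submxP[K EK] : (Em <= J p)%MS.
  by apply/row_subP => i; rewrite frame_row; exact: e_frame.2.
have Kg : K *m (metric (F p) (pt S p) *m K^T) = 1%:M.
  by rewrite -frame_EEt EK trmx_mul /metric !mulmxA.
have Ku : K \in unitmx := (mulmx1_unit Kg).1.
have KTu : K^T \in unitmx by rewrite unitmx_tr.
have gE : metric (F p) (pt S p) = invmx (K^T *m K).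
  rewrite invmxM // -[LHS](mulmxK KTu) -[metric _ _ *m _](mulKmx Ku) Kg mulmx1.
  by [].
rewrite (PiE imm) /Cmx gE invmxK EK trmx_mul !mulmxA.
by [].
Qed.

Lemma trace_frame (A : 'M[R]_d) : \tr (Em *m A *m Em^T) = \tr (A *m Pi p).
Proof. by rewrite mxtrace_mulC mulmxA frame_gram mxtrace_mulC. Qed.

Lemma sum_sff_frame : \sum_i sff S x p (e i) (e i) = Hvec p.
Proof.
apply/rowP => l; rewrite summxE Hvec_tr -sff_mx_Pi -trace_frame; apply: eq_bigr => i _.
by rewrite sffE bil_coef -/(sff_mx p l) [RHS]sandwich_entry frame_row.
Qed.

Lemma mean_curvE : m%:R *: mean_curv S x p e = Hvec p.
Proof.
by rewrite /mean_curv scalerA mulfV ?scale1r ?sum_sff_frame // pnatr_eq0 -lt0n.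
Qed.

Lemma PE i j l :
  P S x p e (e i) (e j) 0 l = (Em *m P_mx p l *m Em^T) i j.
Proof.
have dij : dot (e i) (e j) = (Em *m Pi p *m Em^T) i j.
  by rewrite -frame_gram mulmxA frame_EEt mul1mx frame_EEt mxE (e_frame.1 i j).
have -> : P S x p e (e i) (e j) = dot (e i) (e j) *: Hvec p - sff S x p (e i) (e j).
  by rewrite /P mulrC -scalerA mean_curvE.
rewrite P_mxE mulmxBr mulmxBl -scalemxAr -scalemxAl dij.
rewrite [LHS]mxE [X in X + _]mxE [X in _ + X]mxE [RHS]mxE [X in _ = X + _]mxE [X in _ = _ + X]mxE.
rewrite mulrC; congr (_ - _).
by rewrite sffE bil_coef [RHS]sandwich_entry !frame_row.
Qed.

(** Every product E^T E inside the trace is [Pi], which is absorbed by B. Thus the Hilbert-Schmidt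
    product computed in the frame is the one computed in R^(n+2). *)
Lemma frame_contract (A B : 'M[R]_d) : Pi p *m B *m Pi p = B ->
  \tr (Em *m A *m Em^T *m (Em *m B *m Em^T)^T) = \tr (A *m B^T).
Proof.
move=> BPi.
have BtPi : Pi p *m B^T *m Pi p = B^T.
  by rewrite -[in RHS]BPi !trmx_mul (Pi_sym imm) mulmxA.
have -> : Em *m A *m Em^T *m (Em *m B *m Em^T)^T = Em *m (A *m Pi p *m B^T) *m Em^T.
  by rewrite !trmx_mul trmxK -frame_gram !mulmxA.
by rewrite trace_frame -!mulmxA [Pi p *m (B^T *m _)]mulmxA BtPi.
Qed.

Section BoxStar.
Context (xi : M -> E) (xi_smooth : forall k, class_C_on S k xi).
Local Notation nhess_form := (nhess_form S x xi).

Definition nhess_mx l : 'M[R]_d := coefmx (fun a b => row b (nhess_form a p)) l.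

Lemma nhess_mxE l : nhess_mx l = C p *m coefmx (loc_nhess (F p) (xi \o loc S p) (pt S p)) l *m (C p)^T.
Proof.
rewrite -coefmx_lift /nhess_mx; congr (coefmx _ l).
by apply/funext => a; apply/funext => b; rewrite nhess_lift.
Qed.

Lemma nhess_mx_Pi l : Pi p *m nhess_mx l *m Pi p = nhess_mx l.
Proof.
have CtPi : (C p)^T *m Pi p = (C p)^T by rewrite -[Pi p](Pi_sym imm) -trmx_mul (Pi_C imm).
have PiC := Pi_C imm p; rewrite nhess_mxE; move: (C p) CtPi PiC => Cp CtPi PiC.
by rewrite -mulmxA -mulmxA -mulmxA CtPi !mulmxA PiC.
Qed.

Lemma nhessE X Y : nhess S x p xi X Y = bil X Y (fun a b => row b (nhess_form a p)).
Proof.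
have -> : nhess S x p xi X Y = bil (comps (F p) (pt S p) X) (comps (F p) (pt S p) Y)
    (loc_nhess (F p) (xi \o loc S p) (pt S p)) by [].
rewrite !compsE bil_mul; congr (bil _ _ _); apply/funext => a; apply/funext => b.
exact: nhess_lift.
Qed.

(** Both sides are the full contraction over three indices; the left side slices it by the
    coordinate of the values, the right side by the first argument. *)
Lemma trace_coef (A B : 'I_d -> 'M[R]_d) :
  \sum_l \tr (coefmx (fun a b => row b (A a)) l *m (coefmx (fun a b => row b (B a)) l)^T) =
  \sum_a \tr (A a *m (B a)^T).
Proof.
have -> : \sum_a \tr (A a *m (B a)^T) = \sum_a \sum_b \sum_l A a b l * B a b l.
  by apply: eq_bigr => a _; rewrite sum_mul_tr.
under [RHS]eq_bigr do rewrite exchange_big.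
rewrite [RHS]exchange_big; apply: eq_bigr => l _; rewrite -sum_mul_tr.
by apply: eq_bigr => a _; apply: eq_bigr => b _; rewrite 2![X in X * _]mxE 2![X in _ * X]mxE.
Qed.

Lemma box_starE (fr : M -> 'I_m -> E) : fr p = e ->
  box_star S x fr xi p = \sum_a \tr (P_form a p *m (nhess_form a p)^T).
Proof.
move=> fre; rewrite -trace_coef /box_star fre.
have -> : \sum_i \sum_j dot (P S x p e (e i) (e j)) (nhess S x p xi (e i) (e j)) =
   \sum_l \sum_i \sum_j (Em *m P_mx p l *m Em^T) i j * (Em *m nhess_mx l *m Em^T) i j.
  under eq_bigr => i _ do under eq_bigr => j _ do rewrite dotE.
  under eq_bigr do rewrite exchange_big.
  rewrite exchange_big; apply: eq_bigr => l _; apply: eq_bigr => i _; apply: eq_bigr => j _.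
  by rewrite PE nhessE bil_coef; congr (_ * _); rewrite [RHS]sandwich_entry !frame_row.
by apply: eq_bigr => l _; rewrite sum_mul_tr frame_contract //; exact: nhess_mx_Pi.
Qed.

End BoxStar.

Section Box.
Context (f : M -> R) (f_C2 : smooth 2 f) (nu : 'I_(n.+1 - m) -> E) (nu_frame : normal_frame S x p nu).
Local Notation hess_col := (hess_col S x f).
Let Nu : 'M[R]_(n.+1 - m, d) := \matrix_i nu i.

Lemma normal_Q v : normal S x p v -> v *m Q p = v.
Proof.
move=> [v_eta v_tan].
have vJ : v *m (J p)^T = 0.
  apply/rowP => i; rewrite [RHS]mxE dot_entry.
  have -> : row 0 v = v by apply/rowP => j; rewrite row_entry.
  by apply: v_tan; exact: row_sub.
have vPi : v *m Pi p = 0 by rewrite (PiE imm) /Cmx !mulmxA vJ !mul0mx.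
have ve : v *m (eta x p)^T = 0.
  by apply/matrixP => i j; rewrite !ord1 [RHS]mxE -[RHS]v_eta.
by rewrite /Q !mulmxBr mulmx1 vPi subr0 mulmxA ve mul0mx subr0.
Qed.

(** The tangent frame, eta and the normal frame together form n + 2 orthonormal rows of length n +
    2. For a square matrix A A^T = 1 implies A^T A = 1, which here reads Pi + eta^T eta + Nu^T Nu =
    1. *)
Lemma normal_frame_gram : Nu^T *m Nu = Q p.
Proof.
have nuQ i : row i Nu *m Q p = row i Nu by rewrite rowK; apply: normal_Q; exact: nu_frame.2.
have NuQ : Nu *m Q p = Nu by apply/row_matrixP => i; rewrite row_mul nuQ.
have QNut : Q p *m Nu^T = Nu^T by rewrite -[Q p](Q_sym imm) -trmx_mul NuQ.
have NuNut : Nu *m Nu^T = 1%:M.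
  by apply/matrixP => i j; rewrite dot_entry !rowK (nu_frame.1 i j) mxE.
have etaEt : eta x p *m Em^T = 0.
  apply: (can_inj (@trmxK _ _ _)); rewrite trmx_mul trmxK trmx0.
  have -> : Em = Em *m Pi p by rewrite -frame_gram mulmxA frame_EEt mul1mx.
  by rewrite -mulmxA (Pi_eta imm) mulmx0.
have NuEt : Nu *m Em^T = 0.
  have -> : Em^T = Pi p *m Em^T by rewrite -frame_gram -mulmxA frame_EEt mulmx1.
  by rewrite -NuQ mulmxA -[_ *m Q p *m _]mulmxA (Q_Pi imm) mulmx0 mul0mx.
have Nueta : Nu *m (eta x p)^T = 0.
  apply: (can_inj (@trmxK _ _ _)); rewrite trmx_mul trmxK trmx0.
  by rewrite -QNut mulmxA (eta_Q imm) mul0mx.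
pose A := col_mx (col_mx Em (eta x p)) Nu.
pose A0 := col_mx Em (eta x p).
have A0A0 : A0 *m A0^T = 1%:M.
  rewrite /A0 tr_col_mx mul_col_row frame_EEt etaEt (eta_eta imm).
  have -> : Em *m (eta x p)^T = 0 by rewrite -[LHS]trmxK trmx_mul trmxK etaEt trmx0.
  by rewrite -scalar_mx_block.
have AA : A *m A^T = 1%:M.
  rewrite /A -/A0 tr_col_mx mul_col_row A0A0 NuNut.
  have NuA0 : Nu *m A0^T = 0 by rewrite /A0 tr_col_mx mul_mx_row NuEt Nueta row_mx0.
  have -> : A0 *m Nu^T = 0 by rewrite -[LHS]trmxK trmx_mul trmxK NuA0 trmx0.
  by rewrite NuA0 -scalar_mx_block.
(* The subtraction in n + 1 - m is truncated, so m <= n + 1 has to be known; it holds because m + 1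
   orthonormal rows fit in R^(n+2). *)
have mle : (m + 1 <= d)%N.
  have : \rank (A0 *m A0^T) = (m + 1)%N by rewrite A0A0 mxrank1.
  by move=> <-; apply: leq_trans (mxrankM_maxl _ _) (rank_leq_col _).
have dimE : (m + 1 + (n.+1 - m))%N = d by lia.
(* The number of rows equals n + 2 only propositionally, so the square case is transported along the
   equality for a general matrix. *)
have square k (B : 'M[R]_(k, d)) : k = d -> B *m B^T = 1%:M -> B^T *m B = 1%:M.
  by move=> kd; move: B; rewrite kd => B; exact: mulmx1C.
have := square _ A dimE AA.
rewrite /A tr_col_mx mul_row_col tr_col_mx mul_row_col frame_gram => e1.
rewrite /Q -e1; move: (Pi p) (_ *m eta x p) (Nu^T *m Nu) => A1 A2 A3.
by rewrite -[RHS]addrA -opprD addrAC subrr add0r.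
Qed.

Lemma weingartenE v X Y : dot (weingarten S x p v X) Y = \sum_l v 0 l * (X *m sff_mx p l *m Y^T) 0 0.
Proof.
have -> : weingarten S x p v X = X *m (C p *m (\matrix_(i, j) dot (loc_sff (F p) (pt S p) i j) v) *m (C p)^T).
  by rewrite /weingarten /raise compsE /Cmx trmx_mul invmetric_sym trmxK !mulmxA.
have -> : \matrix_(i, j) dot (loc_sff (F p) (pt S p) i j) v =
    \sum_l v 0 l *: coefmx (loc_sff (F p) (pt S p)) l.
  apply/matrixP => i j; rewrite mxE dotE summxE; apply: eq_bigr => l _.
  by rewrite [RHS]mxE [X in _ = _ * X]mxE mulrC.
have -> : C p *m (\sum_l v 0 l *: coefmx (loc_sff (F p) (pt S p)) l) *m (C p)^T = \sum_l v 0 l *: sff_mx p l.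
  rewrite mulmx_sumr mulmx_suml; apply: eq_bigr => l _.
  by rewrite -scalemxAr -scalemxAl sff_mxE.
rewrite /dot mulmx_sumr mulmx_suml summxE; apply: eq_bigr => l _.
by rewrite -scalemxAr -scalemxAl [LHS]mxE.
Qed.

Definition hess_mx : 'M[R]_d := \matrix_(a, b) hess_col a p b 0.

Lemma hessE X : hess S x f p X = X *m hess_mx.
Proof.
have -> : hess S x f p X = X *m (C p *m loc_hess (F p) (f \o loc S p) (pt S p) *m (C p)^T).
  by rewrite /hess /raise compsE /Cmx trmx_mul invmetric_sym trmxK !mulmxA.
by congr (_ *m _); apply/matrixP => a b; rewrite (hess_lift imm f_C2) [RHS]mxE.
Qed.

Lemma hess_mx_Pi : hess_mx *m Pi p = hess_mx.
Proof.
have -> : hess_mx = C p *m loc_hess (F p) (f \o loc S p) (pt S p) *m (C p)^T.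
  by apply/matrixP => a b; rewrite (hess_lift imm f_C2) [LHS]mxE.
have CtPi : (C p)^T *m Pi p = (C p)^T by rewrite -[Pi p](Pi_sym imm) -trmx_mul (Pi_C imm).
by rewrite -mulmxA CtPi.
Qed.

Lemma tr_P_op v : tr e (P_op S x p e v \o hess S x f p) =
  \sum_l v 0 l * \tr (hess_mx *m P_mx p l).
Proof.
have step i : dot ((P_op S x p e v \o hess S x f p) (e i)) (e i) =
    dot (Hvec p) v * (Em *m hess_mx *m Em^T) i i - \sum_l v 0 l * (Em *m (hess_mx *m sff_mx p l) *m Em^T) i i.
  rewrite /P_op /= hessE.
  have dB (A B Y : E) : dot (A - B) Y = dot A Y - dot B Y.
    by rewrite /dot mulmxBl [LHS]mxE [X in _ + X]mxE.
  have dZ r (A B : E) : dot (r *: A) B = r * dot A B by rewrite /dot -scalemxAl [LHS]mxE.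
  have Hd : m%:R * dot (mean_curv S x p e) v = dot (Hvec p) v by rewrite -dZ mean_curvE.
  rewrite dB dZ weingartenE Hd; congr (_ * _ - _).
    by rewrite [RHS]sandwich_entry frame_row.
  by apply: eq_bigr => l _; rewrite [X in _ = _ * X]sandwich_entry frame_row !mulmxA.
rewrite /tr (eq_bigr _ (fun i _ => step i)) sumrB -mulr_sumr exchange_big /=.
have -> : \sum_i (Em *m hess_mx *m Em^T) i i = \tr hess_mx by apply: etrans (trace_frame hess_mx) _; rewrite hess_mx_Pi.
rewrite dotE mulr_suml -sumrB; apply: eq_bigr => l _.
have -> : \tr (hess_mx *m P_mx p l) = Hvec p 0 l * \tr hess_mx - \tr (hess_mx *m sff_mx p l).
  by rewrite P_mxE mulmxBr linearB /= -scalemxAr linearZ /= hess_mx_Pi.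
rewrite -mulr_sumr [in RHS]mulrBr.
congr (_ - _); first by rewrite [Hvec p 0 l * _]mulrC mulrA.
by congr (_ * _); apply: etrans (trace_frame (hess_mx *m sff_mx p l)) _; rewrite -mulmxA sff_mx_Pi.
Qed.

(** Pairing with xi resums the normal frame: the sum of <nu_a, xi> nu_a is xi Nu^T Nu = xi Q =
    xi. *)
Lemma boxE (xi : M -> E) (fr : M -> 'I_m -> E) (nfr : M -> 'I_(n.+1 - m) -> E) :
  normal S x p (xi p) -> fr p = e -> nfr p = nu ->
  dot (box S x fr nfr f p) (xi p) =
  \sum_a \tr (P_form a p *m (xi p)^T *m (hess_col a p)^T).
Proof.
move=> xi_normal fre nfre; rewrite /box fre nfre.
have -> : dot (\sum_a tr e (P_op S x p e (nu a) \o hess S x f p) *: nu a) (xi p) =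
   \sum_l (xi p *m Nu^T *m Nu) 0 l * \tr (hess_mx *m P_mx p l).
  rewrite /dot mulmx_suml summxE.
  transitivity (\sum_a \sum_l (dot (nu a) (xi p) * nu a 0 l) * \tr (hess_mx *m P_mx p l)).
    apply: eq_bigr => a _; rewrite -scalemxAl [LHS]mxE -/(dot _ _) tr_P_op mulr_suml.
    by apply: eq_bigr => l _; rewrite mulrC mulrA.
  rewrite exchange_big; apply: eq_bigr => l _ /=; rewrite -mulr_suml; congr (_ * _).
  rewrite mulmx_entry; apply: eq_bigr => a _; rewrite dot_entry dotC.
  have -> : row 0 (xi p) = xi p by apply/rowP => j; rewrite row_entry.
  by rewrite rowK [X in _ = _ * X]mxE.
rewrite -mulmxA normal_frame_gram normal_Q //.
have -> : \sum_a \tr (P_form a p *m (xi p)^T *m (hess_col a p)^T) =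
   \sum_a \sum_b \sum_l xi p 0 l * (hess_mx a b * P_mx p l b a).
  apply: eq_bigr => a _; apply: eq_bigr => b _.
  rewrite mulmx_entry big_ord1 mulmx_entry mulr_suml; apply: eq_bigr => l _.
  have e1 : P_mx p l b a = P_form a p b l by rewrite -[P_mx p l]P_mx_sym [LHS]mxE [LHS]mxE row_entry.
  have e2 : hess_mx a b = (hess_col a p)^T 0 b by rewrite mxE [RHS]mxE.
  have e3 : (xi p)^T l 0 = xi p 0 l by rewrite mxE.
  rewrite e1 e2 e3; move: (P_form a p b l) (xi p 0 l) (_ 0 b) => A B G.
  by ring.
under [RHS]eq_bigr do rewrite exchange_big.
rewrite [RHS]exchange_big; apply: eq_bigr => l _ /=; rewrite mulr_sumr; apply: eq_bigr => a _.
by rewrite mulmx_entry mulr_sumr.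
Qed.

End Box.

End Frame.

Lemma nconnE p (xi : M -> E) (xi_smooth : forall k, class_C_on S k xi) v :
  nconn S x p v xi = v *m Nxi S x xi p.
Proof.
have -> : Nxi S x xi p = C p *m npartials S x xi p (pt S p).
  by have := Nxi_chart imm xi_smooth (in_im S p); rewrite loc_pt.
rewrite mulmxA mulmx_sum_row /nconn compsE; apply: eq_bigr => i _.
by rewrite loc_nconn_row.
Qed.

End Frames.

(** * The Codazzi equation *)

Section Codazzi.
Context (R : realType) (m n : nat) (M : topologicalType).
Local Notation d := (n.+1 + 1)%N.
Local Notation E := 'rV[R]_d.
Context (S : manifold R m M) (x : M -> E) (imm : immersion S x).
Implicit Types (p : M) (a b : 'I_d) (f : M -> R).

Local Notation smooth k f := (smooth S k f).
Local Notation smooth_mx k A := (smooth_mx S k A).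
Local Notation D := (D S x).
Local Notation Dm := (Dm S x).
Local Notation F p := (x \o loc S p).
Local Notation C p := (Cmx (F p) (pt S p)).
Local Notation Pi := (Pi S x).
Local Notation Q := (Q S x).
Local Notation B a p := (Dm a Pi p).
Local Notation sff_form := (sff_form S x).
Local Notation P_form := (P_form S x).
Local Notation Hvec := (Hvec S x).
Local Notation eta := (eta x).
Local Notation et := (d_t R n).
Local Notation T := (T S x).
Local Notation N := (N S x).

Lemma hess_sym f a b p : smooth 2 f -> hess_col S x f a p b 0 = hess_col S x f b p a 0.
Proof.
move=> cf; rewrite -!(hess_lift imm cf).
have iu := in_im S p; have oV := @open_im _ _ _ S (chart_at S p).
have cF := immersion_class imm (chart_at S p).
have ls : (loc_hess (F p) (f \o loc S p) (pt S p))^T = loc_hess (F p) (f \o loc S p) (pt S p).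
  apply/matrixP => i j; apply: etrans (mxE _ _ _ _) _.
  apply: etrans (mxE _ _ _ _) (etrans _ (esym (mxE _ _ _ _))).
  apply: (congr2 (fun X Y => X - Y)).
    have nV : \forall w \near pt S p, im (chart_at S p) w by exact: open_nbhs_nbhs.
    have cfc := cf (chart_at S p).
    apply: schwarz.
    - by apply: filterS nV => w Vw; split; apply: class_C_derivable Vw; exact: class_CS cfc.
    - by apply: filterS nV => w Vw; apply: class_C_derivable Vw; exact: class_C_pderiv cfc.
    - by apply: filterS nV => w Vw; apply: class_C_derivable Vw; exact: class_C_pderiv cfc.
    - by apply: class_C_cont iu; exact: class_C_pderiv (class_C_pderiv _ cfc).
    - by apply: class_C_cont iu; exact: class_C_pderiv (class_C_pderiv _ cfc).
  apply: eq_bigr => k _; apply: (congr1 (fun X => X * _)).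
  apply: etrans (christoffelE oV cF j i k iu) (etrans _ (esym (christoffelE oV cF i j k iu))).
  apply: etrans (mulmx_entry _ _ _ _) (etrans _ (esym (mulmx_entry _ _ _ _))).
  by apply: eq_bigr => l _; congr (_ * _); exact: (second_deriv_sym oV cF).
have sym (A X : 'M[R]_d) : A^T = A -> A a b = A b a by move=> e; rewrite -[in LHS]e mxE.
apply: (sym _ 0); move: (C p) => Cp.
by rewrite trmx_mul trmx_mul trmxK ls mulmxA.
Qed.

(* D_a and D_b do not commute: they differentiate along tangential projections. *)
Lemma commutator (A : M -> 'M[R]_d) a b p : smooth_mx 2 A ->
  Dm b (Dm a A) p - Dm a (Dm b A) p = \sum_c (B b p a c - B a p b c) *: Dm c A p.
Proof.
move=> cA; apply/matrixP => i j.
(* The Hessian of each entry is symmetric and equals a second derivative [D a (D b .)] minus a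
   combination of first derivatives with coefficients from [Dm a Pi]; solving for the second
   derivatives gives the commutator. *)
have hs := hess_sym b a p (cA i j).
have hE a' b' : hess_col S x (fun q => A q i j) a' p b' 0 =
    Dm a' (Dm b' A) p i j - \sum_c B a' p b' c * Dm c A p i j.
  rewrite [LHS]mxE [X in X + _]mxE [X in _ + X]mxE mulmx_entry; congr (_ - _).
    by rewrite [RHS]mxE; congr (D a' _ p); apply/funext => q; rewrite [RHS]mxE [LHS]mxE.
  by apply: eq_bigr => c _; congr (_ * _); rewrite [RHS]mxE [LHS]mxE.
move: hs; rewrite !hE => /eqP; rewrite subr_eq addrAC -subr_eq => /eqP hs.
rewrite [LHS]mxE [X in _ + X]mxE summxE.
under [RHS]eq_bigr do rewrite mxE mulrBl.
rewrite sumrB; move/eqP: hs; rewrite subr_eq => /eqP ->.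
by rewrite addrC addrA addKr addrC.
Qed.

Section Point.
Context (p : M).

Lemma B_Pi a : B a p = B a p *m Pi p + Pi p *m B a p.
Proof.
rewrite -Dm_mul; [|exact: smooth_Pi|exact: smooth_Pi].
by congr (Dm a _ p); apply/funext => q; rewrite (Pi_idem imm).
Qed.

(** The derivative of a projection exchanges its image and its kernel: multiplying B = B Pi + Pi B
    by Pi on both sides gives X = X + X. *)
Lemma Pi_B_Pi a : Pi p *m B a p *m Pi p = 0.
Proof.
have := congr1 (fun X => Pi p *m X *m Pi p) (B_Pi a).
rewrite /= mulmxDr mulmxDl !mulmxA -[_ *m Pi p *m Pi p]mulmxA (Pi_idem imm).
by rewrite -[X in X = _]addr0 => /addrI <-.
Qed.

Lemma B_Q a : Pi p *m (B a p *m Q p) = B a p *m Q p.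
Proof.
by rewrite [in RHS]B_Pi mulmxDl -[_ *m Pi p *m Q p]mulmxA (Pi_Q imm) mulmx0 add0r mulmxA.
Qed.

Lemma B_sym a : (B a p)^T = B a p.
Proof.
rewrite -Dm_tr; congr (Dm a _ p).
by apply/funext => q; rewrite (Pi_sym imm).
Qed.

Lemma sum_B (v : E) : \sum_c v 0 c *: B c p = \sum_c (v *m Pi p) 0 c *: B c p.
Proof.
under [RHS]eq_bigr do rewrite mulmx_entry scaler_suml.
rewrite exchange_big; apply: eq_bigr => c _ /=.
rewrite [in LHS](Dm_Pi imm) scaler_sumr; apply: eq_bigr => b _.
by rewrite scalerA.
Qed.

(** The sum sees only Pi A Pi: [B c] depends on its direction c through [Pi], and the columns of
    [B c *m Q] are tangent. *)
Lemma contract0 (A : 'M[R]_d) : Pi p *m A *m Pi p = 0 ->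
  \sum_c row c A^T *m (B c p *m Q p) = 0.
Proof.
move=> A0.
have step X : \sum_c row c X^T *m (B c p *m Q p) = \sum_c row c (Pi p *m X *m Pi p)^T *m (B c p *m Q p).
  have -> : (Pi p *m X *m Pi p)^T = Pi p *m X^T *m Pi p by rewrite !trmx_mul (Pi_sym imm) mulmxA.
  have -> : \sum_c row c (Pi p *m X^T *m Pi p) *m (B c p *m Q p) =
            \sum_c row c (Pi p *m X^T) *m (B c p *m Q p).
    by apply: eq_bigr => c _; rewrite row_mul -mulmxA B_Q.
  under [RHS]eq_bigr do rewrite row_mulC mulmx_suml.
  rewrite exchange_big; apply: eq_bigr => c _ /=.
  rewrite [in LHS](Dm_Pi imm) mulmx_suml mulmx_sumr; apply: eq_bigr => b _.
  rewrite -!scalemxAl -scalemxAr; congr (_ *: _).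
  by rewrite -[in RHS](Pi_sym imm) [RHS]mxE.
rewrite step A0; apply: big1 => c _.
by rewrite trmx0 row0 mul0mx.
Qed.

(** Expanding the direction a through the symmetric [Pi] regroups the sum into rows of Pi B_c Pi,
    which vanish. *)
Lemma trace_B_Pi : (\sum_a row a (B a p)) *m Pi p = 0.
Proof.
rewrite mulmx_suml.
under eq_bigr => a _ do rewrite (Dm_Pi imm) linear_sum /= mulmx_suml.
rewrite exchange_big big1 // => c _ /=.
transitivity (row c (Pi p *m B c p *m Pi p)); last by rewrite Pi_B_Pi row0.
rewrite -mulmxA row_mulC; apply: eq_bigr => a _.
rewrite linearZ /= -scalemxAl row_mul; congr (_ *: _).
by rewrite -[in LHS](Pi_sym imm) [LHS]mxE.
Qed.

(** Obtained by differentiating Pi eta^T = 0. The right side is, up to sign, the second fundamental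
    form of S^n x R in R^(n+2) restricted to the submanifold. *)
Lemma B_eta a : B a p *m (eta p)^T = - col a (Pi p *m sphere_proj R n *m Pi p).
Proof.
have := Dm_mul x a p (smooth_Pi imm 1) (smooth_mx_tr (smooth_eta imm 1)).
have -> : (fun q => Pi q *m (eta q)^T) = fun=> 0 by apply/funext => q; rewrite (Pi_eta imm).
rewrite Dm_cst Dm_tr (Dm_eta imm) trmx_mul => /esym/eqP; rewrite addr_eq0 => /eqP ->.
have -> : (sphere_proj R n)^T = sphere_proj R n by rewrite (sphere_projE R n) linearB /= trmx1 trmx_mul trmxK.
by rewrite tr_row (Pi_sym imm) !colE !mulmxA.
Qed.

Lemma Pi_sphere_proj_Pi : Pi p *m sphere_proj R n *m Pi p = Pi p - (T p)^T *m T p.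
Proof.
rewrite (TE imm) (sphere_projE R n) mulmxBr mulmx1 mulmxBl (Pi_idem imm) trmx_mul (Pi_sym imm).
by rewrite !mulmxA.
Qed.

Lemma T_Pi : T p *m Pi p = T p.
Proof. by rewrite (TE imm) -mulmxA (Pi_idem imm). Qed.

(** The term (D_a eta)^T eta of the derivative dies against [Q], while D_a eta Q is row a of Pi S Q,
    where S = 1 - d_t^T d_t gives -T_a N. This is where T and N enter the Codazzi equation. *)
Lemma Dm_Q_Q a : Dm a Q p *m Q p = - (B a p *m Q p) + T p 0 a *: ((eta p)^T *m N p).
Proof.
have -> : Dm a Q p = - B a p - ((Dm a eta p)^T *m eta p + (eta p)^T *m Dm a eta p).
  have sE k := smooth_eta imm k.
  have sEt k := smooth_mx_tr (sE k).
  rewrite /Q DmD; last 2 first.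
  - apply: smooth_mxD; first exact: smooth_mx_cst.
    by apply: smooth_mxN; exact: smooth_Pi.
  - by apply: smooth_mxN; apply: smooth_mx_mul.
  rewrite DmD; [|exact: smooth_mx_cst|by apply: smooth_mxN; exact: smooth_Pi].
  rewrite Dm_cst add0r DmN; last exact: smooth_Pi.
  rewrite DmN; last by apply: smooth_mx_mul.
  by rewrite Dm_mul // Dm_tr.
rewrite mulmxBl mulNmx mulmxDl -[_ *m eta p *m Q p]mulmxA (eta_Q imm) mulmx0 add0r.
congr (_ + _).
have PIQ : Pi p *m sphere_proj R n *m Q p = - ((T p)^T *m N p).
  have -> : Pi p *m sphere_proj R n = Pi p - Pi p *m et^T *m et.
    by rewrite (sphere_projE R n) mulmxBr mulmx1 mulmxA.
  by rewrite mulmxBl (Pi_Q imm) sub0r (TE imm) (NE imm) trmx_mul (Pi_sym imm) -!mulmxA.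
have row_outer (t v : E) : row a (- (t^T *m v)) = - (t 0 a *: v).
  by apply/rowP => j; rewrite row_entry [LHS]mxE mulmx_entry big_ord1 [RHS]mxE [X in _ = - X]mxE [X in X * _]mxE.
rewrite -[_ *m Dm a _ p *m Q p]mulmxA (Dm_eta imm) -2!row_mul PIQ row_outer.
by rewrite mulmxN opprK -scalemxAr.
Qed.

(* Row b holds the divergence of P in the direction b. *)
Definition P_div : 'M[R]_d := \sum_a Dm a (P_form a) p.

Lemma smooth_sff k a : smooth_mx k (sff_form a).
Proof. by apply: smooth_mx_mul; [apply: smooth_Dm => //; exact: smooth_Pi|exact: smooth_Q]. Qed.

Lemma Hvec_Q : Hvec p *m Q p = Hvec p.
Proof. by rewrite mulmx_suml; apply: eq_bigr => a _; rewrite -row_mul -mulmxA (Q_idem imm). Qed.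

Lemma P_form_Q a : P_form a p *m Q p = P_form a p.
Proof. by rewrite mulmxBl -[_ *m Hvec p *m _]mulmxA Hvec_Q -[_ *m Q p *m Q p]mulmxA (Q_idem imm). Qed.

Lemma Pi_P_form a : Pi p *m P_form a p = P_form a p.
Proof.
rewrite /P_form mulmxBr B_Q mulmxA; congr (_ *m _ - _).
by rewrite [in LHS]colE mulmxA (Pi_idem imm) -colE.
Qed.

End Point.

Lemma smooth_mx_row k q r (A : M -> 'M[R]_(q, r)) i : smooth_mx k A -> smooth_mx k (fun y => row i (A y)).
Proof. by move=> cA i' j; apply: smooth_eq (cA i j) => y; rewrite [RHS]mxE. Qed.

Lemma smooth_mx_col k q r (A : M -> 'M[R]_(q, r)) j : smooth_mx k A -> smooth_mx k (fun y => col j (A y)).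
Proof. by move=> cA i j'; apply: smooth_eq (cA i j) => y; rewrite [RHS]mxE. Qed.

Lemma Dm_row q r (A : M -> 'M[R]_(q, r)) i a p : Dm a (fun y => row i (A y)) p = row i (Dm a A p).
Proof.
by apply/rowP => j; rewrite [LHS]mxE [RHS]mxE [RHS]mxE; congr (D a _ p); apply/funext => q'; rewrite mxE.
Qed.

Lemma Dm_col q r (A : M -> 'M[R]_(q, r)) j a p : Dm a (fun y => col j (A y)) p = col j (Dm a A p).
Proof.
by apply/colP => i; rewrite [LHS]mxE [RHS]mxE [RHS]mxE; congr (D a _ p); apply/funext => q'; rewrite mxE.
Qed.

Lemma smooth_mx_sum k q r (I : Type) (s : seq I) (A : I -> M -> 'M[R]_(q, r)) :
  (forall i, smooth_mx k (A i)) -> smooth_mx k (fun y => \sum_(i <- s) A i y).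
Proof.
move=> cA i j; apply: smooth_eq (smooth_sum s xpredT (fun l => cA l i j)) => y.
by rewrite summxE.
Qed.

Lemma Dm_sum q r (I : Type) (s : seq I) (A : I -> M -> 'M[R]_(q, r)) a p :
  (forall i, smooth_mx 1 (A i)) -> Dm a (fun y => \sum_(i <- s) A i y) p = \sum_(i <- s) Dm a (A i) p.
Proof.
move=> cA; apply/matrixP => i j; rewrite [LHS]mxE summxE.
under [RHS]eq_bigr do rewrite mxE.
rewrite -D_sum; last by move=> l; exact: cA.
by congr (D a _ p); apply/funext => y; rewrite summxE.
Qed.

Lemma smooth_Hvec k : smooth_mx k Hvec.
Proof. by apply: smooth_mx_sum => a; apply: smooth_mx_row; exact: smooth_sff. Qed.

Lemma smooth_P_form k a : smooth_mx k (P_form a).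
Proof.
apply: smooth_mxD; last by apply: smooth_mxN; exact: smooth_sff.
by apply: smooth_mx_mul; [apply: smooth_mx_col; exact: smooth_Pi|exact: smooth_Hvec].
Qed.

Lemma sff_form_sym a b p : row b (sff_form a p) = row a (sff_form b p).
Proof.
apply/rowP => l; have /matrixP/(_ b a) := sff_mx_sym imm p l.
by rewrite [X in X = _]mxE [X in X = _]mxE [X in _ = X]mxE.
Qed.

(** Contracting D_a of the trace [Hvec] with [Pi] gives D_b of it, and the symmetry of sigma lets
    the remaining terms pair up into the antisymmetrized derivative of sigma, the subject of the
    Codazzi equation. *)
Lemma row_P_div b p : row b (P_div p) =
  (\sum_a B a p b a) *: Hvec p + \sum_a row a (Dm b (sff_form a) p - Dm a (sff_form b) p).
Proof.
rewrite /P_div linear_sum /=.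
have step a : row b (Dm a (P_form a) p) = B a p b a *: Hvec p + (Pi p b a *: Dm a Hvec p - row a (Dm a (sff_form b) p)).
  rewrite /P_form DmD; last 2 first.
  - by apply: smooth_mx_mul; [apply: smooth_mx_col; exact: smooth_Pi|exact: smooth_Hvec].
  - by apply: smooth_mxN; exact: smooth_sff.
  rewrite DmN; last exact: smooth_sff.
  rewrite Dm_mul; [|apply: smooth_mx_col; exact: smooth_Pi|exact: smooth_Hvec].
  rewrite Dm_col 2!linearD /= linearN /= 2!row_mul -addrA.
  have r1 (A : 'M[R]_d) : row b (col a A) = (A b a)%:M.
    by apply/rowP => j; rewrite ord1 !mxE eqxx mulr1n.
  rewrite 2!r1 2!mul_scalar_mx -2!Dm_row; congr (_ + (_ - _)).
  by congr (Dm a _ p); apply/funext => q; exact: sff_form_sym.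
rewrite (eq_bigr _ (fun a _ => step a)) big_split -scaler_suml sumrB -(Dm_Pi imm).
congr (_ + _); rewrite Dm_sum; last by move=> a; apply: smooth_mx_row; exact: smooth_sff.
rewrite -sumrB; apply: eq_bigr => a _; rewrite Dm_row.
by rewrite [RHS]linearB.
Qed.

(** With sigma_a = B_a Q, the second derivatives of [Pi] combine into the commutator, and [Dm_Q_Q]
    gives products B B and terms in eta. After summation over a, three of the quadratic sums vanish
    because Pi B Pi = 0. The remaining ones, [y *m Hvec] and [Y3], are annihilated by [Pi] on the
    left, so only the terms in eta survive. *)
Lemma codazzi p : Pi p *m (P_div p *m Q p) = - (m%:R - 1) *: ((T p)^T *m N p).
Proof.
pose y : 'cV[R]_d := \sum_a col a (B a p).
pose Y3 : 'M[R]_d := \matrix_b \sum_a row a ((\sum_c B a p b c *: B c p) *m Q p).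
have rowZ b : row b (P_div p *m Q p) =
   row b (y *m Hvec p - Y3 - (m%:R - 1) *: ((T p)^T *m N p)).
  rewrite row_mul row_P_div mulmxDl -scalemxAl Hvec_Q.
  have rB (A A' : 'M[R]_d) : row b (A - A') = row b A - row b A' by exact: linearB.
  rewrite 2!rB [row b (y *m _)]row_mul -[RHS]addrA; congr (_ + _).
    have -> : row b y = (\sum_a B a p b a)%:M.
      by apply/rowP => j; rewrite ord1 [LHS]mxE summxE [RHS]mxE eqxx mulr1n; apply: eq_bigr => a _; rewrite mxE.
    by rewrite mul_scalar_mx.
  have dsff a b' : Dm b' (sff_form a) p = Dm b' (Dm a Pi) p *m Q p + B a p *m Dm b' Q p.
    apply: Dm_mul; last exact: (smooth_Q imm 1).
    exact: (smooth_Dm imm a (smooth_Pi imm 2)).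
  have step a : (Dm b (sff_form a) p - Dm a (sff_form b) p) *m Q p =
     (\sum_c B b p a c *: (B c p *m Q p)) - (\sum_c B a p b c *: B c p) *m Q p
     - B a p *m (B b p *m Q p) + B b p *m (B a p *m Q p)
     + (T p 0 a *: (col b (Pi p *m sphere_proj R n *m Pi p) *m N p) - T p 0 b *: (col a (Pi p *m sphere_proj R n *m Pi p) *m N p)).
    have alg (X Y U W1 V W2 q : 'M[R]_d) : q *m q = q ->
        (X *m q + U *m W1 - (Y *m q + V *m W2)) *m q = (X - Y) *m q + U *m (W1 *m q) - V *m (W2 *m q).
      move=> qq; rewrite mulmxBl 2!mulmxDl -2!(mulmxA _ q q) qq -2!mulmxA.
      by rewrite opprD addrACA -mulmxBl addrA.
    have comm : (Dm b (Dm a Pi) p - Dm a (Dm b Pi) p) *m Q p =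
        (\sum_c B b p a c *: (B c p *m Q p)) - (\sum_c B a p b c *: B c p) *m Q p.
      apply: etrans (congr1 (fun X => X *m Q p) (commutator a b p (smooth_Pi imm 2))) _.
      under eq_bigr do rewrite scalerBl.
      rewrite sumrB mulmxBl; congr (_ - _); rewrite mulmx_suml.
      by apply: eq_bigr => c _; rewrite -scalemxAl.
    have BDQ a' b' : B a' p *m (Dm b' Q p *m Q p) =
        - (B a' p *m (B b' p *m Q p)) - T p 0 b' *: (col a' (Pi p *m sphere_proj R n *m Pi p) *m N p).
      have eta_term : B a' p *m (T p 0 b' *: ((eta p)^T *m N p)) =
          - (T p 0 b' *: (col a' (Pi p *m sphere_proj R n *m Pi p) *m N p)).
        by rewrite -scalemxAr mulmxA B_eta mulNmx scalerN.
      by rewrite Dm_Q_Q mulmxDr eta_term mulmxN.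
    apply: etrans (congr1 (fun X => X *m Q p) (congr2 (fun X Y => X - Y) (dsff a b) (dsff b a))) _.
    apply: etrans (alg _ _ _ _ _ _ _ (Q_idem imm p)) _.
    apply: etrans (congr2 (fun X Y => X - Y) (congr2 (fun X Y => X + Y) comm (BDQ a b)) (BDQ b a)) _.
    have shuffle (A1 A2 A3 A4 A5 A6 : 'M[R]_d) :
        A1 - A2 + (- A3 - A5) - (- A4 - A6) = A1 - A2 - A3 + A4 + (A6 - A5).
      rewrite opprD !opprK -!addrA; congr (_ + (_ + (_ + _))).
      by rewrite addrCA; congr (_ + _); rewrite addrC.
    exact: shuffle.
  rewrite mulmx_suml (eq_bigr _ (fun a _ => etrans (esym (row_mul _ _ _)) (congr1 (row a) (step a)))).
  have rD a (A A' : 'M[R]_d) : row a (A + A') = row a A + row a A' by exact: linearD.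
  have rN a (A : 'M[R]_d) : row a (- A) = - row a A by exact: linearN.
  under eq_bigr do rewrite 4!rD 2!rN.
  rewrite 4!big_split /= 2!sumrN.
  have -> : \sum_a row a (\sum_c B b p a c *: (B c p *m Q p)) = 0.
    under eq_bigr do rewrite linear_sum /=.
    rewrite exchange_big -[RHS](contract0 (Pi_B_Pi p b)); apply: eq_bigr => c _ /=.
    rewrite mulmx_sum_row; apply: eq_bigr => a _.
    by rewrite linearZ /= row_entry [X in _ = X *: _]mxE.
  have -> : \sum_a row a (B a p *m (B b p *m Q p)) = 0.
    under eq_bigr do rewrite row_mul.
    by rewrite -mulmx_suml -B_Q mulmxA trace_B_Pi mul0mx.
  have -> : \sum_a row a (B b p *m (B a p *m Q p)) = 0.
    rewrite -[RHS](contract0 (Pi_B_Pi p b)); apply: eq_bigr => a _.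
    by rewrite row_mul B_sym.
  rewrite sub0r subr0 addr0 rowK; congr (_ + _).
  have rc a c (A : 'M[R]_d) (v : E) : row a (col c A *m v) = A a c *: v.
    apply/rowP => j; rewrite row_entry mulmx_entry big_ord1 [RHS]mxE.
    by congr (_ * _); rewrite mxE.
  have rZ a r (A : 'M[R]_d) : row a (r *: A) = r *: row a A by exact: linearZ.
  under eq_bigr => a _ do rewrite rD rN 2!rZ 2!rc 2!scalerA -scalerBl.
  rewrite -scaler_suml sumrB -mulr_sumr.
  have -> : \sum_a T p 0 a * (Pi p *m sphere_proj R n *m Pi p) a b = (T p *m (Pi p *m sphere_proj R n *m Pi p)) 0 b.
    by rewrite [RHS]mulmx_entry.
  have -> : \sum_a (Pi p *m sphere_proj R n *m Pi p) a a = \tr (Pi p *m sphere_proj R n *m Pi p) by [].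
  (* The two contractions give (1 - |T|^2) T_b and (m - |T|^2) T_b; in their difference |T|^2
     cancels and -(m - 1) T_b is left. *)
  have -> : \tr (Pi p *m sphere_proj R n *m Pi p) = m%:R - (T p *m (T p)^T) 0 0.
    rewrite Pi_sphere_proj_Pi [LHS]linearB /= (tr_Pi imm); congr (_ - _).
    by rewrite mxtrace_mulC /mxtrace big_ord1.
  have -> : T p *m (Pi p *m sphere_proj R n *m Pi p) = T p - T p *m (T p)^T *m T p.
    by rewrite Pi_sphere_proj_Pi mulmxBr T_Pi mulmxA.
  rewrite rZ; have -> : row b ((T p)^T *m N p) = T p 0 b *: N p.
    apply/rowP => j; rewrite row_entry mulmx_entry big_ord1 [RHS]mxE.
    by congr (_ * _); rewrite mxE.
  rewrite [in RHS]scalerA -[RHS]scaleNr; congr (_ *: N p).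
  have ent (u : E) : (u - u *m u^T *m u) 0 b = u 0 b - (u *m u^T) 0 0 * u 0 b.
    rewrite [LHS]mxE; congr (_ + _); rewrite [LHS]mxE; congr (- _).
    by rewrite [LHS]mulmx_entry big_ord1.
  rewrite ent; move: (T p 0 b) (_ 0 0) => t s; ring.
have Pi_y : Pi p *m y = 0.
  have -> : y = (\sum_a row a (B a p))^T.
    by rewrite linear_sum /=; apply: eq_bigr => a _; rewrite tr_row B_sym.
  by rewrite -[Pi p](Pi_sym imm) -trmx_mul trace_B_Pi trmx0.
have Pi_Y3 : Pi p *m Y3 = 0.
  apply/row_matrixP => b; rewrite row0 row_mulC.
  under eq_bigr => c _ do rewrite rowK scaler_sumr.
  rewrite exchange_big big1 // => a _ /=.
  have -> : \sum_c Pi p b c *: row a ((\sum_c' B a p c c' *: B c' p) *m Q p) =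
      row a ((\sum_c' row b (Pi p *m B a p) 0 c' *: B c' p) *m Q p).
    transitivity (row a ((\sum_c Pi p b c *: \sum_c' B a p c c' *: B c' p) *m Q p)).
      rewrite mulmx_suml linear_sum /=; apply: eq_bigr => c _.
      by rewrite -scalemxAl linearZ.
    congr (row a (_ *m _)).
    under eq_bigr do rewrite scaler_sumr.
    rewrite exchange_big; apply: eq_bigr => c' _ /=.
    rewrite row_entry mulmx_entry scaler_suml; apply: eq_bigr => c _.
    by rewrite scalerA.
  rewrite sum_B -row_mul Pi_B_Pi row0 big1 ?mul0mx ?row0 // => c _.
  by rewrite mxE scale0r.
have -> : P_div p *m Q p = y *m Hvec p - Y3 - (m%:R - 1) *: ((T p)^T *m N p).
  by apply/row_matrixP => b; exact: rowZ.
rewrite 2!mulmxBr mulmxA Pi_y mul0mx Pi_Y3 subr0 sub0r -scalemxAr mulmxA scaleNr.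
by rewrite -[Pi p](Pi_sym imm) -trmx_mul T_Pi.
Qed.

End Codazzi.

(** * The divergence of the flux *)

Section Flux.
Context (R : realType) (m n : nat) (M : topologicalType).
Local Notation d := (n.+1 + 1)%N.
Local Notation E := 'rV[R]_d.
Context (S : manifold R m M) (x : M -> E) (imm : immersion S x) (m_gt0 : (0 < m)%N).
Implicit Types (p : M) (a b : 'I_d).

Local Notation smooth k f := (smooth S k f).
Local Notation smooth_mx k A := (smooth_mx S k A).
Local Notation D := (D S x).
Local Notation Dm := (Dm S x).
Local Notation Pi := (Pi S x).
Local Notation Q := (Q S x).
Local Notation B a p := (Dm a Pi p).
Local Notation P_form := (P_form S x).
Local Notation T := (T S x).
Local Notation N := (N S x).

Context (xi : M -> E) (xi_smooth : forall k, class_C_on S k xi)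
  (xi_normal : forall p, normal S x p (xi p)) (f : M -> R) (f_C2 : smooth 2 f).
Local Notation Nxi := (Nxi S x xi).
Local Notation Dxi := (Dxi S x xi).
Local Notation Df := (Df S x f).
Local Notation nhess_form := (nhess_form S x xi).

(* flux is the field sum_ij <P(e_i, e_j), f nabla^perp_(e_j) xi - df(e_j) xi> e_i, whose
   divergence is the difference of the two sides. *)
Definition flux_form p : 'M[R]_d := f p *: Nxi p - Df p *m xi p.

Definition flux a p : R := \tr (P_form a p *m (flux_form p)^T).

Lemma xi_Q p : xi p *m Q p = xi p. Proof. exact: normal_Q. Qed.

Lemma Pi_Dxi p : Pi p *m Dxi p = Dxi p.
Proof.
apply/matrixP => a l; rewrite mulmx_entry [RHS]mxE (D_Pi imm); apply: eq_bigr => b _.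
by congr (_ * _); rewrite mxE.
Qed.

Lemma Pi_Nxi p : Pi p *m Nxi p = Nxi p.
Proof. by rewrite mulmxA Pi_Dxi. Qed.

Lemma Pi_Df p : Pi p *m Df p = Df p.
Proof.
apply/colP => a; rewrite mulmx_entry [RHS]mxE (D_Pi imm); apply: eq_bigr => b _.
by congr (_ * _); rewrite mxE.
Qed.

Lemma Pi_flux_form p : Pi p *m flux_form p = flux_form p.
Proof. by rewrite mulmxBr -scalemxAr Pi_Nxi mulmxA Pi_Df. Qed.

Lemma flux_form_Q p : flux_form p *m Q p = flux_form p.
Proof. by rewrite mulmxBl -scalemxAl -mulmxA -mulmxA (Q_idem imm) xi_Q. Qed.

Lemma smooth_f1 : smooth 1 f. Proof. exact: smoothS f_C2. Qed.

Lemma smooth_flux_form : smooth_mx 1 flux_form.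
Proof.
apply: smooth_mxD.
  by apply: smooth_mxZ; [exact: smooth_f1|exact: (smooth_Nxi imm xi_smooth)].
by apply: smooth_mxN; apply: smooth_mx_mul; [exact: (smooth_Df imm f_C2)|exact: smooth_xi].
Qed.

Lemma smooth_tr k q (A : M -> 'M[R]_q) : smooth_mx k A -> smooth k (fun p => \tr (A p)).
Proof. by move=> cA; apply: smooth_sum => i; exact: cA. Qed.

Lemma D_tr q (A : M -> 'M[R]_q) a p : smooth_mx 1 A -> D a (fun p => \tr (A p)) p = \tr (Dm a A p).
Proof.
move=> cA; rewrite /mxtrace D_sum; last by move=> i; exact: cA.
by apply: eq_bigr => i _; rewrite [RHS]mxE.
Qed.

Lemma smooth_flux a : smooth 1 (flux a).
Proof.
apply: smooth_tr; apply: smooth_mx_mul; first exact: (smooth_P_form imm).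
by apply: smooth_mx_tr; exact: smooth_flux_form.
Qed.

Lemma flux_tangent a p : \sum_b Pi p a b * flux b p = flux a p.
Proof.
have PP : \sum_b Pi p a b *: P_form b p = P_form a p.
  rewrite /P_form; under eq_bigr do rewrite scalerBr; rewrite sumrB; congr (_ - _).
    under eq_bigr do rewrite scalemxAl; rewrite -mulmx_suml; congr (_ *m _).
    apply/colP => c; rewrite summxE [RHS]mxE -[in RHS](Pi_idem imm) mulmx_entry.
    apply: eq_bigr => b _; rewrite [LHS]mxE [X in _ * X]mxE mulrC; congr (_ * _).
    by rewrite -[in LHS](Pi_sym imm) [LHS]mxE.
  under eq_bigr do rewrite scalemxAl; rewrite -mulmx_suml.
  by rewrite -(Dm_Pi imm).
rewrite /flux -[in RHS]PP mulmx_suml linear_sum; apply: eq_bigr => b _.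
by rewrite -scalemxAl linearZ.
Qed.

Lemma Dm_flux_form a p : Dm a flux_form p = (D a f p *: Nxi p + f p *: Dm a Nxi p) -
  (Dm a Df p *m xi p + Df p *m row a (Dxi p)).
Proof.
have s1 := smooth_Nxi imm xi_smooth 1.
have s2 := smooth_Df imm f_C2.
have s3 := smooth_xi xi_smooth 1.
have s4 : smooth_mx 1 (fun q => Df q *m xi q) by exact: smooth_mx_mul.
rewrite /flux_form DmD; [|by apply: smooth_mxZ; [exact: smooth_f1|]|exact: smooth_mxN].
rewrite DmN; last exact: s4.
rewrite DmZ; [|exact: smooth_f1|exact: s1].
by rewrite (Dm_mul x a p s2 s3) Dm_xi.
Qed.

Lemma D_flux a p : D a (flux a) p =
  \tr (Dm a (P_form a) p *m (flux_form p)^T) + \tr (P_form a p *m (Dm a flux_form p)^T).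
Proof.
have s1 := smooth_P_form imm 1 a.
have s2 := smooth_mx_tr smooth_flux_form.
rewrite /flux D_tr; last exact: smooth_mx_mul.
by rewrite (Dm_mul x a p s1 s2) Dm_tr linearD.
Qed.

(** Only Pi B Pi = 0 enters the trace when both factors are tangential. Hence the corrections by
    [Dm a Pi] in the second covariant derivatives of xi and f disappear when paired with P. *)
Lemma tr_B0 q a p (P' W : 'M[R]_(d, q)) : Pi p *m P' = P' -> Pi p *m W = W ->
  \tr (P' *m (B a p *m W)^T) = 0.
Proof.
have := B_sym imm p a; have := Pi_B_Pi imm p a; have := Pi_sym imm p.
move: (Pi p) (B a p) => PI BB PIs PBP Bs PP' PW.
have -> : (BB *m W)^T = W^T *m (PI *m BB) by rewrite trmx_mul Bs -[in LHS]PW trmx_mul PIs mulmxA.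
rewrite -PP' -[PI *m P' *m _]mulmxA mxtrace_mulC -!mulmxA [PI *m (BB *m _)]mulmxA PBP.
by rewrite !mulmx0 linear0.
Qed.

Lemma tr_nhess a p :
  \tr (P_form a p *m (nhess_form a p)^T) = \tr (P_form a p *m (Dm a Nxi p)^T).
Proof.
have Pi_P := Pi_P_form imm p a; have PQ := P_form_Q imm p a.
have -> : \tr (P_form a p *m (nhess_form a p)^T) =
    \tr (P_form a p *m (Dm a Nxi p - B a p *m Nxi p)^T).
  by rewrite trmx_mul (Q_sym imm) mulmxA PQ.
by rewrite linearB /= mulmxBr linearB /= tr_B0 ?subr0 //; exact: Pi_Nxi.
Qed.

Lemma tr_hess a p :
  \tr (P_form a p *m (xi p)^T *m (hess_col S x f a p)^T) = \tr (P_form a p *m (Dm a Df p *m xi p)^T).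
Proof.
have Pi_P : Pi p *m (P_form a p *m (xi p)^T) = P_form a p *m (xi p)^T.
  by rewrite mulmxA (Pi_P_form imm).
rewrite /hess_col linearB /= mulmxBr linearB /= tr_B0 ?subr0 //; last exact: Pi_Df.
by rewrite trmx_mul mulmxA.
Qed.

Lemma cross_terms p :
  \sum_a \tr (P_form a p *m (D a f p *: Nxi p)^T) =
  \sum_a \tr (P_form a p *m (Df p *m row a (Dxi p))^T).
Proof.
have lhs a : \tr (P_form a p *m (D a f p *: Nxi p)^T) =
    \sum_b D a f p * dot (row b (P_form a p)) (row b (Nxi p)).
  rewrite linearZ /= -scalemxAr linearZ /= mulr_sumr; apply: eq_bigr => b _.
  by rewrite dot_entry.
have rhs a : \tr (P_form a p *m (Df p *m row a (Dxi p))^T) =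
    \sum_b D b f p * dot (row b (P_form a p)) (row a (Nxi p)).
  have -> : \tr (P_form a p *m (Df p *m row a (Dxi p))^T) = \tr (P_form a p *m (Df p *m row a (Nxi p))^T).
    by rewrite -{1}(P_form_Q imm) -(Q_sym imm) -[P_form a p *m _ *m _]mulmxA -trmx_mul -mulmxA -row_mul.
  rewrite trmx_mul mulmxA; apply: eq_bigr => b _; rewrite mulmx_entry big_ord1 mulrC.
  rewrite [X in X * _]mxE [X in X * _]mxE dot_entry; congr (_ * dot _ _).
  by apply/rowP => j; rewrite row_entry.
rewrite (eq_bigr _ (fun a _ => lhs a)) (eq_bigr _ (fun a _ => rhs a)) exchange_big.
by apply: eq_bigr => b _; apply: eq_bigr => a _; rewrite (P_form_sym imm).
Qed.

(** As [flux_form] is tangential on the left and normal on the right, it sees only Pi [P_div] Q,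
    which [codazzi] evaluates. *)
Lemma tr_P_div p : \sum_a \tr (Dm a (P_form a) p *m (flux_form p)^T) =
  - (m%:R - 1) * (N p *m (flux_form p)^T *m (T p)^T) 0 0.
Proof.
have cod := codazzi imm p.
rewrite -linear_sum /= -mulmx_suml.
have -> : (flux_form p)^T = Q p *m (flux_form p)^T *m Pi p.
  by rewrite -[in LHS]flux_form_Q -[in LHS]Pi_flux_form !trmx_mul (Q_sym imm) (Pi_sym imm) mulmxA.
have -> : \tr (P_div S x p *m (Q p *m (flux_form p)^T *m Pi p)) = \tr (Pi p *m (P_div S x p *m Q p) *m (flux_form p)^T).
  by rewrite mulmxA mxtrace_mulC !mulmxA.
have -> : N p *m (Q p *m (flux_form p)^T *m Pi p) *m (T p)^T = N p *m (flux_form p)^T *m (T p)^T.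
  have NQ : N p *m Q p = N p by rewrite (NE imm) -mulmxA (Q_idem imm).
  have PT : Pi p *m (T p)^T = (T p)^T by rewrite -[Pi p](Pi_sym imm) -trmx_mul (T_Pi imm).
  by rewrite !mulmxA NQ -mulmxA PT.
rewrite cod -scalemxAl linearZ /=; congr (_ * _).
by rewrite -mulmxA mxtrace_mulC /mxtrace big_ord1.
Qed.

Lemma div_flux (e : 'I_m -> E) (nu : 'I_(n.+1 - m) -> E)
    (fr : M -> 'I_m -> E) (nfr : M -> 'I_(n.+1 - m) -> E) p :
  tangent_frame S x p e -> normal_frame S x p nu -> fr p = e -> nfr p = nu ->
  \sum_a D a (flux a) p =
  f p * box_star S x fr xi p - dot (box S x fr nfr f p) (xi p)
  - (m%:R - 1) * (f p * dot (nconn S x p (T p) xi) (N p) - dot (N p) (xi p) * dot (grad S x f p) (T p)).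
Proof.
move=> eP nuP fre nfre.
rewrite (box_starE imm m_gt0 eP xi_smooth fre) (boxE imm m_gt0 eP f_C2 nuP (xi_normal p) fre nfre).
rewrite (nconnE imm p xi_smooth).
rewrite (eq_bigr _ (fun a _ => tr_nhess a p)) (eq_bigr _ (fun a _ => tr_hess a p)).
rewrite (eq_bigr _ (fun a _ => D_flux a p)) big_split /= tr_P_div.
have expand a : \tr (P_form a p *m (Dm a flux_form p)^T) =
    \tr (P_form a p *m (D a f p *: Nxi p)^T) + f p * \tr (P_form a p *m (Dm a Nxi p)^T)
    - (\tr (P_form a p *m (Dm a Df p *m xi p)^T) + \tr (P_form a p *m (Df p *m row a (Dxi p))^T)).
  rewrite Dm_flux_form; move: (D a f p *: Nxi p) (Dm a Nxi p) (Dm a Df p *m xi p) (Df p *m _) => A1 A2 A3 A4.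
  have tB (X Y : 'M[R]_d) : (X - Y)^T = X^T - Y^T by exact: linearB.
  have tD (X Y : 'M[R]_d) : (X + Y)^T = X^T + Y^T by exact: linearD.
  have trB (X Y : 'M[R]_d) : \tr (X - Y) = \tr X - \tr Y by exact: linearB.
  by rewrite tB !tD mulmxBr !mulmxDr trB !mxtraceD [(f p *: A2)^T]linearZ /= -scalemxAr mxtraceZ.
have sum2 : \sum_a \tr (P_form a p *m (Dm a flux_form p)^T) =
    f p * (\sum_a \tr (P_form a p *m (Dm a Nxi p)^T)) - \sum_a \tr (P_form a p *m (Dm a Df p *m xi p)^T).
  apply: etrans (eq_bigr _ (fun a _ => expand a)) _.
  have cancel (X Y Z : 'I_d -> R) (r : R) (W : 'I_d -> R) : \sum_a W a = \sum_a Z a ->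
      \sum_a (W a + r * X a - (Y a + Z a)) = r * (\sum_a X a) - \sum_a Y a.
    move=> WZ; rewrite sumrB 2!big_split /= WZ -mulr_sumr.
    by rewrite opprD addrACA [_ - \sum_a Z a]addrC addrA [X in X - _]addrC; ring.
  exact: cancel (cross_terms p).
have last_term (Nv Tv xv : E) (W : 'M[R]_d) (G : 'cV[R]_d) (r : R) :
    (Nv *m (r *: W - G *m xv)^T *m Tv^T) 0 0 = r * dot (Tv *m W) Nv - dot Nv xv * dot G^T Tv.
  have tB (X Y : 'M[R]_d) : (X - Y)^T = X^T - Y^T by exact: linearB.
  have e1 (X Y : 'M[R]_1) : (X - Y) 0 0 = X 0 0 - Y 0 0 by rewrite mxE [X in _ + X]mxE.
  rewrite tB mulmxBr mulmxBl e1; congr (_ - _).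
    by rewrite linearZ /= -scalemxAr -scalemxAl [LHS]mxE dotC /dot trmx_mul mulmxA.
  have -> : Nv *m (G *m xv)^T *m Tv^T = (Nv *m xv^T) *m (G^T *m Tv^T) by rewrite trmx_mul !mulmxA.
  by rewrite [LHS]mulmx_entry big_ord1.
rewrite (gradE S x f p).
apply: etrans (congr2 (fun X Y => - (m%:R - 1) * X + Y)
  (last_term (N p) (T p) (xi p) (Nxi p) (Df p) (f p)) sum2) _.
move: (f p * dot _ _ - _) (\sum_a _) (\sum_a _) => A1 A2 A3.
by ring.
Qed.

End Flux.

(** * The divergence theorem for fields supported in a chart *)

Section Jacobi.
Context (R : realType) (m : nat) (V : set 'rV[R]_m) (oV : open V).
Local Notation fn := ('rV[R]_m -> R^o).

Lemma pderiv_prod (I : eqType) (r : seq I) (f : I -> fn) i u : V u ->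
  (forall l, class_C 1 V (f l)) -> uniq r ->
  pderiv i (fun v => \prod_(l <- r) f l v : R^o) u =
  \sum_(l <- r) pderiv i (f l) u * \prod_(k <- r | k != l) f k u.
Proof.
move=> Vu cf; elim: r => [_|l r IH /= /andP[lr ur]].
  rewrite big_nil -[RHS](derive_cst (1 : R^o) u (delta_mx 0 i)).
  by congr (pderiv i _ u); apply/funext => v; rewrite big_nil.
have -> : (fun v => \prod_(k <- l :: r) f k v : R^o) = (fun v => f l v * \prod_(k <- r) f k v : R^o).
  by apply/funext => v; rewrite big_cons.
rewrite (pderivM (V := V)) //; last exact: class_C_prod.
rewrite IH // big_cons addrC; congr (_ + _).
  rewrite mulrC; congr (_ * _); rewrite big_cons eqxx /=.
  rewrite [RHS]big_seq_cond [LHS]big_seq; apply: eq_bigl => k.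
  by case: (boolP (k \in r)) => //= kr; apply/esym/eqP => kl; move: lr; rewrite -kl kr.
rewrite mulr_sumr [RHS]big_seq [LHS]big_seq; apply: eq_bigr => k kr.
rewrite big_cons ifT; first by rewrite mulrCA.
by apply/eqP => lk; move: lr; rewrite lk kr.
Qed.

Lemma pderiv_det k (A : 'rV[R]_m -> 'M[R]_k) i u : V u -> mx_C 1 V A ->
  pderiv i (fun v => \det (A v) : R^o) u = \tr (dM i A u *m \adj (A u)).
Proof.
move=> Vu cA; rewrite /determinant.
have cprod (s : 'I_k -> 'I_k) : class_C 1 V (fun v => \prod_r A v r (s r) : R^o).
  by apply: class_C_prod => // r; exact: cA.
rewrite (pderiv_sum (V := V)) //; last first.
  by move=> s; apply: class_CM => //; exact: class_C_cst.
(* A with its r-th row differentiated; expansion along that row produces the adjugate. *)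
pose Ar r : 'M[R]_k := \matrix_(r', s) (if r' == r then dM i A u r' s else A u r' s).
transitivity (\sum_r \det (Ar r)).
  rewrite exchange_big; apply: eq_bigr => s _ /=.
  rewrite (pderivM (V := V)) //; last exact: class_C_cst.
  have dcst (t : R) : pderiv i (fun _ : 'rV[R]_m => t : R^o) u = 0 by exact: derive_cst.
  rewrite dcst mulr0 addr0 -mulr_sumr; congr (_ * _).
  rewrite pderiv_prod //; last exact: index_enum_uniq.
  apply: eq_bigr => r _; rewrite [RHS](bigD1 r) //=; congr (_ * _).
    by rewrite [RHS]mxE eqxx [RHS]mxE.
  by apply: eq_bigr => r' r'r; rewrite [RHS]mxE (negPf r'r).
apply: eq_bigr => r _; rewrite (expand_det_row _ r) mulmx_entry; apply: eq_bigr => s _.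
rewrite [X in X * _]mxE eqxx; congr (_ * _); rewrite [RHS]mxE /cofactor; congr (_ * \det _).
by apply/matrixP => a b; rewrite !mxE eq_sym (negPf (neq_lift _ _)).
Qed.

End Jacobi.

Section LocalDivergence.
Context (R : realType) (m n : nat).
Local Notation d := (n.+1 + 1)%N.
Context (F : 'rV[R]_m -> 'rV[R]_d) (V : set 'rV[R]_m) (oV : open V).
Context (cF : forall k, class_C k V F) (free : forall u, V u -> row_free (jac F u))
  (det_gt0 : forall u, V u -> 0 < \det (metric F u)).

Definition density u : R := Num.sqrt (\det (metric F u)).

Lemma pderiv_det_metric i u : V u ->
  pderiv i (fun v => \det (metric F v) : R^o) u = 2 * \det (metric F u) * \tr (dM i (jac F) u *m Cmx F u).
Proof.
move=> Vu; have cJ := mx_C_jac oV cF 1; have gu := metric_unit free Vu.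
rewrite (pderiv_det oV i Vu (mx_C_metric oV cF 1)).
have -> : \adj (metric F u) = \det (metric F u) *: invmx (metric F u).
  by rewrite /invmx gu scalerA mulfV ?scale1r // -unitfE -unitmxE.
rewrite -scalemxAr mxtraceZ [2 * _]mulrC -mulrA; congr (_ * _).
rewrite (dM_mul i oV cJ (mx_C_tr cJ) Vu) dM_tr mulmxDl mxtraceD.
have -> : \tr (jac F u *m (dM i (jac F) u)^T *m invmx (metric F u)) = \tr (dM i (jac F) u *m (jac F u)^T *m invmx (metric F u)).
  rewrite -[LHS]mxtrace_tr trmx_mul trmx_mul trmxK invmetric_sym mxtrace_mulC.
  by [].
by rewrite /Cmx mulmxA mulr2n mulrDl mul1r.
Qed.

Lemma density_gt0 u : V u -> 0 < density u.
Proof. by move=> Vu; rewrite sqrtr_gt0 det_gt0. Qed.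

Lemma class_C_density : class_C 1 V (density : _ -> R^o).
Proof.
have cdet := class_C_det oV (mx_C_metric oV cF 1).
apply: (class_C1_comp1 (dth := fun r => (2 * Num.sqrt r)^-1 : R^o) oV cdet) => u Vu.
  exact: is_derive1_sqrt (det_gt0 Vu).
have cs : {for \det (metric F u), continuous (fun r : R => Num.sqrt r : R^o)}.
  apply/differentiable_continuous/derivable1_diffP.
  exact: (@ex_derive _ _ _ _ _ _ _ (is_derive1_sqrt (det_gt0 Vu))).
apply: (@continuousV _ _ (fun r : R => 2 * Num.sqrt r)).
  by rewrite mulf_neq0 ?pnatr_eq0 // gt_eqF // density_gt0.
by apply: (@continuousM _ _ (fun=> 2)); [exact: cst_continuous|exact: cs].
Qed.

(** Follows by differentiating density^2 = det g and cancelling 2 density. *)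
Lemma pderiv_density i u : V u ->
  pderiv i (density : _ -> R^o) u = density u * \tr (dM i (jac F) u *m Cmx F u).
Proof.
move=> Vu; have cg := class_C_density.
have sqr v : V v -> density v * density v = \det (metric F v).
  by move=> Vv; rewrite -expr2 sqr_sqrtr // ltW // det_gt0.
have := pderivM i cg cg Vu.
rewrite (pderiv_eq_on i oV sqr Vu) pderiv_det_metric // -sqr //.
move: (\tr _) (pderiv i _ u) => t s e.
have d0 : density u != 0 by rewrite gt_eqF // density_gt0.
apply: (mulfI d0); apply: (mulfI (_ : (2 : R) != 0)); first by rewrite pnatr_eq0.
have -> : 2 * (density u * s) = density u * s + density u * s by ring.
by rewrite -e; ring.
Qed.

(** Besides the derivatives of the components, the left side contains a sum of Christoffel symbols
    contracted over i. Symmetry of the second derivatives of F turns it into the logarithmic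
    derivative of the density. *)
Lemma local_divergence (w : 'rV[R]_m -> 'rV[R]_m) u : V u -> mx_C 1 V w ->
  density u * (\sum_i (dM i (fun v => w v *m jac F v) u *m Cmx F u) 0 i) =
  \sum_i pderiv i (fun v => density v * w v 0 i : R^o) u.
Proof.
move=> Vu cw; have cJ := mx_C_jac oV cF 1; have cg := class_C_density.
have dw i : pderiv i (fun v => density v * w v 0 i : R^o) u =
    density u * dM i w u 0 i + w u 0 i * (density u * \tr (dM i (jac F) u *m Cmx F u)).
  by rewrite (pderivM i cg (cw 0 i) Vu) pderiv_density // [dM i w u 0 i]mxE.
rewrite (eq_bigr _ (fun i _ => dw i)) big_split /= -mulr_sumr.
have dwJ i : (dM i (fun v => w v *m jac F v) u *m Cmx F u) 0 i =
    dM i w u 0 i + (w u *m (dM i (jac F) u *m Cmx F u)) 0 i.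
  rewrite (dM_mul i oV cw cJ Vu) mulmxDl -mulmxA (jac_Cmx free Vu) mulmx1 -mulmxA.
  by rewrite [LHS]mxE.
rewrite (eq_bigr _ (fun i _ => dwJ i)) big_split /= mulrDr; congr (_ + _).
have sw i j : (dM i (jac F) u *m Cmx F u) j i = (dM j (jac F) u *m Cmx F u) i i.
  apply: etrans (mulmx_entry _ _ _ _) (etrans _ (esym (mulmx_entry _ _ _ _))).
  by apply: eq_bigr => l _; apply: (congr1 (fun X => X * _)); exact: (second_deriv_sym oV cF).
under eq_bigr do rewrite mulmx_entry.
rewrite exchange_big mulr_sumr; apply: eq_bigr => j _ /=.
rewrite -mulr_sumr mulrCA; congr (_ * (_ * _)).
by apply: eq_bigr => i _; exact: sw.
Qed.

End LocalDivergence.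

Section ExtensionByZero.
Context (R : realType) (m : nat).
Local Notation E := 'rV[R]_m.

Lemma class_C_setU (W : normedModType R) k (A A' : set E) (f : E -> W) :
  class_C k A f -> class_C k A' f -> class_C k (A `|` A') f.
Proof.
elim: k f => [|k IH] f [cA dA] [cA' dA'].
  by split => // u [/cA|/cA'].
split => [u [/cA|/cA']//|i].
have [d1 c1] := dA i; have [d2 c2] := dA' i.
by split => [u [/d1|/d2]//|]; exact: IH.
Qed.

(** V and the complement of K are open and cover the space, and on the latter the extension is
    zero. *)
Lemma class_C_ext0 k (V K : set E) (f : E -> R^o) : open V -> closed K -> K `<=` V ->
  class_C k V f -> (forall u, V u -> ~ K u -> f u = 0) -> class_C k setT (f \_ V : E -> R^o).
Proof.
move=> oV cK KV cf f0.
have <- : V `|` ~` K = setT.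
  apply/seteqP; split => // u _; have [Ku|nKu] := pselect (K u); first by left; exact: KV.
  by right.
apply: class_C_setU.
  by apply: class_C_eq cf => // u Vu; rewrite patchE mem_set.
apply: class_C_eq (class_C_cst k _ (0 : R^o)); first exact: closed_openC.
move=> u nKu; rewrite patchE; case: ifPn => // /set_mem Vu.
by rewrite f0.
Qed.

End ExtensionByZero.

(** * Integration of functions supported in a chart *)

Section ChartIntegral.
Context (R : realType) (m n : nat) (M : ptopologicalType).
Local Notation d := (n.+1 + 1)%N.
Local Notation E := 'rV[R]_d.
Context (S : manifold R m M) (x : M -> E) (imm : immersion S x).
Context (mu : {measure set (g_sigma_algebraType (@open M)) -> \bar R})
  (mu_riem : riemannian_measure S x mu).
Context (det_gt0 : forall (c : chart S) u, im c u -> 0 < \det (metric (x \o par c) u)).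
Local Notation smooth k f := (smooth S k f).
Local Notation Borel := (g_sigma_algebraType (@open M)).

Lemma smooth_continuous k f : smooth k f -> continuous (f : M -> R^o).
Proof.
move=> cf p; pose c := chart_at S p; have cp : dom c p := chart_atP S p.
have : {for p, continuous ((f \o par c : _ -> R^o) \o coor c)}.
  apply: continuous_comp; first exact: coor_continuous.
  by apply: class_C_cont (cf c) _; exact: im_coor.
apply: continuous_near_eq.
have : \forall q \near p, dom c q by apply: open_nbhs_nbhs; split => //; exact: dom_open.
by apply: filterS => q cq /=; rewrite coorK.
Qed.

Lemma continuous_measurable (f : M -> R) : continuous (f : M -> R^o) ->
  measurable_fun [set: Borel] (f : Borel -> R).
Proof.
move=> cf; apply: (measurability _ (RGenOpens.measurableE R)).
move=> _ [_ [a [b ->] <-]]; rewrite setTI; apply: sub_sigma_algebra.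
by have /continuousP := cf; apply; exact: interval_open.
Qed.

Section Chart.
Context (c : chart S) (K : set M) (K_compact : compact K) (K_dom : K `<=` dom c).
Context (L : R) (L_gt0 : 0 < L) (K_box : forall u, (coor c @` K) u -> forall j, `|u 0 j| < L).

Definition chart_lift (w : M -> R) : 'rV[R]_m -> R :=
  (fun u => w (par c u) * density (x \o par c) u) \_ (im c).

Let oV : open (im c) := @open_im _ _ _ S c.
Let cF := immersion_class imm c.
Let fr := @immersion_free _ _ _ _ _ _ imm c.

Lemma coorK_closed : closed (coor c @` K).
Proof.
apply: compact_closed; first exact: norm_hausdorff.
apply: continuous_compact => //; apply: continuous_in_subspaceT => p /set_mem Kp.
exact/coor_continuous/K_dom.
Qed.

Lemma coorK_sub : coor c @` K `<=` im c.
Proof. by move=> _ [p Kp <-]; apply: im_coor; exact: K_dom. Qed.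

Lemma chart_lift_eq0 w u : (forall p, ~ K p -> w p = 0) -> ~ (coor c @` K) u ->
  chart_lift w u = 0.
Proof.
move=> w0 nKu; rewrite /chart_lift patchE; case: ifPn => // /set_mem iu.
by rewrite w0 ?mul0r // => Kp; apply: nKu; exists (par c u) => //; exact: parK.
Qed.

Lemma chart_lift_class k (w : M -> R) : (k <= 1)%N -> smooth k w -> (forall p, ~ K p -> w p = 0) ->
  class_C k setT (chart_lift w : _ -> R^o).
Proof.
move=> k1 cw w0.
have cdens : class_C k (im c) (density (x \o par c) : _ -> R^o).
  have := class_C_density oV cF (det_gt0 (c := c)).
  by move: k1; case: (k) => [_|[|//]]; [exact: class_CS|].
apply: (class_C_ext0 oV coorK_closed coorK_sub); first exact: (class_CM oV (cw c) cdens).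
move=> u iu nKu; rewrite w0 ?mul0r // => Kp; apply: nKu.
by exists (par c u) => //; exact: parK.
Qed.

Lemma chart_lift_continuous w : smooth 0 w -> (forall p, ~ K p -> w p = 0) ->
  continuous (chart_lift w : _ -> R^o).
Proof. by move=> cw w0 u; apply: class_C_cont (chart_lift_class _ cw w0) _. Qed.

Lemma integral_chart_ge0 w : smooth 0 w -> (forall p, 0 <= w p) -> (forall p, ~ K p -> w p = 0) ->
  (\int[mu]_p (w p)%:E = (box_int L (chart_lift w))%:E)%E.
Proof.
move=> cw w_ge0 w0.
have cont_w := smooth_continuous cw.
have mw : measurable_fun [set: Borel] (EFin \o w : Borel -> \bar R).
  by apply/measurable_EFinP; exact: continuous_measurable.
have := mu_riem c mw (fun p => _ : (0 <= (w p)%:E)%E).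
rewrite integral_mkcond.
have -> : (fun p : Borel => (w p)%:E) \_ (dom c) = (fun p => (w p)%:E).
  apply/funext => p; rewrite patchE; case: ifPn => // /negP ndc.
  by rewrite w0 // => /K_dom cp; apply: ndc; exact: mem_set.
move=> -> //.
rewrite -lebesgue_int_box //; last 2 first.
- exact: chart_lift_continuous.
- move=> u nu; apply: chart_lift_eq0 => // Ku; apply: nu => j.
  exact/ltW/K_box.
congr lebesgue_int; apply/funext => u; rewrite /chart_lift !patchE.
by case: ifP.
Qed.

Lemma integrable_chart_ge0 w : smooth 0 w -> (forall p, 0 <= w p) -> (forall p, ~ K p -> w p = 0) ->
  mu.-integrable [set: Borel] (EFin \o w).
Proof.
move=> cw w_ge0 w0; apply/integrableP; split.
  have cont_w := smooth_continuous cw.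
  by apply/measurable_EFinP; exact: continuous_measurable.
under eq_integral do rewrite /= ger0_norm //.
by rewrite integral_chart_ge0 // ltry.
Qed.

Lemma smooth_norm w : smooth 0 w -> smooth 0 (fun p => `|w p|).
Proof.
move=> cw c'; split => [u iu|//]; have cwu := class_C_cont (cw c') iu.
by apply: (continuous_comp cwu); exact: norm_continuous.
Qed.

(** [riemannian_measure] speaks of nonnegative functions, so w is written as (|w| + w) - |w|.
    Absolute values preserve continuity but not differentiability, hence class 0. *)
Lemma integral_chart w : smooth 0 w -> (forall p, ~ K p -> w p = 0) ->
  mu.-integrable [set: Borel] (EFin \o w) /\ \int[mu]_p w p = box_int L (chart_lift w).
Proof.
move=> cw w0.
have cn := smooth_norm cw; have cs := smoothD cn cw.
have n0 p : ~ K p -> `|w p| = 0 by move=> /w0 ->; rewrite normr0.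
have s0 p : ~ K p -> `|w p| + w p = 0 by move=> /w0 ->; rewrite normr0 addr0.
have s_ge0 p : 0 <= `|w p| + w p by rewrite -normrN -{2}[w p]opprK subr_ge0 ler_norm.
have i1 := integrable_chart_ge0 cn (fun p => normr_ge0 _) n0.
have i2 := integrable_chart_ge0 cs s_ge0 s0.
have wE : w = (fun p => (`|w p| + w p) - `|w p|) by apply/funext => p; rewrite addrAC subrr add0r.
have e1 : \int[mu]_p `|w p| = box_int L (chart_lift (fun p => `|w p|)).
  by rewrite /Rintegral integral_chart_ge0.
have e2 : \int[mu]_p (`|w p| + w p) = box_int L (chart_lift (fun p => `|w p| + w p)).
  by rewrite /Rintegral integral_chart_ge0.
split.
  by rewrite wE; exact: (integrableB _ i2 i1).
rewrite [in LHS]wE RintegralB // e1 e2.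
have [lD _ _ _] := box_intP L_gt0 m.
have -> : chart_lift (fun p => `|w p| + w p) = (fun u => chart_lift (fun p => `|w p|) u + chart_lift w u).
  apply/funext => u; rewrite /chart_lift !patchE; case: ifP => _; last by rewrite addr0.
  by rewrite mulrDl.
rewrite lD; [|exact: chart_lift_continuous|exact: chart_lift_continuous].
by rewrite addrAC subrr add0r.
Qed.

End Chart.

End ChartIntegral.

Lemma compact_rV_bound (R : realType) m (A : set 'rV[R]_m) : compact A ->
  exists2 L : R, 0 < L & forall u, A u -> forall j, `|u 0 j| < L.
Proof.
move=> /compact_bounded [B [_ BP]].
(* Every number above B bounds the norm; |B| + 1 is one, and a further unit makes the inequality
   strict. *)
exists (`|B| + 2); first by rewrite ltr_wpDl.
move=> u Au j; apply: (@le_lt_trans _ _ `|u|).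
  by rewrite [leRHS]mx_normrE; apply: (le_bigmax _ (fun ij : 'I_1 * 'I_m => `|u ij.1 ij.2|) (0, j)).
apply: (@le_lt_trans _ _ (`|B| + 1)); last by rewrite ltrD2l ltr1n.
by apply: BP Au; rewrite (le_lt_trans (ler_norm B)) // ltrDl.
Qed.

Lemma coor_compact (R : realType) m (M : topologicalType) (S : manifold R m M) (c : chart S)
    (K : set M) : compact K -> K `<=` dom c -> compact (coor c @` K).
Proof.
move=> K_compact K_dom; apply: continuous_compact => //.
apply: continuous_in_subspaceT => p /set_mem Kp.
exact/coor_continuous/K_dom.
Qed.

Lemma box_int_sum (R : realType) (L : R) (L_gt0 : 0 < L) m (I : Type) (s : seq I)
    (f : I -> 'rV[R]_m -> R) : (forall i, continuous (f i : _ -> R^o)) ->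
  continuous (fun u => \sum_(i <- s) f i u : R^o) /\
  box_int L (fun u => \sum_(i <- s) f i u) = \sum_(i <- s) box_int L (f i).
Proof.
move=> cf; elim: s => [|i s [cs IH]].
  have -> : (fun u => \sum_(i <- [::]) f i u) = (fun=> 0) by apply/funext => u; rewrite big_nil.
  by rewrite big_nil box_int0 //; split => // u; exact: cst_continuous.
have -> : (fun u => \sum_(j <- i :: s) f j u) = (fun u => f i u + \sum_(j <- s) f j u).
  by apply/funext => u; rewrite big_cons.
split; first by move=> u; exact: (continuousD (cf i u) (cs u)).
have [lD _ _ _] := box_intP L_gt0 m.
by rewrite big_cons lD // IH.
Qed.

Section Divergence.
Context (R : realType) (m n : nat) (M : ptopologicalType).
Local Notation d := (n.+1 + 1)%N.
Local Notation E := 'rV[R]_d.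
Context (S : manifold R m M) (x : M -> E) (imm : immersion S x) (M_haus : hausdorff_space M).
Context (mu : {measure set (g_sigma_algebraType (@open M)) -> \bar R})
  (mu_riem : riemannian_measure S x mu).
Context (det_gt0 : forall (c : chart S) u, im c u -> 0 < \det (metric (x \o par c) u)).
Local Notation smooth k f := (smooth S k f).
Local Notation D := (D S x).
Local Notation Pi := (Pi S x).
Local Notation Borel := (g_sigma_algebraType (@open M)).
Implicit Types (p : M) (a b : 'I_d).

Lemma D_near0 f a p : (\forall q \near p, f q = 0) -> D a f p = 0.
Proof.
move=> f0; rewrite D_at big1 // => i _.
rewrite -[RHS](mulr0 (Cmx (x \o loc S p) (pt S p) a i)); congr (_ * _).
rewrite -[RHS](derive_cst (0 : R^o) (pt S p) (delta_mx 0 i)).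
apply: near_eq_derive.
have pc := par_continuous (in_im S p).
by apply: (pc [set q | f q = 0]); rewrite [par _ _]loc_pt.
Qed.

Section Supported.
Context (c : chart S) (K : set M) (K_compact : compact K) (K_dom : K `<=` dom c).
Context (V : 'I_d -> M -> R) (V_smooth : forall a, smooth 1 (V a))
  (V_tan : forall p a, \sum_b Pi p a b * V b p = V a p) (V0 : forall a p, ~ K p -> V a p = 0).

Let oV : open (im c) := @open_im _ _ _ S c.
Let cF := immersion_class imm c.
Let fr := @immersion_free _ _ _ _ _ _ imm c.
(** The dual frame extracts the coordinate components [w] of the tangent field V. The functions
    [Phi i], density times component extended by zero, have as ordinary divergence the Riemannian
    divergence times the density. *)
Let Vrow u : E := \row_a V a (par c u).
Let w u : 'rV[R]_m := Vrow u *m Cmx (x \o par c) u.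
Let Phi i : 'rV[R]_m -> R := (fun u => density (x \o par c) u * w u 0 i) \_ (im c).

Definition divergence p : R := \sum_a D a (V a) p.

Lemma smooth_divergence : smooth 0 divergence.
Proof. by apply: smooth_sum => a; exact: (smooth_D imm a (V_smooth a)). Qed.

Lemma divergence0 p : ~ K p -> divergence p = 0.
Proof.
move=> nKp; rewrite /divergence big1 // => a _; apply: D_near0.
have : \forall q \near p, (~` K) q.
  by apply: open_nbhs_nbhs; split => //; apply: closed_openC; exact: compact_closed.
by apply: filterS => q; exact: V0.
Qed.

Lemma mx_C_w : mx_C 1 (im c) w.
Proof.
apply: mx_C_mul => //; last exact: (mx_C_Cmx oV cF fr).
move=> i a; apply: class_C_eq (V_smooth a c) => // u iu.
by rewrite [RHS]mxE.
Qed.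

Lemma Vrow_w u : im c u -> w u *m jac (x \o par c) u = Vrow u.
Proof.
move=> iu; rewrite /w -mulmxA -(Pi_chart imm iu).
apply/rowP => a; rewrite mulmx_entry [RHS]mxE -V_tan; apply: eq_bigr => b _.
by rewrite [X in X * _]mxE mulrC -[in RHS](Pi_sym imm) [X in _ = X * _]mxE.
Qed.

Lemma class_C_Phi i : class_C 1 setT (Phi i : _ -> R^o).
Proof.
have cdens := class_C_density oV cF (det_gt0 (c := c)).
apply: (class_C_ext0 oV (coorK_closed K_compact K_dom) (coorK_sub K_dom)).
  exact: (class_CM oV cdens (mx_C_w 0 i)).
move=> u iu nKu.
have -> : w u = 0.
  rewrite /w; have -> : Vrow u = 0; last by rewrite mul0mx.
  apply/rowP => a; rewrite mxE [RHS]mxE V0 // => Kp; apply: nKu.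
  by exists (par c u) => //; exact: parK.
by rewrite mxE mulr0.
Qed.

Lemma lift_divergence u : chart_lift x c divergence u = \sum_i pderiv i (Phi i : _ -> R^o) u.
Proof.
have [iu|niu] := pselect (im c u); last first.
  rewrite /chart_lift patchE memNset // big1 // => i _.
  have nKu : ~ (coor c @` K) u by move=> Ku; apply: niu; exact: coorK_sub Ku.
  rewrite -[RHS](derive_cst (0 : R^o) u (delta_mx 0 i)).
  apply: (@pderiv_eq_on _ _ _ (~` (coor c @` K)) (Phi i : _ -> R^o) (fun=> 0)) nKu.
    by apply: closed_openC; exact: coorK_closed.
  move=> v nKv; rewrite /Phi patchE; case: ifPn => // /set_mem iv.
  have -> : w v = 0; last by rewrite mxE mulr0.
  rewrite /w; have -> : Vrow v = 0; last by rewrite mul0mx.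
  apply/rowP => a; rewrite mxE [RHS]mxE V0 // => Kp; apply: nKv.
  by exists (par c v) => //; exact: parK.
rewrite /chart_lift patchE mem_set //.
have -> : \sum_i pderiv i (Phi i : _ -> R^o) u =
    \sum_i pderiv i (fun v => density (x \o par c) v * w v 0 i : R^o) u.
  apply: eq_bigr => i _; apply: (pderiv_eq_on i oV _ iu) => v iv.
  by rewrite /Phi patchE mem_set.
rewrite -(local_divergence oV cF fr (det_gt0 (c := c)) iu mx_C_w) mulrC; congr (_ * _).
have dV i : dM i (fun v => w v *m jac (x \o par c) v) u = dM i Vrow u.
  exact: (dM_eq i oV Vrow_w iu).
have -> : \sum_i (dM i (fun v => w v *m jac (x \o par c) v) u *m Cmx (x \o par c) u) 0 i =
   \sum_i \sum_a pderiv i (fun v => V a (par c v) : R^o) u * Cmx (x \o par c) u a i.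
  apply: eq_bigr => i _; rewrite dV mulmx_entry; apply: eq_bigr => a _; apply: (congr1 (fun X => X * _)).
  rewrite [LHS]mxE; apply: (congr1 (fun G => pderiv i G u)).
  by apply/funext => v; rewrite mxE.
rewrite exchange_big; apply: eq_bigr => a _ /=.
have := D_chart imm a (V_smooth a) (par_dom iu); rewrite parK // => e.
by apply: etrans e _; apply: eq_bigr => i _; rewrite mulrC.
Qed.

Lemma divergence_chart : mu.-integrable [set: Borel] (EFin \o divergence) /\ \int[mu]_p divergence p = 0.
Proof.
have [L L_gt0 K_box] := compact_rV_bound (coor_compact K_compact K_dom).
have [intd ->] := integral_chart imm mu_riem det_gt0 K_compact K_dom L_gt0 K_box smooth_divergence divergence0.
split => //.
have -> : chart_lift x c divergence = (fun u => \sum_i pderiv i (Phi i : _ -> R^o) u).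
  by apply/funext => u; exact: lift_divergence.
have cP i := class_C_Phi i.
rewrite (box_int_sum L_gt0 _ _).2; last by move=> i u; exact: class_C_cont (class_C_pderiv i (cP i)) _.
rewrite big1 // => i _; apply: (box_int_pderiv L_gt0).
- by move=> u; exact: class_C_cont (cP i) _.
- by move=> j u; exact: class_C_derivable (cP i) _.
- by move=> j u; exact: class_C_cont (class_C_pderiv j (cP i)) _.
(* Coordinates of points in the image of K are strictly below L in absolute value, so v lies outside
   it and [Phi i] vanishes on the boundary of the cube too. *)
- move=> v j vj; rewrite /Phi patchE; case: ifPn => // /set_mem iv.
  have -> : w v = 0; last by rewrite mxE mulr0.
  rewrite /w; have -> : Vrow v = 0; last by rewrite mul0mx.
  apply/rowP => a; rewrite mxE [RHS]mxE V0 // => Kp.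
  have Kv : (coor c @` K) v by exists (par c v) => //; exact: parK.
  by have := K_box _ Kv j; rewrite ltNge vj.
Qed.

End Supported.

End Divergence.

(** * Partition of unity *)

Section Bump.
Context (R : realType).

(** Squaring makes the positive part C^1 at 0, the regularity asked of a cut-off that is
    differentiated once. *)
Definition pospart2 (s : R) : R^o := Num.max 0 s ^+ 2.

Lemma is_derive_pospart2 (s : R) : is_derive s 1 pospart2 (2 * Num.max 0 s).
Proof.
have [s_lt0|s_gt0|->] := ltgtP s 0.
- rewrite mulr0.
  apply: (near_eq_is_derive (f := fun=> 0 : R^o)).
    have : \forall r \near s, r < 0 by exact: lt_nbhsl.
    by apply: filterS => r r0; rewrite /pospart2 max_l ?ltW // expr0n.
- apply: (near_eq_is_derive (f := fun r : R => r ^+ 2 : R^o)).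
    have : \forall r \near s, 0 < r by exact: lt_nbhsr.
    by apply: filterS => r r0; rewrite /pospart2 max_r ?ltW.
  have -> : 2 * s = (2%:R * s ^+ 1) *: (1 : R^o) by rewrite expr1 [RHS]mulr1.
  exact: (@is_deriveX _ _ (id : R -> R) 2 s 1 1 (is_derive_id s 1)).
- rewrite mulr0.
  suff lim0 : (fun h : R => h^-1 *: ((pospart2 \o shift 0) (h *: (1:R)) - pospart2 0) : R^o) @ 0^' --> (0 : R^o).
    by split; [apply/cvg_ex; eexists; exact: lim0|exact: cvg_lim lim0].
  apply/cvgrPdist_le => e e0; near=> h.
  have he : `|h| <= e by near: h; exact: dnbhs0_le.
  rewrite sub0r normrN /= addr0 [h *: 1]mulr1 /pospart2 maxxx expr0n subr0.
  have [h0|h0] := ltP 0 h; last by rewrite expr0n scaler0 normr0 ltW.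
  by rewrite [_ *: _]mulrC expr2 mulfK ?gt_eqF.
Unshelve. all: by end_near. Qed.

Lemma class_C_coordfn m k (V : set 'rV[R]_m) j : class_C k V (fun u => u 0 j : R^o).
Proof.
have dc i u : is_derive u (delta_mx 0 i) (fun u : 'rV[R]_m => u 0 j : R^o) ((delta_mx 0 i : 'rV[R]_m) 0 j).
  suff lim0 : (fun h : R => h^-1 *: (((fun u : 'rV[R]_m => u 0 j : R^o) \o shift u) (h *: delta_mx 0 i) - u 0 j) : R^o) @ 0^'
      --> ((delta_mx 0 i : 'rV[R]_m) 0 j : R^o).
    by split; [apply/cvg_ex; eexists; exact: lim0|exact: cvg_lim lim0].
  apply: cvg_near_cst; near=> h.
  have h0 : h != 0 by near: h; exact: nbhs_dnbhs_neq.
  by rewrite /= mxE addrK mxE scalerA mulVf // scale1r.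
case: k => [|k]; first by split => // u _; exact: coord_continuous.
split => [u _|i]; first exact: coord_continuous.
split => [u _|]; first exact: (@ex_derive _ _ _ _ _ _ _ (dc i u)).
have -> : pderiv i (fun u => u 0 j : R^o) = fun=> (delta_mx 0 i : 'rV[R]_m) 0 j.
  by apply/funext => u; exact: (@derive_val _ _ _ _ _ _ _ (dc i u)).
exact: class_C_cst.
Unshelve. all: by end_near. Qed.

Definition bump_fun m (u0 : 'rV[R]_m) (rho : R) (u : 'rV[R]_m) : R^o :=
  pospart2 (rho ^+ 2 - \sum_j (u 0 j - u0 0 j) * (u 0 j - u0 0 j)).

Lemma bump_fun_class m (u0 : 'rV[R]_m) rho : class_C 1 setT (bump_fun u0 rho).
Proof.
have oT : open [set: 'rV[R]_m] by exact: openT.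
have cd j : class_C 1 setT (fun u : 'rV[R]_m => u 0 j - u0 0 j : R^o).
  by apply: class_CD => //; [exact: class_C_coordfn|exact: class_C_cst].
have cq : class_C 1 setT (fun u : 'rV[R]_m => rho ^+ 2 - \sum_j (u 0 j - u0 0 j) * (u 0 j - u0 0 j) : R^o).
  have cs : class_C 1 setT (fun u : 'rV[R]_m => \sum_j (u 0 j - u0 0 j) * (u 0 j - u0 0 j) : R^o).
    by apply: class_C_sum => // j; exact: class_CM oT (cd j) (cd j).
  have cm := class_CM oT (class_C_cst 1 setT (-1 : R^o)) cs.
  have := class_CD oT (class_C_cst 1 setT (rho ^+ 2 : R^o)) cm.
  by apply: class_C_eq => // u _; rewrite mulN1r.
apply: (class_C1_comp1 (dth := fun s => 2 * Num.max 0 s : R^o) oT cq) => u _.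
  exact: is_derive_pospart2.
apply: (@continuousM _ _ (fun=> 2) (fun s : R => Num.max 0 s)); first exact: cst_continuous.
apply: (@continuous_max _ _ (fun=> 0) id); [exact: cst_continuous|exact: cvg_id].
Qed.

Lemma bump_fun_ge0 m (u0 : 'rV[R]_m) rho u : 0 <= bump_fun u0 rho u.
Proof. exact: sqr_ge0. Qed.

Lemma bump_fun_gt0 m (u0 : 'rV[R]_m) rho : 0 < rho -> 0 < bump_fun u0 rho u0.
Proof.
move=> r0; rewrite /bump_fun /pospart2 big1; last by move=> j _; rewrite subrr mul0r.
by rewrite subr0 max_r ?sqr_ge0 // exprn_gt0 // exprn_gt0.
Qed.

Lemma bump_fun_supp m (u0 : 'rV[R]_m) rho u : 0 < rho -> bump_fun u0 rho u != 0 ->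
  forall j, `|u 0 j - u0 0 j| <= rho.
Proof.
move=> r0; rewrite /bump_fun /pospart2 expf_eq0 /= => ne j.
have : 0 < rho ^+ 2 - \sum_j (u 0 j - u0 0 j) * (u 0 j - u0 0 j).
  by rewrite ltNge; apply/negP => le0; move: ne; rewrite max_l // eqxx.
rewrite subr_gt0 (bigD1 j) //= => lt.
have : `|u 0 j - u0 0 j| ^+ 2 <= rho ^+ 2.
  rewrite real_normK ?num_real // expr2; apply: le_trans (ltW lt).
  by rewrite lerDl sumr_ge0 // => i _; rewrite -expr2 sqr_ge0.
by rewrite ler_pXn2r // nnegrE ?normr_ge0 // ltW.
Qed.

End Bump.

Section BumpOnManifold.
Context (R : realType) (m : nat) (M : ptopologicalType) (S : manifold R m M)
  (M_haus : hausdorff_space M).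
Local Notation smooth k f := (smooth S k f).

(** In another chart the extension is g composed with a transition map on the overlap, and zero off
    K. The second region is open since a compact set in a Hausdorff space is closed. *)
Lemma smooth_ext0 k (c : chart S) (K : set M) (g : 'rV[R]_m -> R^o) :
  compact K -> K `<=` dom c -> class_C k (im c) g ->
  (forall u, im c u -> ~ K (par c u) -> g u = 0) -> smooth k ((g \o coor c) \_ (dom c)).
Proof.
move=> K_compact K_dom cg g0 c'.
have K_closed := compact_closed M_haus K_compact.
pose A : set 'rV[R]_m := coor c' @` (dom c' `&` dom c).
pose A' : set 'rV[R]_m := im c' `&` [set u | ~ K (par c' u)].
have oA : open A by exact: open_overlap.
have oA' : open A'.
  rewrite openE => u [iu nKu]; apply: filterI.
    by apply: open_nbhs_nbhs; split => //; exact: open_im.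
  have pc := par_continuous iu.
  apply: (pc (~` K)); apply: open_nbhs_nbhs; split => //.
  exact: closed_openC.
have AA' : im c' `<=` A `|` A'.
  move=> _ [p c'p <-]; have [Kp|nKp] := pselect (K p).
    by left; exists p => //; split => //; exact: K_dom.
  by right; split; [exact: im_coor|rewrite /= coorK].
apply: (class_C_sub AA'); apply: class_C_setU.
  apply: (class_C_eq (f := g \o (coor c \o par c'))) => //.
    by move=> _ [p [c'p cp] <-] /=; rewrite patchE coorK // mem_set.
  apply: (class_C_comp (V := im c)) => //; first exact: open_im.
    by move=> _ [p [c'p cp] <-] /=; rewrite coorK //; exact: im_coor.
  by move=> j; apply: class_C_coord => //; exact: transition_smooth.
apply: class_C_eq (class_C_cst k _ (0 : R^o)) => // u [iu nKu].
rewrite /= patchE; case: ifPn => // /set_mem cu.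
by rewrite /= g0 ?coorK //; exact: im_coor.
Qed.

Lemma exists_bump p : exists b K, [/\ smooth 1 b, forall q, 0 <= b q, 0 < b p,
  compact K & K `<=` dom (chart_at S p) /\ forall q, ~ K q -> b q = 0].
Proof.
pose c := chart_at S p; pose u0 := pt S p.
have : \forall u \near u0, im c u.
  by apply: open_nbhs_nbhs; split; [exact: open_im|exact: in_im].
move=> /near_ball [r r0 rP].
(* The closed cube of half-side rho lies in the sup-norm ball of radius r, hence in the chart, and
   contains the Euclidean ball of radius rho that supports the bump function. *)
pose rho := r / 2; have rho0 : 0 < rho by rewrite divr_gt0.
pose Kb : set 'rV[R]_m := [set u | forall i, `[u0 ord0 i - rho, u0 ord0 i + rho]%classic (u ord0 i)].
have Kb_compact : compact Kb.
  apply: (@rV_compact R m (fun i => `[u0 ord0 i - rho, u0 ord0 i + rho]%classic)) => i.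
  exact: segment_compact.
have Kb_im : Kb `<=` im c.
  move=> u Ku; apply: rP; split => // i j; rewrite ord1 -ball_normE /= distrC.
  apply: (@le_lt_trans _ _ rho); last by rewrite /rho; lra.
  have := Ku j; rewrite /= in_itv /= => /andP [k1 k2].
  by rewrite ler_distl; apply/andP; split.
have Kb_supp u : bump_fun u0 rho u != 0 -> Kb u.
  move=> /(bump_fun_supp rho0) Hu i; rewrite /= in_itv /=.
  by have := Hu i; rewrite ler_distl.
have K_dom : par c @` Kb `<=` dom c by move=> _ [u Ku <-]; apply: par_dom; exact: Kb_im.
have K_compact : compact (par c @` Kb).
  apply: continuous_compact => //; apply: continuous_in_subspaceT => u /set_mem Ku.
  exact: par_continuous (Kb_im _ Ku).
exists ((bump_fun u0 rho \o coor c) \_ (dom c)), (par c @` Kb); split => //.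
- apply: smooth_ext0 K_compact K_dom _ _.
    by apply: class_C_sub (bump_fun_class u0 rho).
  move=> u iu nK; apply/eqP/negPn/negP => /Kb_supp Ku; apply: nK.
  by exists u.
- by move=> q; rewrite patchE; case: ifP => // _; exact: bump_fun_ge0.
- rewrite patchE mem_set; first exact: bump_fun_gt0.
  exact: chart_atP.
split => // q nKq; rewrite patchE; case: ifPn => // /set_mem cq.
apply/eqP/negPn/negP => /Kb_supp Kq; apply: nKq.
by exists (coor c q) => //; rewrite coorK.
Qed.

End BumpOnManifold.

Section Partition.
Context (R : realType) (m : nat) (M : ptopologicalType) (S : manifold R m M)
  (M_compact : compact [set: M]) (M_haus : hausdorff_space M).
Local Notation smooth k f := (smooth S k f).

(** Compactness leaves finitely many bump functions whose sum is positive everywhere; dividing by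
    that sum keeps the supports. *)
Lemma partition_of_unity : exists (s : seq M) (chi : M -> M -> R) (K : M -> set M),
  [/\ forall p, smooth 1 (chi p), forall q, \sum_(p <- s) chi p q = 1,
      forall p, compact (K p), forall p, K p `<=` dom (chart_at S p) &
      forall p q, ~ K p q -> chi p q = 0].
Proof.
have [b /choice[K bK]] := choice (exists_bump S M_haus).
have b1 p : smooth 1 (b p) by have [] := bK p.
have b_ge0 p q : 0 <= b p q by have [_ ->] := bK p.
have b_gt0 p : 0 < b p p by have [] := bK p.
have cover_M : [set: M] `<=` cover [set: M] (fun p => [set q | 0 < b p q]).
  by move=> p _; exists p => //; exact: b_gt0.
have b_open p : [set: M] p -> open [set q | 0 < b p q].
  move=> _; have /continuousP := smooth_continuous (b1 p).
  by move=> /(_ [set r | 0 < r]); apply; exact: open_gt.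
have M_cover := M_compact; rewrite compact_cover in M_cover.
have [s _ sP] := M_cover _ _ _ b_open cover_M.
pose t : seq M := finmap.enum_fset s.
pose B q := \sum_(p <- t) b p q.
have B_gt0 q : 0 < B q.
  have [p sp bpq] := sP q I.
  by rewrite /B (big_rem p (sp : p \in t)) ltr_wpDr // sumr_ge0.
exists t, (fun p q => b p q * (B q)^-1), K; split => //.
- move=> p; apply: smoothM => //; apply: smoothV; first by move=> q; rewrite gt_eqF.
  exact: smooth_sum.
- by move=> q; rewrite -mulr_suml -/(B q) divff // gt_eqF.
- by move=> p; have [_ _ _ cK _] := bK p.
- by move=> p; have [_ _ _ _ [sK _]] := bK p.
- by move=> p q nK; have [_ _ _ _ [_ b0]] := bK p; rewrite b0 // mul0r.
Qed.

End Partition.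

(** * The divergence theorem and the integral formula *)

Section DivergenceTheorem.
Context (R : realType) (m n : nat) (M : ptopologicalType).
Local Notation d := (n.+1 + 1)%N.
Local Notation E := 'rV[R]_d.
Context (S : manifold R m M) (x : M -> E) (imm : immersion S x)
  (M_compact : compact [set: M]) (M_haus : hausdorff_space M).
Context (mu : {measure set (g_sigma_algebraType (@open M)) -> \bar R})
  (mu_riem : riemannian_measure S x mu).
Context (e : M -> 'I_m -> E) (e_frame : forall p, tangent_frame S x p (e p)).
Local Notation smooth k f := (smooth S k f).
Local Notation D := (D S x).
Local Notation Pi := (Pi S x).
Local Notation Borel := (g_sigma_algebraType (@open M)).

(* With E the matrix of an orthonormal frame, E^T E is the tangent projection, so the
   metric J J^T is the square of the matrix J E^T. *)
Lemma det_metric_gt0 (c : chart S) u : im c u -> 0 < \det (metric (x \o par c) u).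
Proof.
move=> iu.
have free := @immersion_free _ _ _ _ _ _ imm c.
have PiE := Pi_chart imm iu.
have gram := frame_gram imm (e_frame (par c u)).
have JC := jac_Cmx free iu.
have := metric_unit free iu; rewrite unitmxE unitfE.
move: PiE gram JC; rewrite /metric.
move: (jac _ u) (Cmx _ u) (\matrix_i e (par c u) i) (Pi _) => J C Em PI -> gram JC.
have -> : J *m J^T = (J *m Em^T) *m (J *m Em^T)^T.
  by rewrite trmx_mul trmxK mulmxA -[J *m Em^T *m Em]mulmxA gram !mulmxA JC mul1mx.
by rewrite det_mulmx det_tr lt_def => -> /=; rewrite -expr2 sqr_ge0.
Qed.

Lemma integrable_Rsum (I : Type) (s : seq I) (F : I -> M -> R) :
  (forall i, mu.-integrable [set: Borel] (EFin \o F i)) ->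
  mu.-integrable [set: Borel] (EFin \o (fun p => \sum_(i <- s) F i p)) /\
  \int[mu]_p (\sum_(i <- s) F i p) = \sum_(i <- s) \int[mu]_p F i p.
Proof.
move=> iF; elim: s => [|i s [is_ IH]].
  have -> : (fun p => \sum_(i <- [::]) F i p) = cst 0 by apply/funext => p; rewrite big_nil.
  rewrite big_nil; split; first exact: integrable0.
  by rewrite /Rintegral integral0.
have -> : (fun p => \sum_(j <- i :: s) F j p) = (fun p => F i p + \sum_(j <- s) F j p).
  by apply/funext => p; rewrite big_cons.
split; last by rewrite big_cons RintegralD // IH.
have -> : EFin \o (fun p => F i p + \sum_(j <- s) F j p) =
    (EFin \o F i) \+ (EFin \o (fun p => \sum_(j <- s) F j p)) by [].
exact: integrableD.
Qed.

(** Cutting phi by the partition of unity leaves continuous pieces with compact support in a chart,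
    whose integrals over cubes are finite. *)
Lemma integrable_smooth phi : smooth 0 phi -> mu.-integrable [set: Borel] (EFin \o phi).
Proof.
move=> cphi; have [s [chi [K [chi1 sum1 K_compact K_dom chi0]]]] := partition_of_unity S M_compact M_haus.
have -> : phi = (fun p => \sum_(q <- s) chi q p * phi p).
  by apply/funext => p; rewrite -mulr_suml sum1 mul1r.
apply: (integrable_Rsum s _).1 => q.
have [L L_gt0 LP] := compact_rV_bound (coor_compact (K_compact q) (K_dom q)).
apply: (integral_chart imm mu_riem det_metric_gt0 (K_compact q) (K_dom q) L_gt0 LP _ _).1.
  by apply: smoothM => //; exact: smoothS.
by move=> p nK; rewrite chi0 // mul0r.
Qed.

(** The field itself is cut by the partition of unity, not its divergence. By additivity the
    derivatives of the cut-offs never have to be written out. *)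
Lemma divergence_theorem (V : 'I_d -> M -> R) : (forall a, smooth 1 (V a)) ->
  (forall p a, \sum_b Pi p a b * V b p = V a p) -> \int[mu]_p divergence S x V p = 0.
Proof.
move=> cV V_tan; have [s [chi [K [chi1 sum1 K_compact K_dom chi0]]]] := partition_of_unity S M_compact M_haus.
pose W q a p := chi q p * V a p.
have cW q a : smooth 1 (W q a) by exact: smoothM.
have -> : divergence S x V = (fun p => \sum_(q <- s) divergence S x (W q) p).
  apply/funext => p; rewrite exchange_big; apply: eq_bigr => a _ /=.
  rewrite -D_sum //; congr (D a _ p); apply/funext => y.
  by rewrite -mulr_suml sum1 mul1r.
have key q : mu.-integrable [set: Borel] (EFin \o divergence S x (W q)) /\
    \int[mu]_p divergence S x (W q) p = 0.
  apply: (divergence_chart imm M_haus mu_riem det_metric_gt0 (K_compact q) (K_dom q)) => //.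
    move=> p a; rewrite /W -V_tan mulr_sumr; apply: eq_bigr => b _.
    by rewrite mulrCA.
  by move=> a p nK; rewrite /W chi0 // mul0r.
rewrite (integrable_Rsum s (fun q => (key q).1)).2 big1 // => q _.
exact: (key q).2.
Qed.

End DivergenceTheorem.

Section Integrands.
Context (R : realType) (m n : nat) (M : ptopologicalType).
Local Notation E := 'rV[R]_(n.+1 + 1).
Context (S : manifold R m M) (x : M -> E) (imm : immersion S x) (m_gt0 : (0 < m)%N).
Context (e : M -> 'I_m -> E) (e_frame : forall p, tangent_frame S x p (e p)).
Context (nu : M -> 'I_(n.+1 - m) -> E) (nu_frame : forall p, normal_frame S x p (nu p)).
Context (f : M -> R) (f_C2 : smooth S 2 f).
Context (xi : M -> E) (xi_smooth : forall k, class_C_on S k xi)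
  (xi_normal : forall p, normal S x p (xi p)).
Local Notation smooth k f := (smooth S k f).
Local Notation smooth_mx k A := (smooth_mx S k A).

Lemma smooth_dot k (v w : M -> E) : smooth_mx k v -> smooth_mx k w ->
  smooth k (fun p => dot (v p) (w p)).
Proof. by move=> cv cw; apply: (smooth_mx_mul cv (smooth_mx_tr cw)). Qed.

Lemma smooth_T k : smooth_mx k (T S x).
Proof.
have -> : T S x = (fun p => d_t R n *m Pi S x p) by apply/funext => p; exact: TE.
by apply: smooth_mx_mul; [exact: smooth_mx_cst|exact: smooth_Pi].
Qed.

Lemma smooth_N k : smooth_mx k (N S x).
Proof.
have -> : N S x = (fun p => d_t R n *m Q S x p) by apply/funext => p; exact: NE.
by apply: smooth_mx_mul; [exact: smooth_mx_cst|exact: smooth_Q].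
Qed.

Lemma smooth_box_star k : smooth k (box_star S x e xi).
Proof.
have -> : box_star S x e xi = (fun p => \sum_a \tr (P_form S x a p *m (nhess_form S x xi a p)^T)).
  by apply/funext => p; exact: (box_starE imm m_gt0 (e_frame p) xi_smooth).
have cN := smooth_Nxi imm xi_smooth; have cPi := smooth_Pi imm.
apply: smooth_sum => a; apply: smooth_tr; apply: smooth_mx_mul; first exact: smooth_P_form.
apply: smooth_mx_tr; apply: smooth_mx_mul; last exact: smooth_Q.
apply: smooth_mxD; first exact: (smooth_Dm imm a (cN k.+1)).
by apply: smooth_mxN; apply: smooth_mx_mul (cN k); exact: (smooth_Dm imm a (cPi k.+1)).
Qed.

Lemma smooth_dot_box : smooth 0 (fun p => dot (box S x e nu f p) (xi p)).
Proof.
have -> : (fun p => dot (box S x e nu f p) (xi p)) =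
    (fun p => \sum_a \tr (P_form S x a p *m (xi p)^T *m (hess_col S x f a p)^T)).
  by apply/funext => p; exact: (boxE imm m_gt0 (e_frame p) f_C2 (nu_frame p)).
have cDf := smooth_Df imm f_C2.
have cDf0 : smooth_mx 0 (Df S x f) by move=> r s; exact: smoothS (cDf r s).
apply: smooth_sum => a; apply: smooth_tr; apply: smooth_mx_mul.
  by apply: smooth_mx_mul; [exact: smooth_P_form|apply: smooth_mx_tr; exact: smooth_xi].
apply: smooth_mx_tr; apply: smooth_mxD; first exact: (smooth_Dm imm a cDf).
by apply: smooth_mxN; apply: smooth_mx_mul cDf0; exact: (smooth_Dm imm a (smooth_Pi imm 1)).
Qed.

Lemma smooth_last_integrand : smooth 0 (fun p =>
  f p * dot (nconn S x p (T S x p) xi) (N S x p) - dot (N S x p) (xi p) * dot (grad S x f p) (T S x p)).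
Proof.
have cf0 : smooth 0 f by do 2 apply: smoothS.
have cT := smooth_T 0; have cN := smooth_N 0; have cxi := smooth_xi xi_smooth 0.
have cgrad : smooth_mx 0 (grad S x f).
  have -> : grad S x f = (fun p => (Df S x f p)^T) by apply/funext => p; exact: gradE.
  by apply: smooth_mx_tr => r s; apply: smoothS; exact: (smooth_Df imm f_C2).
have cnconn : smooth_mx 0 (fun p => nconn S x p (T S x p) xi).
  have -> : (fun p => nconn S x p (T S x p) xi) = (fun p => T S x p *m Nxi S x xi p).
    by apply/funext => p; exact: nconnE.
  by apply: smooth_mx_mul => //; exact: smooth_Nxi.
apply: smoothB; first exact: smoothM cf0 (smooth_dot cnconn cN).
exact: smoothM (smooth_dot cN cxi) (smooth_dot cgrad cT).
Qed.

End Integrands.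

Theorem lemma4p1 (R : realType) (m n : nat) (M : ptopologicalType)
    (S : manifold R m M) (x : M -> 'rV[R]_(n.+1 + 1))
    (mu : {measure set (g_sigma_algebraType (@open M)) -> \bar R})
    (m_gt0 : (0 < m)%N)
    (M_compact : compact [set: M])
    (M_hausdorff : hausdorff_space M)
    (x_immersion : immersion S x)
    (mu_riemannian : riemannian_measure S x mu)
    (e : M -> 'I_m -> 'rV[R]_(n.+1 + 1))
    (nu : M -> 'I_(n.+1 - m) -> 'rV[R]_(n.+1 + 1))
    (e_frame : forall p, tangent_frame S x p (e p))
    (nu_frame : forall p, normal_frame S x p (nu p))
    (f : M -> R) (xi : M -> 'rV[R]_(n.+1 + 1))
    (f_C2 : class_C_on S 2 (f : M -> R^o))
    (xi_smooth : forall k, class_C_on S k xi)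
    (xi_normal : forall p, normal S x p (xi p)) :
  \int[mu]_p (f p * box_star S x e xi p) =
  \int[mu]_p dot (box S x e nu f p) (xi p) +
  (m%:R - 1) *
    \int[mu]_p (f p * dot (nconn S x p (T S x p) xi) (N S x p)
                - dot (N S x p) (xi p) * dot (grad S x f p) (T S x p)).
Proof.
have cf0 : smooth S 0 f by do 2 apply: smoothS.
have c1 := smoothM cf0 (smooth_box_star x_immersion m_gt0 e_frame xi_smooth 0).
have c2 := smooth_dot_box x_immersion m_gt0 e_frame nu_frame f_C2 xi_smooth xi_normal.
have c3 := smooth_last_integrand x_immersion f_C2 xi_smooth.
have c4 := smoothM (@smooth_cst _ _ _ S 0 (m%:R - 1)) c3.
have int := integrable_smooth x_immersion M_compact M_hausdorff mu_riemannian e_frame.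
have div0 := divergence_theorem x_immersion M_compact M_hausdorff mu_riemannian e_frame
  (smooth_flux x_immersion xi_smooth f_C2)
  (fun p a => flux_tangent x_immersion xi f a p).
have divE : divergence S x (flux S x xi f) = (fun p =>
    (f p * box_star S x e xi p - dot (box S x e nu f p) (xi p))
    - (m%:R - 1) * (f p * dot (nconn S x p (T S x p) xi) (N S x p)
                    - dot (N S x p) (xi p) * dot (grad S x f p) (T S x p))).
  apply/funext => p.
  exact: (div_flux x_immersion m_gt0 xi_smooth xi_normal f_C2 (e_frame p) (nu_frame p)).
(* The real integral is additive on integrable functions, so each summand is first known to be
   continuous; then the vanishing integral of the divergence splits into the three integrals of the
   formula. *)
move: div0; rewrite divE RintegralB //; [|exact: int (smoothB c1 c2)|exact: int c4].
rewrite RintegralB //; [|exact: int c1|exact: int c2].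
rewrite RintegralZl //; last exact: int c3.
by move=> /eqP; rewrite subr_eq0 subr_eq addrC => /eqP.
Qed.
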